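(* Let $u$ be the solution of the biharmonic problem $\Delta^2u=f$ in $\Omega$, $u=0$ and $\frac{\partial u}{\partial\mathbf n}=0$ on $\partial\Omega$, let $\varphi=-\Delta u$ and assume $\varphi\in H^2(\Omega)$. Let $(\varphi_h,u_h)\in V_h\times V_h^0$ be the solution of the stabilizer-free weak Galerkin scheme, and define $\varepsilon_u=\Pi_h^Ru-u_h$ and $\varepsilon_\varphi=\Pi_h^N\varphi-\varphi_h$. Then $$a(\varepsilon_\varphi,\phi_h)-b(\phi_h,\varepsilon_u)=E(\varphi,u,\phi_h)\qquad\forall\,\phi_h\in V_h,$$ $$b(\varepsilon_\varphi,\psi_h)=0\qquad\forall\,\psi_h\in V_h^0,$$ where $$E(\varphi,u,\phi_h)=a(\Pi_h^N\varphi-\varphi,\phi_h)+(\nabla_w\phi_h,\nabla_w(u-\Pi_h^Ru))_{\mathcal T_h}+l(u,\phi_h).$$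
   Context: $\Omega\subset\mathbb R^d$, $d=2$, is a bounded polygonal domain with Lipschitz boundary and unit outward normal $\mathbf n$; $f\in L^2(\Omega)$. $\mathcal T_h$ is a shape-regular partition of $\Omega$ into polygons $T$, $\mathcal E_h$ the set of its edges, $h_T$ the diameter of $T$. $(\cdot,\cdot)_T$, $\langle\cdot,\cdot\rangle_{\partial T}$ are $L^2$ inner products on $T$, $\partial T$; $(v,w)_{\mathcal T_h}=\sum_T(v,w)_T$, $\langle v,w\rangle_{\partial\mathcal T_h}=\sum_T\langle v,w\rangle_{\partial T}$ (on $\partial T$, $\mathbf n$ is the unit outward normal of $T$). Fix an integer $k\ge1$. $V_h=\{v=\{v_0,v_b\}: v_0|_T\in P_k(T),\ v_b|_e\in P_k(e),\ T\in\mathcal T_h,\ e\in\mathcal E_h\}$ ($P_k$: polynomials of degree at most $k$), $V_h^0=\{v\in V_h: v_b|_e=0 \text{ for } e\subset\partial\Omega\}$, $\overline V_h=\{v\in V_h:\int_\Omega v_0\,dx=0\}$, $\overline H^1(\Omega)=\{v\in H^1(\Omega):\int_\Omega v\,dx=0\}$. A function $v\in H^1(\Omega)$ is identified with $\{v|_T,v|_{\partial T}\}$. For $v\in V_h+H^1(\Omega)$, $\nabla_wv|_T\in[P_j(T)]^d$ is defined by $(\nabla_wv,\mathbf q)_T=-(v_0,\nabla\cdot\mathbf q)_T+\langle v_b,\mathbf q\cdot\mathbf n\rangle_{\partial T}$ for all $\mathbf q\in[P_j(T)]^d$, where $j=N+k-1$ and $N$ is the number of edges of the polygon $T$. $\mathbb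 Q_h$ is the elementwise $L^2$ projection onto $[P_j(T)]^d$. $a(w,v)=(w_0,v_0)_{\mathcal T_h}+\sum_Th_T\langle w_0-w_b,v_0-v_b\rangle_{\partial T}$, $b(v,\psi)=(\nabla_wv,\nabla_w\psi)_{\mathcal T_h}$, and $l(v,\psi)=\langle(\mathbb Q_h\nabla v-\nabla v)\cdot\mathbf n,\psi_0-\psi_b\rangle_{\partial\mathcal T_h}$. Scheme: find $(\varphi_h,u_h)\in V_h\times V_h^0$ with $a(\varphi_h,v)-b(v,u_h)=0$ for all $v\in V_h$ and $b(\varphi_h,\psi)=(f,\psi_0)$ for all $\psi\in V_h^0$. Ritz projection: for $v\in H_0^1(\Omega)\cap H^2(\Omega)$, $\Pi_h^Rv\in V_h^0$ satisfies $(\nabla_w\Pi_h^Rv,\nabla_w\psi)_{\mathcal T_h}=(-\Delta v,\psi_0)_{\mathcal T_h}$ for all $\psi\in V_h^0$. Neumann projection: for $v\in\overline H^1(\Omega)\cap H^2(\Omega)$, $\Pi_h^Nv\in\overline V_h$ satisfies $(\nabla_w\Pi_h^Nv,\nabla_w\psi)_{\mathcal T_h}=(-\Delta v,\psi_0)_{\mathcal T_h}+\langle\nabla v\cdot\mathbf n,\psi_b\rangle_{\partial\Omega}$ for all $\psi\in V_h$. (Here $\int_\Omega\varphi\,dx=-\int_{\partial\Omega}\frac{\partial u}{\partial\mathbf n}\,ds=0$, so $\Pi_h^N\varphi$ is defined.) *)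

(* Defs.v *)
From HB Require Import structures.
From mathcomp Require Import all_boot all_order all_algebra.
From mathcomp Require Import all_classical all_reals all_analysis.

Set Implicit Arguments.
Unset Strict Implicit.
Unset Printing Implicit Defensive.

Import Order.TTheory GRing.Theory Num.Theory.
Import numFieldNormedType.Exports.

Local Open Scope classical_set_scope.
Local Open Scope ring_scope.

Notation plane R := (measurableTypeR R * measurableTypeR R)%type.

Section Plane.
Context {R : realType}.
Implicit Types (x y : plane R) (f : plane R -> R) (i : 'I_2).

Definition mu1 : {measure set (measurableTypeR R) -> \bar R} :=
  @lebesgue_measure R.

Definition mu2 : {measure set (plane R) -> \bar R} :=
  (@lebesgue_measure R \x @lebesgue_measure R)%E.

Definition coord x i : R := if i == ord0 then x.1 else x.2.

Definition unit_vec i : R * R := ((i == ord0)%:R, (i != ord0)%:R).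

Definition dot x y : R := \sum_(i < 2) coord x i * coord y i.

(* The norm of the library on [R * R] is the sup norm; lengths, diameters and
   unit normals need the Euclidean one. *)
Definition enorm x : R := Num.sqrt (dot x x).

Definition vadd x y : plane R := (x.1 + y.1, x.2 + y.2).
Definition vsub x y : plane R := (x.1 - y.1, x.2 - y.2).
Definition vscale (r : R) x : plane R := (r * x.1, r * x.2).

Definition diam (D : set (plane R)) : R :=
  sup [set r | exists x y, [/\ D x, D y & r = enorm (vsub x y)]].

Definition pderiv i f : plane R -> R :=
  fun x => 'D_(unit_vec i) (f : R * R -> R) x.

Fixpoint Cn (m : nat) f : Prop :=
  continuous (f : R * R -> R) /\
  if m is m'.+1 then
    forall i, (forall x : R * R, derivable (f : R * R -> R) x (unit_vec i)) /\
              Cn m' (pderiv i f)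
  else True.

Definition smooth f : Prop := forall m, Cn m f.

Definition test_function (D : set (plane R)) f : Prop :=
  smooth f /\
  exists K : set (R * R),
    [/\ compact K, K `<=` D & forall x, ~ K x -> f x = 0].

End Plane.

Notation segment R := (plane R * plane R)%type.

Section Polygons.
Context {R : realType}.
Implicit Types (s : segment R) (D : set (plane R)).

Definition param s (t : R) : plane R := vadd s.1 (vscale t (vsub s.2 s.1)).

Definition segset s : set (plane R) := [set param s t | t in `[0, 1]].

Definition endpoints s : set (plane R) := [set x | x = s.1 \/ x = s.2].

Definition len s : R := enorm (vsub s.2 s.1).

(* The same segment, up to orientation. *)
Definition same_segment s s' : Prop := s = s' \/ s = (s'.2, s'.1).

(* Integral over a segment with respect to arc length. *)
Definition eint s (f : plane R -> R) : R :=
  len s * \int[mu1]_(t in `[0, 1]) f (param s t).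

(* One of the two unit normals of [s]. *)
Definition snormal s : plane R :=
  vscale (len s)^-1 (s.2.2 - s.1.2, s.1.1 - s.2.1).

(* Near each relative interior point of [s], the vector [nu] points out of [D]
   and its opposite points into [D]. *)
Definition points_outward D s (nu : plane R) : Prop :=
  forall t, 0 < t < 1 -> exists2 d : R, 0 < d &
    forall r, 0 < r < d ->
      D (vsub (param s t) (vscale r nu)) /\
      ~ D (vadd (param s t) (vscale r nu)).

Definition onormal D s : plane R :=
  if `[< points_outward D s (snormal s) >] then snormal s
  else vscale (-1) (snormal s).

Definition boundary D : set (plane R) :=
  closure (D : set (R * R)) `\` (D : set (R * R))°.

Definition bounded_domain D : Prop :=
  [/\ open (D : set (R * R)), connected (D : set (R * R)), D !=set0 &
      bounded_set (D : set (R * R))].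

(* In suitable orthonormal coordinates around any boundary point, D is locally
   the strict hypograph of a Lipschitz function. *)
Definition lipschitz_boundary D : Prop :=
  forall x, boundary D x -> exists (tau nu : plane R) (g : R -> R) (L r h : R),
    [/\ enorm tau = 1, enorm nu = 1 & dot tau nu = 0] /\
    [/\ 0 < r, 0 < h, forall a b, `|g a - g b| <= L * `|a - b| &
        forall a b, `|a| < r -> `|b| < h ->
          (D (vadd x (vadd (vscale a tau) (vscale b nu))) <-> b < g a)].

Definition polygonal_domain D : Prop :=
  bounded_domain D /\
  exists S : seq (segment R), boundary D = \bigcup_(s in [set` S]) segset s.

(* Two distinct segments of a family only meet at common endpoints. *)
Definition meet_at_endpoints s s' : Prop :=
  segset s `&` segset s' `<=` endpoints s `&` endpoints s'.

Definition sides_of (p : seq (plane R)) : seq (segment R) := zip p (rot 1 p).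

(* [D] is the open polygon bounded by the simple closed chain through the
   vertices [p]; an angle may be flat, so that a hanging node of a mesh counts
   as a vertex. *)
Definition polygon (p : seq (plane R)) D : Prop :=
  [/\ bounded_domain D, (2 < size p)%N && uniq p,
      boundary D = \bigcup_(s in [set` sides_of p]) segset s,
      {in sides_of p &, forall s s', s != s' -> meet_at_endpoints s s'} &
      {in sides_of p, forall s, points_outward D s (snormal s) \/
                                points_outward D s (vscale (-1) (snormal s))}].

End Polygons.

Section Sobolev.
Context {R : realType}.

Definition L2 d (T : measurableType d) (mu : {measure set T -> \bar R})
    (A : set T) (f : T -> R) : Prop :=
  measurable_fun A f /\ (\int[mu]_(x in A) ((f x) ^+ 2)%:E < +oo)%E.

Definition L2_cvg d (T : measurableType d) (mu : {measure set T -> \bar R})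
    (A : set T) (w : nat -> T -> R) (f : T -> R) : Prop :=
  (fun n => \int[mu]_(x in A) ((w n x - f x) ^+ 2)%:E)%E @ \oo --> 0%E.

Implicit Types (D : set (plane R)) (v g : plane R -> R).

Definition is_weak_deriv D (i : 'I_2) v g : Prop :=
  forall eta, test_function D eta ->
    \int[mu2]_(x in D) (v x * pderiv i eta x) =
    - \int[mu2]_(x in D) (g x * eta x).

(* The square integrable weak derivative, when there is one; it is only
   determined almost everywhere. *)
Definition wderiv D (i : 'I_2) v : plane R -> R :=
  xget (fun=> 0) [set g | L2 mu2 D g /\ is_weak_deriv D i v g].

Definition H1 D v : Prop :=
  L2 mu2 D v /\
  forall i, exists g, L2 mu2 D g /\ is_weak_deriv D i v g.

Definition H2 D v : Prop := H1 D v /\ forall i, H1 D (wderiv D i v).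

Definition neg_laplacian D v : plane R -> R :=
  fun x => - \sum_(i < 2) wderiv D i (wderiv D i v) x.

Definition bilaplacian D v : plane R -> R :=
  neg_laplacian D (neg_laplacian D v).

(* [g] is the trace of [v \in H1(D)] on the segments of [S]: the limit, in L2
   of each segment, of the restrictions of functions that are smooth on the
   whole plane and converge to [v] in H1(D). *)
Definition is_trace D (S : set (segment R)) v g : Prop :=
  (forall s, S s -> L2 mu1 `[0, 1] (g \o param s)) /\
  exists w : nat -> plane R -> R,
    [/\ forall n, smooth (w n),
        L2_cvg mu2 D w v,
        forall i, L2_cvg mu2 D (fun n => pderiv i (w n)) (wderiv D i v) &
        forall s, S s ->
          L2_cvg mu1 `[0, 1] (fun n => w n \o param s) (g \o param s)].

Definition trace D (S : set (segment R)) v : plane R -> R :=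
  xget (fun=> 0) [set g | is_trace D S v g].

Definition boundary_segments D : set (segment R) :=
  [set s | s.1 <> s.2 /\ segset s `<=` boundary D].

Definition vanishes_on_boundary D v : Prop :=
  is_trace D (boundary_segments D) v (fun=> 0).

Definition normal_derivative_vanishes D v : Prop :=
  exists g : 'I_2 -> plane R -> R,
    (forall i, is_trace D (boundary_segments D) (wderiv D i v) (g i)) /\
    forall s, boundary_segments D s ->
      {ae mu1, forall t, t \in `[0, 1] ->
        \sum_(i < 2) g i (param s t) * coord (onormal D s) i = 0}.

Definition biharmonic_solution D (f u : plane R -> R) : Prop :=
  [/\ H2 D u,
      {ae mu2, forall x, D x -> bilaplacian D u x = f x},
      vanishes_on_boundary D u &
      normal_derivative_vanishes D u].

End Sobolev.

Record mesh (R : realType) := Mesh {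
  cell : finType;
  edge : finType;
  dom : cell -> set (plane R);
  ends : edge -> segment R;
  sides : cell -> {set edge}
}.

Section Meshes.
Context {R : realType}.
Variables (Omega : set (plane R)) (M : mesh R).

(* Cells are open sets, and edges closed segments. *)
Definition partition_of : Prop :=
  [/\ forall T : cell M, exists p,
        [/\ polygon p (dom T),
            {in sides_of p, forall s,
               exists2 e, e \in sides T & same_segment s (ends e)} &
            {in sides T, forall e,
               exists2 s, s \in sides_of p & same_segment s (ends e)}],
      forall T : cell M, dom T `<=` Omega,
      closure (Omega : set (R * R)) =
        \bigcup_(T : cell M) closure (dom T : set (R * R)),
      forall T T' : cell M, T != T' -> dom T `&` dom T' = set0 &
      forall e : edge M, exists T : cell M, e \in sides T] /\
  forall e e' : edge M, e != e' -> meet_at_endpoints (ends e) (ends e').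

Definition hT (T : cell M) : R := diam (dom T).

Definition hull3 (A B C : plane R) : set (plane R) :=
  [set x | exists a b c : R, [/\ 0 <= a, 0 <= b, 0 <= c & a + b + c = 1] /\
     x = vadd (vscale a A) (vadd (vscale b B) (vscale c C))].

(* The usual shape-regularity conditions for polygonal meshes in the weak
   Galerkin literature (Wang and Ye): area and edge lengths comparable to the
   diameter; on each side a triangle contained in the cell, of comparable
   height, and whose apex sees the side under an angle to its normal bounded
   away from the right angle; circumscribed shape-regular triangles with
   bounded overlap. One constant [rho] serves for all the bounds. *)
Definition shape_regular (rho : R) (K : nat) : Prop :=
  [/\ forall T : cell M, ((rho * hT T ^+ 2)%:E <= mu2 (dom T))%E,
      forall T : cell M, {in sides T, forall e, rho * hT T <= len (ends e)},
      forall T : cell M, {in sides T, forall e, exists A : plane R,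
        (forall t r, 0 < t < 1 -> 0 < r < 1 ->
           dom T (vadd A (vscale r (vsub (param (ends e) t) A)))) /\
        (forall t, 0 <= t <= 1 ->
           let z := vsub (param (ends e) t) A in
           rho * hT T <= dot z (onormal (dom T) (ends e)) /\
           rho * enorm z <= dot z (onormal (dom T) (ends e)))} &
      exists S : cell M -> set (plane R),
        [/\ forall T, exists A B C, S T = hull3 A B C,
            forall T, dom T `<=` S T,
            forall T, rho * diam (S T) <= hT T,
            forall T, ((rho * diam (S T) ^+ 2)%:E <= mu2 (S T))%E &
            forall T, (#|[set T' | `[< S T `&` S T' !=set0 >]]| <= K)%N]].

(* [v0 v T] is a function on the closed cell: its values on the open sides of
   [T] are those of the trace of the interior component from inside [T].
   [vb v e] is a function on the edge [e]. *)
Record wfun := WFun {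
  v0 : cell M -> plane R -> R;
  vb : edge M -> plane R -> R
}.

Definition wsub (v w : wfun) : wfun :=
  WFun (fun T x => v0 v T x - v0 w T x) (fun e x => vb v e x - vb w e x).

Definition skeleton : set (segment R) := range (@ends R M).

(* Identification of [v \in H1(Omega)] with its restrictions to the cells and
   to their boundaries. *)
Definition of_H1 (v : plane R -> R) : wfun :=
  WFun (fun T x => if `[< dom T x >] then v x else trace Omega skeleton v x)
       (fun _ => trace Omega skeleton v).

Definition polynomial2 (n : nat) (p : plane R -> R) : Prop :=
  exists c : nat -> nat -> R, forall x,
    p x = \sum_(a < n.+1) \sum_(b < n.+1 | (a + b <= n)%N)
            c a b * x.1 ^+ a * x.2 ^+ b.

Definition Vh (k : nat) (v : wfun) : Prop :=
  (forall T, exists2 p, polynomial2 k p &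
     forall x, closure (dom T : set (R * R)) x -> v0 v T x = p x) /\
  (forall e, exists2 p : {poly R}, (size p <= k.+1)%N &
     forall t, 0 <= t <= 1 -> vb v e (param (ends e) t) = p.[t]).

Definition boundary_edge (e : edge M) : bool :=
  `[< segset (ends e) `<=` boundary Omega >].

Definition Vh0 (k : nat) (v : wfun) : Prop :=
  Vh k v /\ forall e, boundary_edge e ->
    forall x, segset (ends e) x -> vb v e x = 0.

Definition Vhbar (k : nat) (v : wfun) : Prop :=
  Vh k v /\ \sum_(T : cell M) \int[mu2]_(x in dom T) v0 v T x = 0.

Definition ip (D : set (plane R)) (f g : plane R -> R) : R :=
  \int[mu2]_(x in D) (f x * g x).

Definition vfield : Type := 'I_2 -> plane R -> R.

Definition vip (D : set (plane R)) (F G : vfield) : R :=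
  \sum_(i < 2) ip D (F i) (G i).

Definition divergence (q : vfield) : plane R -> R :=
  fun x => \sum_(i < 2) pderiv i (q i) x.

Definition vdot (q : vfield) (n : plane R) : plane R -> R :=
  fun x => \sum_(i < 2) q i x * coord n i.

Definition jdeg (k : nat) (T : cell M) : nat := (#|sides T| + k - 1)%N.

Definition Pj (k : nat) (T : cell M) (q : vfield) : Prop :=
  forall i, polynomial2 (jdeg k T) (q i).

Definition eip (T : cell M) (e : edge M) (f : plane R -> R) (q : vfield) : R :=
  eint (ends e) (fun x => f x * vdot q (onormal (dom T) (ends e)) x).

Definition is_weak_gradient (k : nat) (v : wfun) (T : cell M) (G : vfield) :=
  Pj k T G /\ forall q, Pj k T q ->
    vip (dom T) G q =
    - ip (dom T) (v0 v T) (divergence q) + \sum_(e in sides T) eip T e (vb v e) q.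

Definition weak_gradient (k : nat) (v : wfun) (T : cell M) : vfield :=
  xget (fun _ _ => 0) [set G | is_weak_gradient k v T G].

Definition is_Qh (k : nat) (T : cell M) (F G : vfield) : Prop :=
  Pj k T G /\ forall q, Pj k T q -> vip (dom T) G q = vip (dom T) F q.

Definition Qh (k : nat) (T : cell M) (F : vfield) : vfield :=
  xget (fun _ _ => 0) [set G | is_Qh k T F G].

Definition form_a (w v : wfun) : R :=
  \sum_(T : cell M) ip (dom T) (v0 w T) (v0 v T) +
  \sum_(T : cell M) hT T * \sum_(e in sides T) eint (ends e)
     (fun x => (v0 w T x - vb w e x) * (v0 v T x - vb v e x)).

Definition form_b (k : nat) (v psi : wfun) : R :=
  \sum_(T : cell M) vip (dom T) (weak_gradient k v T) (weak_gradient k psi T).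

Definition grad (v : plane R -> R) : vfield := fun i => wderiv Omega i v.

Definition grad_trace (v : plane R -> R) : vfield :=
  fun i => trace Omega skeleton (wderiv Omega i v).

Definition form_l (k : nat) (v : plane R -> R) (psi : wfun) : R :=
  \sum_(T : cell M) \sum_(e in sides T)
    eip T e (fun x => v0 psi T x - vb psi e x)
            (fun i x => Qh k T (grad v) i x - grad_trace v i x).

(* The inner product of [f] with the interior component, cell by cell. *)
Definition load (f : plane R -> R) (psi : wfun) : R :=
  \sum_(T : cell M) ip (dom T) f (v0 psi T).

Definition wg_solution (k : nat) (f : plane R -> R) (phih uh : wfun) : Prop :=
  [/\ Vh k phih, Vh0 k uh,
      forall v, Vh k v -> form_a phih v - form_b k v uh = 0 &
      forall psi, Vh0 k psi -> form_b k phih psi = load f psi].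

Definition is_ritz_projection (k : nat) (v : plane R -> R) (P : wfun) : Prop :=
  Vh0 k P /\ forall psi, Vh0 k psi ->
    form_b k P psi = load (neg_laplacian Omega v) psi.

Definition is_neumann_projection (k : nat) (v : plane R -> R) (P : wfun) :
    Prop :=
  Vhbar k P /\ forall psi, Vh k psi ->
    form_b k P psi = load (neg_laplacian Omega v) psi +
      \sum_(e : edge M | boundary_edge e) eint (ends e)
        (fun x => vdot (grad_trace v) (onormal Omega (ends e)) x * vb psi e x).

Definition error_functional (k : nat) (phi u : plane R -> R)
    (PNphi PRu phih : wfun) : R :=
  form_a (wsub PNphi (of_H1 phi)) phih +
  form_b k phih (wsub (of_H1 u) PRu) +
  form_l k u phih.

End Meshes.

(* Main.v *)
Require Import Defs.
From HB Require Import structures.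
From mathcomp Require Import all_boot all_order all_algebra.
From mathcomp Require Import all_classical all_reals all_analysis.
From mathcomp Require Import measurable_realfun ring lra.

Set Implicit Arguments.
Unset Strict Implicit.
Unset Printing Implicit Defensive.
Import Order.TTheory GRing.Theory Num.Theory.
Import numFieldNormedType.Exports.
Local Open Scope classical_set_scope.
Local Open Scope ring_scope.

(** The error equations follow by linearity of the forms from two facts. The
    first one is that [-Delta phi = f] almost everywhere, so that both discrete
    functions tested with [psi] give [(f, psi_0)]; the boundary term of the
    Neumann projection disappears because [psi_b] vanishes there. The second one
    is the consistency identity
      [(phi, v_0) = b(v, u) + l(u, v)]      for all [v] in [V_h],
    which is the heart of the matter ([consistency]).

    On a cell [T], [v_0] is a polynomial [p], and integrating
    [phi = - div (grad u)] by parts against it gives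
    [(grad u, grad p) - <grad u . n, p>]. As [grad p] is a polynomial field of
    the degree of weak gradients, [grad u] may be replaced by its projection [Q]
    in the first term. Integrating by parts back, and testing the definition of
    the weak gradient of [v] with [Q], one finds
    [(Q, grad p) = (grad_w v, Q) + <p - v_b, Q . n>]. Here
    [(grad_w v, Q) = (grad_w v, grad u) = (grad_w v, grad_w u)], because the
    weak gradient of a function of H1 is the projection of its gradient
    ([weak_gradient_of_H1]). Hence the identity holds on [T] up to the term
    [- <grad u . n, v_b>] ([cell_consistency]). Summed over the cells, these
    terms cancel: an inner edge has opposite normals in its two cells, and on the
    boundary the normal derivative of [u] vanishes ([edge_fluxes_cancel]).

    Three bodies of facts support this computation.

    Integration by parts on a polygon. By Fubini and the fundamental theorem of
    calculus, it suffices to know the vertical slices of the polygon. The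
    indicator function of the polygon at a point is the signed number of sides
    above it ([region_winding]), so a slice contributes exactly the fluxes
    through the sides that it crosses; this is the divergence theorem for
    vertical fields, and transposing the plane gives the horizontal ones
    ([divergence_theorem]). Functions of H1 are reached by passing to the limit
    ([green_H1]).

    Traces. The trace of a function on the edges of the mesh is a chosen object,
    so its existence has to be proved. The boundary conditions on [u] come with
    smooth functions that approximate [u] and its partial derivatives in H1.
    Shape regularity puts a triangle behind each side of a cell, on which the
    divergence theorem yields a trace inequality ([cell_trace_inequality]): the
    approximations are then Cauchy sequences on all the edges, and they have a
    limit there ([trace_exists]). The same inequality shows that two traces of
    one function agree on a common segment ([trace_unique_ae]), which transports
    the boundary condition to the edges of the mesh.

    Finite-dimensional duality. Weak gradients and projections are chosen
    objects too; they exist because a linear functional on polynomials that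
    vanishes on those vanishing on the cell is represented by a polynomial
    ([polynomial_riesz]). *)

(** * Segments and polygonal regions *)

Section PlaneGeometry.
Context {R : realType}.
Implicit Types (s : segment R) (D : set (plane R)).

Lemma dotE (x y : plane R) : dot x y = x.1 * y.1 + x.2 * y.2.
Proof. by rewrite /dot big_ord_recl big_ord1 /coord. Qed.

Lemma param1E s t : (param s t).1 = s.1.1 + t * (s.2.1 - s.1.1).
Proof. by []. Qed.

Lemma param2E s t : (param s t).2 = s.1.2 + t * (s.2.2 - s.1.2).
Proof. by []. Qed.

Lemma plane_eq (x y : plane R) : x.1 = y.1 -> x.2 = y.2 -> x = y.
Proof. by case: x => ? ?; case: y => ? ? /= -> ->. Qed.

Lemma pair_continuous (T : topologicalType) (f g : T -> R) :
  continuous f -> continuous g -> continuous (fun t => (f t, g t) : R * R).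
Proof. by move=> cf cg t; apply: (@cvg_pair _ _ _ _ (nbhs (f t)) (nbhs (g t))); [exact: cf|exact: cg]. Qed.

Lemma affine_continuous (a b : R) : continuous (fun t : R => a + t * b).
Proof.
by move=> t; apply: cvgD; [exact: cvg_cst|apply: cvgM; [exact: cvg_id|exact: cvg_cst]].
Qed.

Lemma param_continuous s : continuous (param s : R -> R * R).
Proof. by apply: pair_continuous; exact: affine_continuous. Qed.

Lemma segset_compact s : compact (segset s : set (R * R)).
Proof.
rewrite (_ : segset s = (param s : R -> R * R) @` `[0, 1]); last first.
  by apply/seteqP; split => z /= [t /= tI <-]; exists t.
apply: continuous_compact; last exact: segment_compact.
exact/continuous_subspaceT/param_continuous.
Qed.

Lemma segset_closed s : closed (segset s : set (R * R)).
Proof. by apply: compact_closed; [exact: norm_hausdorff|exact: segset_compact]. Qed.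

Lemma boundaryE D : open (D : set (R * R)) ->
  boundary D = closure (D : set (R * R)) `\` D.
Proof. by move=> oD; rewrite /boundary; congr (_ `\` _); exact: (interior_id _).1. Qed.

(** The segment is connected, and an open set is relatively closed off its
    boundary. *)
Lemma segment_stays_inside D (A B : plane R) : open (D : set (R * R)) ->
  (forall t, 0 <= t <= 1 -> ~ boundary D (param (A, B) t)) -> D A -> D B.
Proof.
move=> oD nb DA.
have p0 : param (A, B) 0 = A.
  by apply: plane_eq; rewrite /= mul0r addr0.
have p1 : param (A, B) 1 = B.
  by apply: plane_eq; rewrite /= mul1r addrC subrK.
pose g : R -> R * R := param (A, B).
have cg : continuous g := @param_continuous (A, B).
have /seteqP[_ H] : `[0, 1]%classic `&` g @^-1` D = `[0, 1]%classic :> set R.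
  apply: (@segment_connected R 0 1).
  - by exists 0; split; [rewrite /= in_itv/= lexx ler01|rewrite /g /= p0].
  - by exists (g @^-1` D) => //; move/continuousP : cg; exact.
  - exists (g @^-1` closure (D : set (R * R))).
      by move/continuous_closedP : cg; apply; exact: closed_closure.
    apply/seteqP; split => t [/= tI Dt]; split => //.
      exact: subset_closure.
    apply: contrapT => nD; apply: (nb t); first by move: tI; rewrite in_itv.
    by rewrite boundaryE.
have [//|_] := H 1; first by rewrite /= in_itv/= lexx ler01.
by rewrite /= /g p1.
Qed.

Definition is_normal s (nu : plane R) :=
  nu = snormal s \/ nu = vscale (-1) (snormal s).

(** What the divergence theorem needs to know of a polygon: a bounded open set
    whose boundary is a finite family of segments that meet only at endpoints,
    each with the set on exactly one side. Cells, triangles and their mirror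
    images are all of this kind. *)
Record polygonal_region (I : finType) (E : {set I}) (S : I -> segment R)
    (nu : I -> plane R) (D : set (plane R)) : Prop := PolygonalRegion {
  region_open : open (D : set (R * R));
  region_bounded : bounded_set (D : set (R * R));
  region_boundary : boundary D = \bigcup_(e in [set` E]) segset (S e);
  region_meet : {in E &, forall e e', e != e' -> meet_at_endpoints (S e) (S e')};
  region_nondegenerate : {in E, forall e, (S e).1 <> (S e).2};
  region_normal : {in E, forall e, is_normal (S e) (nu e)};
  region_outward : {in E, forall e, points_outward D (S e) (nu e)} }.

Lemma len_gt0 s : s.1 <> s.2 -> 0 < len s.
Proof.
move=> s12; rewrite /len /enorm sqrtr_gt0 dotE /= lt_neqAle.
rewrite addr_ge0 -?expr2 ?sqr_ge0// andbT eq_sym paddr_eq0 ?sqr_ge0//.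
rewrite !sqrf_eq0 !subr_eq0; apply/negP => /andP[/eqP a /eqP b].
by apply: s12; apply: plane_eq.
Qed.

Lemma sqr_len s : len s ^+ 2 = (s.2.1 - s.1.1) ^+ 2 + (s.2.2 - s.1.2) ^+ 2.
Proof.
rewrite /len /enorm sqr_sqrtr dotE /= -?expr2//.
by rewrite addr_ge0 ?sqr_ge0.
Qed.

Lemma normal_len s nu : s.1 <> s.2 -> is_normal s nu ->
  (len s * nu.1 = s.2.2 - s.1.2 /\ len s * nu.2 = s.1.1 - s.2.1) \/
  (len s * nu.1 = s.1.2 - s.2.2 /\ len s * nu.2 = s.2.1 - s.1.1).
Proof.
move=> /len_gt0 l0 [] -> /=; [left|right];
  by split; rewrite ?mulN1r ?mulrN mulrA divff ?gt_eqF// mul1r ?opprB.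
Qed.

Lemma dot_normal_param s nu t u : s.1 <> s.2 -> is_normal s nu ->
  dot (vsub (param s t) (param s u)) nu = 0.
Proof.
move=> s12 hnu; apply: (mulfI (lt0r_neq0 (len_gt0 s12))); rewrite mulr0 dotE /=.
rewrite mulrDr ![len s * (_ * _)]mulrCA.
by case: (normal_len s12 hnu) => -[-> ->]; ring.
Qed.

Lemma normal_unit s nu : s.1 <> s.2 -> is_normal s nu -> dot nu nu = 1.
Proof.
move=> s12 hnu; have l0 := len_gt0 s12.
apply: (mulfI (expf_neq0 2 (lt0r_neq0 l0))); rewrite mulr1 {2}sqr_len dotE.
rewrite mulrDr (_ : len s ^+ 2 * _ = (len s * nu.1) ^+ 2); last by ring.
rewrite (_ : len s ^+ 2 * _ = (len s * nu.2) ^+ 2); last by ring.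
by case: (normal_len s12 hnu) => -[-> ->]; ring.
Qed.

Lemma closed_avoid (A : set (plane R)) (P : plane R) : closed (A : set (R * R)) ->
  ~ A P -> exists2 d : R, 0 < d & forall a b : R, `|a| < d -> `|b| < d ->
    ~ A (P.1 + a, P.2 + b).
Proof.
move=> cA nP.
have oA : open (~` A : set (R * R)) by exact: closed_openC.
have /nbhs_ballP[d /= d0 H] := open_nbhs_nbhs (conj oA nP : open_nbhs (P : R * R) _).
exists d => // a b ad bd; apply: H; split; rewrite /= /ball /=.
  by rewrite opprD addNKr normrN.
by rewrite opprD addNKr normrN.
Qed.

Section Region.
Context {I : finType} (E : {set I}) (S : I -> segment R) (nu : I -> plane R)
  (D : set (plane R)) (HD : polygonal_region E S nu D).

Lemma param_inj s t u : s.1 <> s.2 -> param s t = param s u -> t = u.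
Proof.
move=> s12 /[dup] /(congr1 fst) /= /addrI e1 /(congr1 snd) /= /addrI e2.
apply: contrapT => /eqP; rewrite -subr_eq0 => tu.
apply: s12; apply: plane_eq.
  by apply/eqP; rewrite eq_sym -subr_eq0 -(mulrI_eq0 _ (mulfI tu)) mulrBl e1 subrr.
by apply/eqP; rewrite eq_sym -subr_eq0 -(mulrI_eq0 _ (mulfI tu)) mulrBl e2 subrr.
Qed.

Lemma inner_not_endpoint s t : s.1 <> s.2 -> 0 < t < 1 ->
  ~ endpoints s (param s t).
Proof.
move=> s12 /andP[t0 t1] [] h.
  have := @param_inj s t 0 s12; rewrite h => /(_ _) t00.
  suff t_0 : t = 0 by rewrite t_0 ltxx in t0.
  by apply: t00; apply: plane_eq; rewrite /= mul0r addr0.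
have := @param_inj s t 1 s12; rewrite h => /(_ _) t00.
suff t_1 : t = 1 by rewrite t_1 ltxx in t1.
by apply: t00; apply: plane_eq; rewrite /= mul1r addrC subrK.
Qed.

(** Sides meet only at common endpoints. *)
Lemma inner_only_edge e e' t : e \in E -> e' \in E -> e != e' -> 0 < t < 1 ->
  ~ segset (S e') (param (S e) t).
Proof.
move=> eE e'E ee' t01 h.
have [|h1 _] := region_meet HD eE e'E ee' (t := param (S e) t).
  split => //; exists t => //=; move: t01; rewrite in_itv/=.
  by case/andP => /ltW -> /ltW ->.
exact: inner_not_endpoint (region_nondegenerate HD eE) t01 h1.
Qed.

(** At a point in the interior of a side, the region lies locally on one side:
    a small half disc misses the boundary, so its points are joined to those of
    the normal line inside or outside the region. *)
Lemma region_local e t (v : plane R) : e \in E -> 0 < t < 1 ->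
  0 < dot v (nu e) -> exists2 d : R, 0 < d & forall r, 0 < r < d ->
    D (vsub (param (S e) t) (vscale r v)) /\
    ~ D (vadd (param (S e) t) (vscale r v)).
Proof.
move=> eE t01 vnu; set P := param (S e) t.
have oD := region_open HD.
have ndeg := region_nondegenerate HD eE.
have hnu := region_normal HD eE.
pose others : set (R * R) := \bigcup_(e' in [set` E :\ e]) segset (S e').
have cO : closed others.
  apply: closed_bigcup; first exact: finite_finset.
  by move=> e' _; exact: segset_closed.
have nO : ~ others P.
  move=> [e' /=]; rewrite !inE => /andP[e'e e'E].
  by apply: inner_only_edge => //; rewrite eq_sym.
have [d1 d10 H1] := closed_avoid cO nO.
have [d2 d20 H2] := region_outward HD eE t01.
pose B : R := 1 + `|v.1| + `|v.2| + `|(nu e).1| + `|(nu e).2|.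
have B0 : 0 < B by rewrite !ltr_wpDr.
have nuu := normal_unit ndeg hnu.
(* a point near P strictly on one side of the line is not on the boundary *)
have key (w : plane R) : `|w.1| < d1 -> `|w.2| < d1 -> dot w (nu e) != 0 ->
    ~ boundary D (vadd P w).
  move=> w1 w2 wn; rewrite (region_boundary HD) => -[e' /= e'E h].
  have [ee'|ne] := eqVneq e' e.
    move: h; rewrite ee' => -[u _ hu].
    have := dot_normal_param u t ndeg hnu; rewrite hu => h0.
    move/eqP: wn; apply; rewrite -h0 !dotE /=.
    by rewrite -!/P; ring.
  by apply: (H1 w.1 w.2) => //; exists e' => //=; rewrite !inE ne.
exists (Num.min (d1 / B) (d2 / B)).
  by rewrite lt_min !divr_gt0.
move=> r /andP[r0]; rewrite lt_min !ltr_pdivlMr// => /andP[rd1 rd2].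
have [vB1 vB2 nB1 nB2] : [/\ `|v.1| <= B, `|v.2| <= B,
    `|(nu e).1| <= B & `|(nu e).2| <= B].
  have := (normr_ge0 v.1, normr_ge0 v.2, normr_ge0 (nu e).1, normr_ge0 (nu e).2).
  by rewrite /B => -[[[h1 h2] h3] h4]; split; lra.
have B1 : 1 <= B by rewrite /B -!addrA lerDl !addr_ge0.
have rd2' : r < d2 by rewrite (le_lt_trans _ rd2)// ler_peMr// ltW.
have small (a b u : R) : `|a| <= B -> `|b| <= B -> 0 <= u <= 1 ->
    `|r * (a + u * (b - a))| < d1.
  move=> aB bB /andP[u0 u1]; apply: le_lt_trans rd1.
  rewrite normrM gtr0_norm// ler_pM2l//.
  rewrite (_ : a + u * (b - a) = (1 - u) * a + u * b); last by ring.
  rewrite (le_trans (ler_normD _ _))// !normrM (ger0_norm u0).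
  rewrite ger0_norm ?subr_ge0//; have u1' : 0 <= 1 - u by rewrite subr_ge0.
  have := ler_wpM2l u1' aB; have := ler_wpM2l u0 bB; lra.
have pos u : 0 <= u <= 1 -> 0 < dot v (nu e) + u * (1 - dot v (nu e)).
  move=> /andP[u0 u1]; rewrite (_ : _ + _ = (1 - u) * dot v (nu e) + u); last by ring.
  have [->|u1'] := eqVneq u 1; first by rewrite subrr mul0r add0r.
  by rewrite ltr_pwDl// mulr_gt0// subr_gt0 lt_neqAle u1' u1.
have path (sg u : R) : sg = 1 \/ sg = -1 -> 0 <= u <= 1 ->
   ~ boundary D (vadd P (sg * (r * (v.1 + u * ((nu e).1 - v.1))),
                         sg * (r * (v.2 + u * ((nu e).2 - v.2))))).
  move=> sg1 u01; apply: key => /=.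
  - by case: sg1 => ->; rewrite ?mul1r ?mulN1r ?normrN small.
  - by case: sg1 => ->; rewrite ?mul1r ?mulN1r ?normrN small.
  - rewrite dotE /= (_ : _ + _ =
      sg * r * (dot v (nu e) + u * (dot (nu e) (nu e) - dot v (nu e)))).
      rewrite nuu !mulf_neq0// ?(gt_eqF r0) ?(gt_eqF (pos _ _))//.
      by case: sg1 => ->; rewrite ?oppr_eq0 oner_neq0.
    by rewrite !dotE; ring.
have [Din Dout] : D (vsub P (vscale r (nu e))) /\ ~ D (vadd P (vscale r (nu e))).
  by apply: H2; rewrite r0.
split.
- apply: segment_stays_inside Din => // u u01.
  rewrite (_ : param _ u = vadd P
    (-1 * (r * (v.1 + (1 - u) * ((nu e).1 - v.1))),
     -1 * (r * (v.2 + (1 - u) * ((nu e).2 - v.2))))).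
    by apply: path; [right|move: u01; lra].
  by apply: plane_eq; rewrite /=; ring.
- move=> h; apply: Dout; apply: segment_stays_inside h => // u u01.
  rewrite (_ : param _ u = vadd P
    (1 * (r * (v.1 + u * ((nu e).1 - v.1))),
     1 * (r * (v.2 + u * ((nu e).2 - v.2))))).
    by apply: path => //; left.
  by apply: plane_eq; rewrite /=; ring.
Qed.

(** Division by zero makes this parameter 0 for a vertical side, which is thus
    never crossed. *)
Definition crossing e (x : R) : R := (x - (S e).1.1) / ((S e).2.1 - (S e).1.1).
Definition crosses (x : R) : pred I := fun e => 0 < crossing e x < 1.
Definition height e (x : R) : R := (param (S e) (crossing e x)).2.

Definition generic_abscissa (x : R) : Prop :=
  {in E, forall e, x <> (S e).1.1 /\ x <> (S e).2.1}.

Lemma crosses_nonvertical e (x : R) : crosses x e -> (S e).1.1 != (S e).2.1.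
Proof.
by rewrite /crosses /crossing; apply: contraTneq => ->; rewrite subrr invr0 mulr0 ltxx.
Qed.

Lemma param_crossing e (x : R) : crosses x e -> param (S e) (crossing e x) = (x, height e x).
Proof.
move=> /crosses_nonvertical h; apply: plane_eq => //=.
by rewrite /crossing divfK ?subr_eq0 1?eq_sym// addrC subrK.
Qed.

Lemma boundary_crossing (x y : R) : generic_abscissa x ->
  boundary D (x, y) <-> exists e, [/\ e \in E, crosses x e & y = height e x].
Proof.
move=> gx; rewrite (region_boundary HD); split.
- move=> [e /= eE [t /= t01 ht]]; exists e; split=> //.
    have [x1 x2] := gx _ eE.
    have xE : x = (S e).1.1 + t * ((S e).2.1 - (S e).1.1) by rewrite -param1E ht.
    have h : (S e).2.1 - (S e).1.1 != 0.
      by apply/eqP => h; apply: x1; rewrite xE h mulr0 addr0.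
    rewrite /crosses /crossing {1 2}xE addrAC subrr add0r mulfK//.
    move: t01; rewrite in_itv/= => /andP[t0 t1]; rewrite !lt_neqAle t0 t1 !andbT.
    apply/andP; split; apply/eqP => h0; [apply: x1|apply: x2]; rewrite xE.
      by rewrite -h0 mul0r addr0.
    by rewrite h0 mul1r addrC subrK.
  have [x1 x2] := gx _ eE.
  have xE : x = (S e).1.1 + t * ((S e).2.1 - (S e).1.1) by rewrite -param1E ht.
  have h : (S e).2.1 - (S e).1.1 != 0.
    by apply/eqP => h; apply: x1; rewrite xE h mulr0 addr0.
  rewrite /height /crossing xE addrAC subrr add0r mulfK//.
  by rewrite -[y]/((x, y).2) -ht.
- move=> [e [eE ex ->]]; exists e => //; exists (crossing e x).
    by move: ex; rewrite /crosses /= in_itv/= => /andP[/ltW -> /ltW ->].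
  exact: param_crossing.
Qed.

Lemma height_inj e e' (x : R) : e \in E -> e' \in E -> crosses x e -> crosses x e' ->
  height e x = height e' x -> e = e'.
Proof.
move=> eE e'E ex e'x h; apply/eqP; apply: contrapT => /negP ne.
apply: (inner_only_edge eE e'E ne ex).
rewrite param_crossing// h -param_crossing//; exists (crossing e' x) => //=.
by move: e'x; rewrite /crosses in_itv/= => /andP[/ltW -> /ltW ->].
Qed.

Lemma vertical_path (x y y' : R) : y <= y' ->
  (forall z, y <= z <= y' -> ~ boundary D (x, z)) -> D (x, y) <-> D (x, y').
Proof.
move=> yy' nb; split; apply: segment_stays_inside; try exact: region_open HD.
- move=> t /andP[t0 t1].
  rewrite (_ : param _ t = (x, y + t * (y' - y))); last first.
    by apply: plane_eq; rewrite //= subrr mulr0 addr0.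
  have h : 0 <= y' - y by rewrite subr_ge0.
  apply: nb; have := mulr_ge0 t0 h; have := ler_wpM2r h t1; lra.
- move=> t /andP[t0 t1].
  rewrite (_ : param _ t = (x, y' + t * (y - y'))); last first.
    by apply: plane_eq; rewrite //= subrr mulr0 addr0.
  have h : 0 <= y' - y by rewrite subr_ge0.
  apply: nb; have := mulr_ge0 t0 h; have := ler_wpM2r h t1; lra.
Qed.

Lemma region_box : exists2 B : R, 0 < B & forall x y : R, D (x, y) -> `|x| < B /\ `|y| < B.
Proof.
have [B [_ HB]] := region_bounded HD.
exists (`|B| + 2) => [|x y Dxy]; first by rewrite ltr_wpDl.
have := HB (`|B| + 1); rewrite (le_lt_trans (ler_norm _)) ?ltrDl// => /(_ isT _ Dxy).
rewrite /= prod_normE ge_max => /andP[/= h1 h2].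
by split; [apply: (le_lt_trans h1)|apply: (le_lt_trans h2)]; rewrite ltrD2l ltr1n.
Qed.

(** The vertical ray upwards from a point leaves and enters the region at each
    side that it crosses, and it ends outside: the signs of the crossings add up
    to the indicator function of the region. *)
Lemma region_winding (x y : R) : generic_abscissa x -> ~ boundary D (x, y) ->
  (`[< D (x, y) >])%:R =
  \sum_(e in E | crosses x e && (y < height e x)) Num.sg (nu e).2 :> R.
Proof.
move=> gx.
pose A (y : R) := [set e in E | crosses x e && (y < height e x)].
suff H n : forall y, #|A y| = n -> ~ boundary D (x, y) ->
    (`[< D (x, y) >])%:R = \sum_(e in A y) Num.sg (nu e).2 :> R.
  move=> nb; rewrite (H _ y erefl nb); apply: eq_bigl => e.
  by rewrite !inE.
have bd z e : e \in E -> crosses x e -> z = height e x -> boundary D (x, z).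
  by move=> *; apply/(boundary_crossing _ gx); exists e.
(* Going up past the lowest side above y removes exactly that side. *)
elim: n => [|n IH] {}y.
  move=> /eqP; rewrite cards_eq0 => /eqP A0 nb; rewrite A0 big_set0.
  have [B B0 HB] := region_box.
  suff /asboolPn/negbTE-> : ~ D (x, y) by [].
  have [yB|By] := leP y B; last first.
    by move=> /HB[_]; rewrite ltNge (le_trans (ltW By) (ler_norm _)).
  rewrite (vertical_path (y' := B))//.
    by move=> /HB[_]; rewrite gtr0_norm// ltxx.
  move=> z /andP[yz zB] /(boundary_crossing _ gx)[e [eE ex ze]].
  have : e \in A y.
    rewrite inE eE ex /= -ze lt_neqAle yz andbT.
    by apply/eqP => yz'; apply: nb; rewrite yz'; exact: bd ze.
  by rewrite A0 inE.
move=> cA nb.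
have [e1 e1A] : exists e1, e1 \in A y.
  by apply/set0Pn; rewrite -cards_eq0 cA.
have [e0 e0A e0min] : exists2 e0, e0 \in A y &
    forall e, e \in A y -> height e0 x <= height e x.
  by have [e0 ? ?] := @arg_minP _ _ I e1 (mem (A y)) (height^~ x) e1A; exists e0.
move: (e0A); rewrite inE => /and3P[e0E e0x e0y].
pose h0 := height e0 x.
(* no other side is crossed right above e0 *)
have [d1 d10 H1] : exists2 d1, 0 < d1 &
    forall e, e \in A y :\ e0 -> h0 + d1 < height e x.
  pose d := \big[Num.min/1]_(e in A y :\ e0) (height e x - h0).
  have d0 : 0 < d.
    apply: (big_ind (fun z => 0 < z)) => [|a b a0 b0|e]; first exact: ltr01.
      by rewrite lt_min a0.
    rewrite in_setD1 subr_gt0 => /andP[ne eA]; rewrite lt_neqAle e0min// andbT.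
    move: eA; rewrite inE => /and3P[eE ex _].
    by apply: contra ne => /eqP /height_inj ->.
  exists (d / 2); first by rewrite divr_gt0.
  move=> e eA; have : d <= height e x - h0 by apply: bigmin_le_cond.
  by move: d0; lra.
pose sgn := Num.sg (nu e0).2.
have nu0 : (nu e0).2 != 0.
  have ndeg := region_nondegenerate HD e0E.
  have nv := crosses_nonvertical e0x.
  apply/eqP => n0; case: (normal_len ndeg (region_normal HD e0E)) => -[_];
    rewrite n0 mulr0 => /esym/eqP; rewrite subr_eq0.
    by rewrite (negbTE nv).
  by rewrite eq_sym (negbTE nv).
have [d2 d20 H2] : exists2 d, 0 < d & forall r, 0 < r < d ->
    D (x, h0 - r * sgn) /\ ~ D (x, h0 + r * sgn).
  have [|d d0 Hd] := @region_local e0 (crossing e0 x) (0, sgn) e0E e0x.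
    by rewrite dotE /= mul0r add0r /sgn -normrEsg normr_gt0.
  exists d => // r /Hd.
  rewrite param_crossing// (_ : vsub _ _ = (x, h0 - r * sgn)); last first.
    by rewrite /vsub /= mulr0 subr0.
  by rewrite (_ : vadd _ _ = (x, h0 + r * sgn)) // /vadd /= mulr0 addr0.
pose r := Num.min d1 (Num.min d2 (h0 - y)) / 2.
have m0 : 0 < Num.min d1 (Num.min d2 (h0 - y)) by rewrite !lt_min d10 d20 subr_gt0.
have r0 : 0 < r by rewrite divr_gt0.
have [r1 r2 r3] : [/\ r < d1, r < d2 & r < h0 - y].
  have : r < Num.min d1 (Num.min d2 (h0 - y)) by rewrite /r; move: m0; lra.
  by rewrite !lt_min => /and3P[].
have above z : h0 < z <= h0 + r -> ~ boundary D (x, z).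
  move=> /andP[hz zr] /(boundary_crossing _ gx)[e [eE ex ze]].
  have eA : e \in A y by rewrite inE eE ex -ze (lt_trans e0y).
  have [ee0|ne] := eqVneq e e0; first by move: hz; rewrite ze ee0 ltxx.
  have : h0 + d1 < height e x by apply: H1; rewrite in_setD1 ne.
  by rewrite -ze; move: zr r1; lra.
have below z : y <= z < h0 -> ~ boundary D (x, z).
  move=> /andP[yz zh] /(boundary_crossing _ gx)[e [eE ex ze]].
  have [yz'|yz'] := eqVneq y z; first by apply: nb; rewrite yz'; exact: bd ze.
  have eA : e \in A y by rewrite inE eE ex -ze lt_neqAle yz'.
  by have := e0min _ eA; rewrite leNgt -ze zh.
have Aup : A (h0 + r) = A y :\ e0.
  apply/setP => e; rewrite in_setD1 !inE.
  have [->|ne] := eqVneq e e0; first by rewrite /= -/h0 ltNge ltW ?ltrDl// !andbF.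
  rewrite /=; apply/idP/idP => /and3P[eE ex ey]; rewrite eE ex /=.
    by apply: lt_trans ey; rewrite (lt_trans e0y) ?ltrDl.
  have : h0 + d1 < height e x by apply: H1; rewrite in_setD1 ne inE eE ex.
  by move: r1; lra.
have cA' : #|A (h0 + r)| = n.
  by rewrite Aup; move: cA; rewrite (cardsD1 e0) e0A add1n => -[].
have IHr : (`[< D (x, h0 + r) >])%:R = \sum_(e in A (h0 + r)) Num.sg (nu e).2 :> R.
  by apply: IH => //; apply: above; rewrite ltrDl r0 lexx.
rewrite (big_setD1 e0)//= -Aup -IHr.
have -> : `[< D (x, y) >] = `[< D (x, h0 - r) >].
  apply: asbool_equiv_eq; apply: vertical_path; first by move: r3; lra.
  by move=> z /andP[yz zh]; apply: below; rewrite yz /=; move: zh r0; lra.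
have /H2[] : 0 < r < d2 by rewrite r0.
rewrite -/sgn /sgn; case: sgrP nu0 => // _ _; rewrite ?mulr1 ?mulrN1 ?opprK.
  by move=> /asboolT -> /asboolPn/negbTE ->; rewrite addr0.
by move=> /asboolT -> /asboolPn/negbTE ->; rewrite addrC subrr.
Qed.

End Region.
End PlaneGeometry.

(** * Measure and integration in the plane *)

Section PlaneMeasure.
Context {R : realType}.
Implicit Types (D : set (plane R)) (f g : plane R -> R).

(** The plane carries the product sigma-algebra; an open set is a countable
    union of rational boxes. *)
Lemma open_measurable_plane D : open (D : set (R * R)) -> measurable D.
Proof.
move=> oD.
pose box (q : rat * rat * rat) : set (plane R) :=
  `](ratr q.1.1 - ratr q.2), (ratr q.1.1 + ratr q.2)[%classic `*`
  `](ratr q.1.2 - ratr q.2), (ratr q.1.2 + ratr q.2)[%classic.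
pose F q := if `[< box q `<=` D >] then box q else set0.
suff -> : D = \bigcup_q F q.
  apply: countable_bigcupT_measurable; first exact: countableP.
  move=> q; rewrite /F; case: ifPn => // _.
  by apply: measurableX; exact: measurable_itv.
apply/seteqP; split => [z Dz|z [q _]]; last first.
  by rewrite /F; case: ifPn => // /asboolP; apply.
have /nbhs_ballP[e /= e0 H] := open_nbhs_nbhs (conj oD Dz : open_nbhs (z : R * R) _).
have [r] := @rat_in_itvoo R 0 (e / 2) ltac:(by rewrite divr_gt0).
rewrite in_itv /= => /andP[r0 re].
have [q1] := @rat_in_itvoo R (z.1 - ratr r) z.1 ltac:(by rewrite ltrBlDr ltrDl).
rewrite in_itv /= => /andP[q11 q12].
have [q2] := @rat_in_itvoo R (z.2 - ratr r) z.2 ltac:(by rewrite ltrBlDr ltrDl).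
rewrite in_itv /= => /andP[q21 q22].
exists (q1, q2, r) => //; rewrite /F asboolT.
  by split; rewrite /= in_itv /=; apply/andP; split; lra.
move=> w [/=]; rewrite !in_itv /= => /andP[a1 a2] /andP[b1 b2]; apply: H.
by split; rewrite /ball /= ltr_norml; apply/andP; split; lra.
Qed.

Lemma continuous_measurable_plane f : continuous (f : R * R -> R) ->
  measurable_fun [set: plane R] f.
Proof.
move=> cf; have oab (a b : R) : open (f @^-1` `]a, b[%classic : set (R * R)).
  by apply: open_comp => [x _|]; [exact: cf|exact: interval_open].
have mab (a b : R) : measurable (f @^-1` `]a, b[%classic).
  exact: open_measurable_plane.
apply: (measurability _ (RGenOpens.measurableE R)).
by move=> _ [_ [a [b ->]] <-]; rewrite setTI; exact: mab.
Qed.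

Lemma bounded_sub_box D : bounded_set (D : set (R * R)) ->
  exists2 B : R, 0 < B & D `<=` `[- B, B]%classic `*` `[- B, B]%classic.
Proof.
move=> [B [_ HB]]; exists (`|B| + 1) => [|x Dx]; first by rewrite ltr_wpDl.
have := HB (`|B| + 1); rewrite (le_lt_trans (ler_norm _)) ?ltrDl// => /(_ isT _ Dx).
rewrite /= prod_normE ge_max => /andP[/= h1 h2].
by split; rewrite /= in_itv/= -ler_norml.
Qed.

Lemma bounded_mu2_lty D : measurable D -> bounded_set (D : set (R * R)) ->
  (mu2 D < +oo)%E.
Proof.
move=> mD /bounded_sub_box[B B0 DB].
apply: (@le_lt_trans _ _ (mu2 (`[- B, B]%classic `*` `[- B, B]%classic : set (plane R)))).
  by apply: le_measure => //; rewrite inE//; apply: measurableX; exact: measurable_itv.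
have -> : mu2 (`[- B, B]%classic `*` `[- B, B]%classic : set (plane R)) =
    (mu1 `[(- B)%R, B]%classic * mu1 `[(- B)%R, B]%classic)%E.
  by apply: product_measure1E; exact: measurable_itv.
rewrite /mu1 /= lebesgue_measure_itv.
by case: ifP => _; rewrite ?mule0// -EFinD -EFinM ltry.
Qed.

Lemma continuous_bounded_on D f : bounded_set (D : set (R * R)) ->
  continuous (f : R * R -> R) -> exists2 C, 0 < C & forall x, D x -> `|f x| <= C.
Proof.
move=> /bounded_sub_box[B B0 DB] cf.
have cK : compact (`[- B, B]%classic `*` `[- B, B]%classic : set (R * R)).
  by apply: compact_setX; exact: segment_compact.
have : compact (f @` (`[- B, B]%classic `*` `[- B, B]%classic) : set R).
  by apply: continuous_compact => //; exact: continuous_subspaceT.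
move=> /compact_bounded[M [_ HM]]; exists (`|M| + 1) => [|x Dx].
  by rewrite ltr_wpDl.
by apply: HM; [rewrite (le_lt_trans (ler_norm _)) ?ltrDl|exists x => //; exact: DB].
Qed.

Lemma continuous_integrable_plane D f : measurable D ->
  bounded_set (D : set (R * R)) -> continuous (f : R * R -> R) ->
  mu2.-integrable D (EFin \o f).
Proof.
move=> mD bD cf; apply: measurable_bounded_integrable => //.
- exact: bounded_mu2_lty.
- by apply: measurable_funTS; exact: continuous_measurable_plane.
- have [C C0 HC] := continuous_bounded_on bD cf.
  exists C; split; first exact: num_real.
  by move=> M CM x Dx; apply: le_trans (HC _ Dx) (ltW CM).
Qed.

Lemma affine_substitution_lt (h : R -> R) (a b : R) : a < b -> continuous h ->
  (b - a) * \int[mu1]_(t in `[0, 1]) h (a + t * (b - a)) =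
  \int[mu1]_(x in `[a, b]) h x.
Proof.
move=> ab ch.
pose F (t : R) : R := a + t * (b - a).
have cF : continuous F := @affine_continuous R a (b - a).
have dFt (t : R) : is_derive t 1 F (b - a).
  have := is_deriveD (is_derive_cst a t 1) (is_deriveM (is_derive_id t 1) (is_derive_cst (b - a) t 1)).
  by move=> H; apply: is_derive_eq H _; rewrite add0r scaler0 add0r /GRing.scale/= mulr1.
have dF : derive1 F = cst (b - a).
  by apply/funext => t; rewrite derive1E; exact: (@derive_val _ _ _ _ _ _ _ (dFt t)).
have c1 (k : R) : continuous (cst k : R -> R) by move=> ?; exact: cvg_cst.
rewrite -RintegralZl//=; last first.
  apply: continuous_compact_integrable; first exact: segment_compact.
  by apply: continuous_subspaceT => t; apply: continuous_comp; [exact: cF|exact: ch].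
rewrite /Rintegral; congr fine.
have := @integration_by_substitution_increasing R F h 0 1 ler01.
rewrite /F mul0r addr0 mul1r [a + _]addrC subrK => -> //.
- apply: eq_integral => x _; congr EFin.
  by rewrite -/F dF; exact: mulrC.
- by move=> x y _ _ xy; rewrite ltrD2l ltr_pM2r// subr_gt0.
- by rewrite -/F dF => x _; exact: c1.
- by rewrite -/F dF; exact: is_cvg_cst.
- by rewrite -/F dF; exact: is_cvg_cst.
- split => [x _||].
  + exact: (@ex_derive _ _ _ _ _ _ _ (dFt x)).
  + by apply: cvg_at_right_filter; exact: (cF 0).
  + by apply: cvg_at_left_filter; exact: (cF 1).
- exact: continuous_subspaceT.
Qed.

Lemma integral01_reverse (h : R -> R) : continuous h ->
  \int[mu1]_(t in `[0, 1]) h (1 - t) = \int[mu1]_(t in `[0, 1]) h t.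
Proof.
move=> ch; have := @Rintegration_by_substitution_onem R h 1.
rewrite /unstable.onem subrr => H; apply/esym; apply: H.
- by rewrite ler01 lexx.
- exact: continuous_subspaceT.
Qed.

(** Min and max, because a side may be run from right to left. *)
Lemma affine_substitution (h : R -> R) (a b : R) : a != b -> continuous h ->
  `|b - a| * \int[mu1]_(t in `[0, 1]) h (a + t * (b - a)) =
  \int[mu1]_(x in `[Num.min a b, Num.max a b]) h x.
Proof.
move=> + ch; case: ltgtP => // ab _.
  by rewrite gtr0_norm ?subr_gt0// affine_substitution_lt//.
rewrite ltr0_norm ?subr_lt0// opprB -(affine_substitution_lt ab ch); congr (_ * _).
rewrite -integral01_reverse.
  by apply: eq_Rintegral => t _; congr h; ring.
by move=> t; apply: continuous_comp; [exact: affine_continuous|exact: ch].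
Qed.

Lemma pderiv_vertical f (i : 'I_2) (x y : R) : i != ord0 ->
  pderiv i f (x, y) = derive1 (fun y => f (x, y)) y.
Proof.
move=> i0; rewrite derive1E /pderiv /derive.
set F := (fun h => _); set G := (fun h => _); suff -> : F = G by [].
apply/funext => h; congr (_ *: (f _ - _)).
by rewrite /unit_vec (negbTE i0) /=; apply: plane_eq; rewrite /= ?scaler0 ?add0r.
Qed.

Lemma derivable_vertical f (i : 'I_2) (x y : R) : i != ord0 ->
  derivable (f : R * R -> R) (x, y) (unit_vec i) -> derivable (fun y => f (x, y)) y 1.
Proof.
move=> i0; rewrite /derivable.
set F := (fun h => _); set G := (fun h => _); suff -> : F = G by [].
apply/funext => h; congr (_ *: (f _ - _)).
by rewrite /unit_vec (negbTE i0) /=; apply: plane_eq; rewrite /= ?scaler0 ?add0r.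
Qed.

Lemma vertical_continuous f (x : R) : continuous (f : R * R -> R) ->
  continuous (fun y : R => f (x, y)).
Proof.
move=> cf y.
apply: (@continuous_comp _ _ _ (fun y : R => (x, y) : R * R)); last exact: cf.
by apply: (pair_continuous (f := cst x) (g := id)) => z; [exact: cvg_cst|exact: cvg_id].
Qed.

Lemma Rintegral_FTC (g G : R -> R) (a b : R) : a < b -> continuous g ->
  (forall x : R, is_derive x 1 G (g x)) ->
  \int[mu1]_(x in `[a, b]) g x = G b - G a.
Proof.
move=> ab cg dG.
have cG (x : R) : {for x, continuous G}.
  by apply: differentiable_continuous; apply/derivable1_diffP; exact: (@ex_derive _ _ _ _ _ _ _ (dG x)).
suff H : (\int[@lebesgue_measure R]_(x in `[a, b]) (g x)%:E = (G b)%:E - (G a)%:E)%E.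
  exact: (congr1 fine H).
apply: continuous_FTC2 => //.
- exact: continuous_subspaceT.
- split=> [x _||].
  + exact: (@ex_derive _ _ _ _ _ _ _ (dG x)).
  + by apply: cvg_at_right_filter; exact: cG.
  + by apply: cvg_at_left_filter; exact: cG.
- by move=> x _; rewrite derive1E; exact: (@derive_val _ _ _ _ _ _ _ (dG x)).
Qed.

Lemma vertical_FTC f (i : 'I_2) (x a b : R) : i != ord0 -> Cn 1 f -> a < b ->
  \int[mu1]_(y in `[a, b]) pderiv i f (x, y) = f (x, b) - f (x, a).
Proof.
move=> i0 [cf /(_ i)[df [cpf _]]] ab.
apply: (Rintegral_FTC (g := fun y => pderiv i f (x, y)) (G := fun y => f (x, y)) ab).
  exact: vertical_continuous.
move=> y; apply: DeriveDef; first exact: (derivable_vertical i0).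
by rewrite pderiv_vertical// derive1E.
Qed.

End PlaneMeasure.

(** * Square integrable functions *)

Section L2Tools.
Context d (T : measurableType d) (R : realType) (mu : {measure set T -> \bar R})
  (A : set T) (mA : measurable A).
Implicit Types f g : T -> R.
Local Notation int f := (mu.-integrable A (EFin \o f)).

Lemma integrable_add f g : int f -> int g -> int (fun x => f x + g x).
Proof. by move=> hf hg; exact: (integrableD mA hf hg). Qed.

Lemma integrable_scale (r : R) f : int f -> int (fun x => r * f x).
Proof. by move=> hf; exact: (integrableZl mA r hf). Qed.

Lemma integrable_bigsum (I : Type) (s : seq I) (P : pred I) (F : I -> T -> R) :
  (forall i, P i -> int (F i)) -> int (fun x => \sum_(i <- s | P i) F i x).
Proof.
move=> hF; elim: s => [|i s IH].
  by under eq_fun do rewrite big_nil; exact: integrable0.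
under eq_fun do rewrite big_cons.
by case: (boolP (P i)) => // Pi; apply: integrable_add => //; exact: hF.
Qed.

Lemma Rintegral_bigsum (I : Type) (s : seq I) (P : pred I) (F : I -> T -> R) :
  (forall i, P i -> int (F i)) ->
  \int[mu]_(x in A) (\sum_(i <- s | P i) F i x) =
  \sum_(i <- s | P i) \int[mu]_(x in A) F i x.
Proof.
move=> hF; elim: s => [|i s IH].
  under eq_fun do rewrite big_nil.
  by rewrite Rintegral_cst// mul0r big_nil.
under eq_fun do rewrite big_cons; rewrite big_cons; case: (boolP (P i)) => // Pi.
by rewrite RintegralD// ?IH//; [exact: hF|exact: integrable_bigsum].
Qed.

Lemma integralE_Rintegral f : int f ->
  (\int[mu]_(x in A) (f x)%:E)%E = (\int[mu]_(x in A) f x)%:E.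
Proof. by move=> hf; rewrite /Rintegral fineK//; exact: integrable_fin_num. Qed.

Lemma integrable_dominated f g : measurable_fun A f -> int g ->
  (forall x, A x -> `|f x| <= g x) -> int f.
Proof.
move=> mf ig fg; apply: le_integrable ig => //; first exact/measurable_EFinP.
by move=> x Ax; rewrite /= lee_fin (le_trans (fg _ Ax))// ler_norm.
Qed.

Lemma ge0_integrable f : measurable_fun A f -> (forall x, A x -> 0 <= f x) ->
  (\int[mu]_(x in A) (f x)%:E < +oo)%E -> int f.
Proof.
move=> mf f0 fy; apply/integrableP; split; first exact/measurable_EFinP.
apply: le_lt_trans fy; apply: ge0_le_integral => //.
- by apply: measurableT_comp => //; exact/measurable_EFinP.
- exact/measurable_EFinP.
- by move=> x Ax; rewrite /= ger0_norm// f0.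
Qed.

Local Notation L2 := (L2 mu A).

Lemma L2_measurable f : L2 f -> measurable_fun A f. Proof. by case. Qed.

Lemma L2P f : L2 f <-> measurable_fun A f /\ int (fun x => f x ^+ 2).
Proof.
split => -[mf h]; split => //.
  apply: ge0_integrable => //; first exact: measurable_funX.
  by move=> x _; exact: sqr_ge0.
by rewrite integralE_Rintegral ?ltry.
Qed.

Lemma L2_sqr_integrable f : L2 f -> int (fun x => f x ^+ 2).
Proof. by move/L2P => []. Qed.

Lemma L2_mul_integrable f g : L2 f -> L2 g -> int (fun x => f x * g x).
Proof.
move=> /L2P[mf hf] /L2P[mg hg].
apply: (@integrable_dominated _ (fun x => f x ^+ 2 + g x ^+ 2)).
- exact: measurable_funM.
- exact: integrable_add.
- move=> x _; rewrite normrM -(real_normK (num_real (f x))) -(real_normK (num_real (g x))).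
  have := sqr_ge0 (`|f x| - `|g x|); have := sqr_ge0 `|f x|; have := sqr_ge0 `|g x|.
  nra.
Qed.

Lemma L2_scale (r : R) f : L2 f -> L2 (fun x => r * f x).
Proof.
move=> /L2P[mf hf]; apply/L2P; split; first exact: measurable_funM.
under eq_fun do rewrite exprMn; exact: integrable_scale.
Qed.

Lemma L2_add f g : L2 f -> L2 g -> L2 (fun x => f x + g x).
Proof.
move=> hf hg; have mf := L2_measurable hf; have mg := L2_measurable hg.
apply/L2P; split; first exact: measurable_funD.
under eq_fun do rewrite sqrrD -mulr_natl.
apply: integrable_add; last exact: L2_sqr_integrable.
by apply: integrable_add; [exact: L2_sqr_integrable|apply/integrable_scale/L2_mul_integrable].
Qed.

Lemma L2_sub f g : L2 f -> L2 g -> L2 (fun x => f x - g x).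
Proof.
move=> hf hg; under eq_fun do rewrite -mulN1r.
by apply: L2_add => //; exact: L2_scale.
Qed.

Lemma L2_mul_bounded f g (C : R) : L2 f -> measurable_fun A g ->
  (forall x, A x -> `|g x| <= C) -> L2 (fun x => f x * g x).
Proof.
move=> /L2P[mf hf] mg gC; apply/L2P; split; first exact: measurable_funM.
apply: (@integrable_dominated _ (fun x => C ^+ 2 * f x ^+ 2)).
- by apply: measurable_funX; exact: measurable_funM.
- exact: integrable_scale.
- move=> x Ax; rewrite normrX normrM exprMn real_normK ?num_real// mulrC.
  rewrite ler_wpM2r ?sqr_ge0// lerXn2r ?nnegrE//; last exact: gC.
  exact: le_trans (gC _ Ax).
Qed.

Lemma bounded_L2 f (C : R) : (mu A < +oo)%E -> measurable_fun A f ->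
  (forall x, A x -> `|f x| <= C) -> L2 f.
Proof.
move=> Ay mf fC.
suff : L2 (fun x => cst 1 x * f x) by under [in X in X -> _]eq_fun do rewrite mul1r.
apply: L2_mul_bounded fC => //; apply/L2P; split => //=.
under eq_fun do rewrite expr1n.
apply: measurable_bounded_integrable => //.
by exists 1; split; [exact: num_real|move=> M M1 x _; rewrite /= normr1 ltW].
Qed.

Lemma eq_L2 f g : (forall x, A x -> f x = g x) -> L2 f -> L2 g.
Proof.
move=> fg [mf hf]; split.
  by apply: eq_measurable_fun mf => x /set_mem; exact: fg.
by under eq_integral => x /set_mem Ax do rewrite -fg//.
Qed.

Lemma Rintegral_sqr_eq0 f : L2 f -> \int[mu]_(x in A) (f x ^+ 2) = 0 ->
  {ae mu, forall x, A x -> f x = 0}.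
Proof.
move=> fL f0; have i1 := L2_sqr_integrable fL.
have mf : measurable_fun A (fun x => (f x ^+ 2)%:E) by exact: measurable_int i1.
have E0 : (\int[mu]_(x in A) `|(f x ^+ 2)%:E| = 0)%E.
  under eq_integral do rewrite gee0_abs ?lee_fin ?sqr_ge0//.
  by rewrite (integralE_Rintegral i1) f0.
have := (ae_eq_integral_abs mu mA mf).1 E0.
by apply: filterS => x hx Ax; have := hx Ax => /= -[] /eqP; rewrite sqrf_eq0 => /eqP.
Qed.

(** A weighted inequality between arithmetic and geometric means: a large weight
    keeps the product small when the first factor is small. *)
Lemma Rintegral_mul_le (l : R) f g : 0 < l -> L2 f -> L2 g ->
  `|\int[mu]_(x in A) (f x * g x)| <=
  l * \int[mu]_(x in A) (f x ^+ 2) + l^-1 * \int[mu]_(x in A) (g x ^+ 2).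
Proof.
move=> l0 hf hg.
have hi := L2_mul_integrable hf hg.
have hf2 := L2_sqr_integrable hf; have hg2 := L2_sqr_integrable hg.
apply: le_trans (le_normr_Rintegral mA hi) _.
rewrite -RintegralZl// -RintegralZl// -RintegralD//; last 2 first.
  exact: integrable_scale.
  exact: integrable_scale.
apply: le_Rintegral => //.
- exact: (integrable_norm hi).
- by apply: integrable_add; exact: integrable_scale.
- move=> x _; rewrite normrM -(real_normK (num_real (f x))) -(real_normK (num_real (g x))).
  have : 0 <= `|f x| by []. have : 0 <= `|g x| by [].
  move: `|f x| `|g x| => a b b0 a0.
  rewrite -(ler_pM2l l0) mulrDr [l * (l^-1 * _)]mulrA divff ?gt_eqF// mul1r.
  have := sqr_ge0 (l * a - b); have := mulr_ge0 (ltW l0) (mulr_ge0 a0 b0).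
  rewrite !expr2 => h1 h2.
  rewrite -subr_ge0 (_ : _ - _ = (l * a - b) * (l * a - b) + l * (a * b)); last by ring.
  by rewrite addr_ge0.
Qed.

Section Convergence.
Context (w : nat -> T -> R) (f : T -> R) (wL : forall n, L2 (w n)) (fL : L2 f).

Lemma L2_cvgE : L2_cvg mu A w f <->
  (fun n => \int[mu]_(x in A) ((w n x - f x) ^+ 2)) @ \oo --> (0 : R).
Proof.
have E n : (\int[mu]_(x in A) ((w n x - f x) ^+ 2)%:E)%E =
    (\int[mu]_(x in A) ((w n x - f x) ^+ 2))%:E.
  by apply: integralE_Rintegral; apply: L2_sqr_integrable; exact: L2_sub.
rewrite /L2_cvg; under eq_cvg do rewrite E.
by split => [/fine_cvgP[_]|]; [|move=> h; apply/fine_cvgP; split => //; near=> n].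
Unshelve. all: end_near.
Qed.

Lemma L2_cvg_mul g : L2_cvg mu A w f -> L2 g ->
  (fun n => \int[mu]_(x in A) (w n x * g x)) @ \oo --> \int[mu]_(x in A) (f x * g x).
Proof.
move=> /L2_cvgE wf gL; apply/cvgrPdist_le => e e0.
pose Q := \int[mu]_(x in A) (g x ^+ 2).
have Q0 : 0 <= Q by apply: Rintegral_ge0 => x _; exact: sqr_ge0.
pose l := 2 * (Q + 1) / e.
have l0 : 0 < l by rewrite divr_gt0// mulr_gt0// ltr_wpDl.
have c0 : 0 < e / (2 * l) by rewrite divr_gt0// mulr_gt0.
move/cvgrPdist_le : wf => /(_ _ c0); apply: filterS => n.
rewrite sub0r normrN ger0_norm; last first.
  by apply: Rintegral_ge0 => x _; exact: sqr_ge0.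
move=> hn; rewrite distrC -RintegralB//; [|exact: L2_mul_integrable..].
under eq_Rintegral do rewrite -mulrBl.
have := Rintegral_mul_le l0 (L2_sub (wL n) fL) gL; rewrite -/Q => /le_trans; apply.
have h1 : l * \int[mu]_(x in A) (w n x - f x) ^+ 2 <= e / 2.
  rewrite mulrC -ler_pdivlMr// (le_trans hn)// invfM mulrA.
  by rewrite lexx.
have h2 : l^-1 * Q <= e / 2.
  rewrite /l invf_div mulrAC ler_pdivrMr ?mulr_gt0 ?ltr_wpDl//.
  have := ltW e0; nra.
by lra.
Qed.

End Convergence.

End L2Tools.

(** * The divergence theorem for vertical fields *)

Section Divergence.
Context {R : realType} {I : finType} (E : {set I}) (S : I -> segment R)
  (nu : I -> plane R) (D : set (plane R)) (HD : polygonal_region E S nu D).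
Implicit Types (F G : plane R -> R) (e : I).

Lemma region_measurable : measurable D.
Proof. exact: open_measurable_plane (region_open HD). Qed.

Lemma integrable_patch (g : R -> R) (a b : R) : continuous g ->
  mu1.-integrable setT (EFin \o (g \_ `[a, b[%classic)).
Proof.
move=> cg; rewrite -restrict_EFin.
have mI : measurable (`[a, b[%classic : set (measurableTypeR R)) by exact: measurable_itv.
apply: (integrable_mkcond _ mI).1.
have : mu1.-integrable `[a, b]%classic (EFin \o g).
  apply: continuous_compact_integrable; first exact: segment_compact.
  exact: continuous_subspaceT.
by apply: integrableS => //; exact: subset_itv_co_cc.
Qed.

Lemma Rintegral_patch_FTC F (i : 'I_2) (x a b : R) : i != ord0 -> Cn 1 F -> a < b ->
  \int[mu1]_y ((fun y : R => pderiv i F (x, y)) \_ `[a, b[%classic) y =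
  F (x, b) - F (x, a).
Proof.
move=> i0 CF ab; rewrite -(vertical_FTC x i0 CF ab) -Rintegral_mkcond.
apply: Rintegral_itv_bndo_bndc.
have cpf : continuous (fun y : R => pderiv i F (x, y)).
  by apply: vertical_continuous; case: CF => _ /(_ i)[_ []].
have : mu1.-integrable `[a, b]%classic (EFin \o (fun y : R => pderiv i F (x, y))).
  apply: continuous_compact_integrable; first exact: segment_compact.
  exact: continuous_subspaceT.
by apply: integrableS => //; exact: subset_itv_co_cc.
Qed.

Definition slice_flux F (x : R) : R :=
  \sum_(e in E | crosses S x e) Num.sg (nu e).2 * F (x, height S e x).

(** On a vertical line that avoids the vertices, the indicator function of the
    region is the signed number of sides above a point; each side contributes
    the integral of the derivative up to its height, from a level [a] below all
    the sides. The values at [a] cancel because the signs add up to zero. *)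
Lemma slice_integral F (i : 'I_2) (x : R) : i != ord0 -> Cn 1 F ->
  generic_abscissa E S x ->
  (\int[mu1]_y ((EFin \o pderiv i F) \_ D) (x, y) = (slice_flux F x)%:E)%E.
Proof.
move=> i0 CF gx.
have cpf : continuous (pderiv i F : R * R -> R) by case: CF => _ /(_ i)[_ []].
have cpfx : continuous (fun y : R => pderiv i F (x, y)) by exact: vertical_continuous.
have [B B0 HB] := region_box HD.
(* a level below the region and below all the sides *)
pose a := - (B + \sum_(e in E) `|height S e x| + 1).
have heighta e : e \in E -> a < height S e x.
  move=> eE; rewrite /a ltrNl (bigD1 e)//=.
  have : 0 <= \sum_(j in E | j != e) `|height S j x| by apply: sumr_ge0.
  have := ler_norm (- height S e x); rewrite normrN; lra.
have aB : a < - B.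
  rewrite /a ltrN2; have : 0 <= \sum_(e in E) `|height S e x| by apply: sumr_ge0.
  lra.
pose K (y : R) := \sum_(e in E | crosses S x e) Num.sg (nu e).2 *
  ((fun y : R => pderiv i F (x, y)) \_ `[a, height S e x[%classic) y.
have iK : mu1.-integrable setT (EFin \o K).
  apply: integrable_bigsum => // e _; apply: integrable_scale => //.
  exact: integrable_patch.
have nba : ~ boundary D (x, a).
  move=> /(boundary_crossing HD _ gx)[e [eE _ ae]].
  by have := heighta _ eE; rewrite -ae ltxx.
have flux0 : \sum_(e in E | crosses S x e) Num.sg (nu e).2 = 0 :> R.
  have := region_winding HD gx nba.
  have /asboolPn/negbTE-> : ~ D (x, a).
    by move=> /HB[_]; rewrite ltNge ler0_norm; lra.
  move=> W0; transitivity (\sum_(e in E | crosses S x e && (a < height S e x))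
    Num.sg (nu e).2); last by rewrite -W0.
  apply: eq_bigl => e.
  by case: (boolP (e \in E)) => //= eE; rewrite heighta// andbT.
transitivity (\int[mu1]_y (K y)%:E)%E; last first.
  rewrite integralE_Rintegral//; congr EFin.
  rewrite Rintegral_bigsum//; last first.
    by move=> e _; apply: integrable_scale => //; exact: integrable_patch.
  have -> : slice_flux F x = \sum_(e in E | crosses S x e)
      Num.sg (nu e).2 * (F (x, height S e x) - F (x, a)).
    under [RHS]eq_bigr do rewrite mulrBr.
    by rewrite sumrB -mulr_suml flux0 mul0r subr0.
  apply: eq_bigr => e /andP[eE ex].
  rewrite RintegralZl//; last exact: integrable_patch.
  by rewrite Rintegral_patch_FTC ?heighta.
apply: ae_eq_integral => //.
- have mG : measurable_fun setT ((EFin \o pderiv i F) \_ D : plane R -> \bar R).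
    apply: (measurable_restrictT _ region_measurable).1.
    apply/measurable_EFinP; apply: measurable_funTS.
    exact: continuous_measurable_plane.
  have mP : measurable_fun setT (fun y : measurableTypeR R => (x, y) : plane R).
    exact: pair1_measurable.
  exact: (measurableT_comp mG mP).
- by apply: measurable_int iK.
pose N : set R := [set y | exists2 e, e \in E & y = height S e x].
have fN : countable N.
  rewrite (_ : N = (fun e => height S e x) @` [set` E]); last first.
    by apply/seteqP; split => [y [e eE ->]|y [e eE <-]]; exists e.
  apply: finite_set_countable.
  by apply: finite_image; exact: finite_finset.
exists N; split.
- by apply: countable_measurable => // t; exact: measurable_set1.
- exact: countable_lebesgue_measure0.
move=> y /= /not_implyP[_ hy]; apply: contrapT => nN; apply: hy.
have nb : ~ boundary D (x, y).
  by move=> /(boundary_crossing HD _ gx)[e [eE _ ye]]; apply: nN; exists e.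
have W := region_winding HD gx nb.
rewrite /= restrict_EFin /=; congr EFin.
rewrite patchE; transitivity ((`[< D (x, y) >])%:R * pderiv i F (x, y)).
  case: asboolP => Dxy; first by rewrite mem_set ?mul1r.
  by rewrite memNset// mul0r.
have [ay|ya] := leP a y; last first.
  have /asboolPn/negbTE-> : ~ D (x, y).
    by move=> /HB[_]; rewrite ltNge ler0_norm; lra.
  rewrite mul0r /K big1// => e _; rewrite patchE memNset ?mulr0//=.
  by rewrite in_itv/= leNgt ya.
rewrite W mulr_suml /K big_mkcondr [RHS]big_mkcondr; apply: eq_bigr => e eE.
case: (boolP (crosses S x e)) => //= ex.
rewrite patchE; case: ifPn => yh.
  by rewrite mem_set//= in_itv/= ay.
by rewrite memNset ?mulr0//= in_itv/= ay; apply/negP.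
Qed.

Lemma crossesE e (x : R) : (S e).1.1 != (S e).2.1 ->
  crosses S x e = (Num.min (S e).1.1 (S e).2.1 < x < Num.max (S e).1.1 (S e).2.1).
Proof.
rewrite /crosses /crossing; move: (S e).1.1 (S e).2.1 => a b; case: (ltgtP a b) => // ab _.
  by rewrite ltr_pdivlMr ?subr_gt0// mul0r subr_gt0 ltr_pdivrMr ?subr_gt0// mul1r ltrD2r.
by rewrite ltr_ndivlMr ?subr_lt0// mul0r subr_lt0 ltr_ndivrMr ?subr_lt0// mul1r ltrD2r andbC.
Qed.

Lemma crossesT e : (S e).1.1 = (S e).2.1 -> forall x, crosses S x e = false.
Proof. by move=> h x; rewrite /crosses /crossing h subrr invr0 mulr0 ltxx. Qed.

Lemma height_continuous F e : continuous (F : R * R -> R) ->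
  continuous (fun x : R => F (x, height S e x)).
Proof.
move=> cF x; apply: (@continuous_comp _ _ _ (fun x : R => (x, height S e x) : R * R)); last exact: cF.
move: x; apply: (pair_continuous (f := id)) => [x|]; first exact: cvg_id.
rewrite /height /crossing /=; set c := (S e).2.2 - (S e).1.2; set m := (_ - _)^-1.
rewrite (_ : (fun x => _) = (fun x => ((S e).1.2 - (S e).1.1 * m * c) + x * (m * c))).
  exact: affine_continuous.
by apply/funext => x; ring.
Qed.

(** The abscissa is an affine parameter on a side that is not vertical; the
    factor between it and the arc length is the vertical component of the
    normal, up to sign. A vertical side has no flux. *)
Lemma side_flux F e : e \in E -> continuous (F : R * R -> R) ->
  mu1.-integrable setT (EFin \o
     ((fun x : R => F (x, height S e x)) \_ [set x | crosses S x e])) /\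
  Num.sg (nu e).2 * \int[mu1]_x
     ((fun x : R => F (x, height S e x)) \_ [set x | crosses S x e]) x =
  eint (S e) (fun x => F x * (nu e).2).
Proof.
move=> eE cF; have ndeg := region_nondegenerate HD eE.
have l0 := len_gt0 ndeg.
have nl : len (S e) * (nu e).2 = (S e).2.1 - (S e).1.1 \/
    len (S e) * (nu e).2 = - ((S e).2.1 - (S e).1.1).
  case: (normal_len ndeg (region_normal HD eE)) => -[_ ->]; last by left.
  by right; rewrite opprB.
have iF : mu1.-integrable `[0, 1]%classic (EFin \o (fun t => F (param (S e) t))).
  apply: continuous_compact_integrable; first exact: segment_compact.
  apply: continuous_subspaceT => t.
  by apply: continuous_comp; [exact: param_continuous|exact: cF].
have -> : eint (S e) (fun x => F x * (nu e).2) =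
    len (S e) * (nu e).2 * \int[mu1]_(t in `[0, 1]) F (param (S e) t).
  rewrite /eint -mulrA; congr (_ * _); under eq_Rintegral do rewrite mulrC.
  by rewrite RintegralZl//.
have [h|h] := eqVneq (S e).1.1 (S e).2.1.
  have nu0 : (nu e).2 = 0.
    apply: (mulfI (lt0r_neq0 l0)); rewrite mulr0.
    by case: nl => ->; rewrite h subrr ?oppr0.
  rewrite (_ : [set x | _] = set0); last first.
    by apply/seteqP; split => // x /=; rewrite crossesT.
  rewrite nu0 mulr0 mul0r sgr0 mul0r; split=> //.
  rewrite -restrict_EFin; apply: (integrable_mkcond _ measurable0).1.
  exact: integrable_set0.
rewrite (_ : [set x | _] =
    `]Num.min (S e).1.1 (S e).2.1, Num.max (S e).1.1 (S e).2.1[%classic); last first.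
  by apply/seteqP; split => x /=; rewrite crossesE// in_itv.
set a := (S e).1.1 in h nl *; set b := (S e).2.1 in h nl *.
have cH := @height_continuous F e cF.
have icc : mu1.-integrable `[Num.min a b, Num.max a b]%classic
    (EFin \o (fun x : R => F (x, height S e x))).
  apply: continuous_compact_integrable; first exact: segment_compact.
  exact: continuous_subspaceT.
have ico : mu1.-integrable `[Num.min a b, Num.max a b[%classic
    (EFin \o (fun x : R => F (x, height S e x))).
  by apply: integrableS icc => //; exact: subset_itv_co_cc.
have ioo : mu1.-integrable `]Num.min a b, Num.max a b[%classic
    (EFin \o (fun x : R => F (x, height S e x))).
  by apply: integrableS icc => //; exact: subset_itv_oo_cc.
have mI : measurable (`]Num.min a b, Num.max a b[%classic : set (measurableTypeR R)).
  exact: measurable_itv.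
split; first by rewrite -restrict_EFin; exact: (integrable_mkcond _ mI).1.
rewrite -Rintegral_mkcond Rintegral_itv_obnd_cbnd// Rintegral_itv_bndo_bndc//.
rewrite -affine_substitution// mulrA; congr (_ * _); last first.
  apply: eq_Rintegral => t _; congr F.
  apply: plane_eq => //=; rewrite -/a -/b /height param2E /crossing -/a -/b.
  by rewrite addrAC subrr add0r mulfK// subr_eq0 eq_sym.
have sE : Num.sg (nu e).2 = Num.sg (len (S e) * (nu e).2).
  by rewrite sgrM (gtr0_sg l0) mul1r.
have sg1 (z : R) : Num.sg z * `|z| = z by rewrite -numEsg.
have sg2 (z : R) : Num.sg (- z) * `|z| = - z by rewrite -normrN -numEsg.
by rewrite sE; case: nl => ->; [exact: sg1|exact: sg2].
Qed.

Lemma divergence_vertical F (i : 'I_2) : i != ord0 -> Cn 1 F ->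
  \int[mu2]_(x in D) pderiv i F x =
  \sum_(e in E) eint (S e) (fun x => F x * (nu e).2).
Proof.
move=> i0 CF.
have cF : continuous (F : R * R -> R) by case: CF.
have cpf : continuous (pderiv i F : R * R -> R) by case: CF => _ /(_ i)[_ []].
have mD := region_measurable.
have iG : mu2.-integrable setT ((EFin \o pderiv i F) \_ D).
  apply: (integrable_mkcond _ mD).1.
  by apply: continuous_integrable_plane => //; exact: region_bounded HD.
pose h e := (fun x : R => F (x, height S e x)) \_ [set x | crosses S x e].
pose H (x : R) := \sum_(e in E) Num.sg (nu e).2 * h e x.
have ih e : e \in E -> mu1.-integrable setT (EFin \o (fun x => Num.sg (nu e).2 * h e x)).
  by move=> eE; apply: integrable_scale => //; case: (side_flux eE cF).
have iH : mu1.-integrable setT (EFin \o H) by apply: integrable_bigsum.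
have HE x : slice_flux F x = H x.
  rewrite /slice_flux /H big_mkcondr; apply: eq_bigr => e _.
  rewrite /h patchE; case: ifPn => ex; first by rewrite mem_set.
  by rewrite memNset ?mulr0//; apply/negP.
transitivity (\int[mu1]_x H x); last first.
  rewrite Rintegral_bigsum//; apply: eq_bigr => e eE.
  have [ihe <-] := side_flux eE cF.
  by rewrite RintegralZl.
apply: (congr1 fine); rewrite integral_mkcond.
transitivity (\int[mu1]_x \int[mu1]_y ((EFin \o pderiv i F) \_ D) (x, y))%E.
  by apply/esym; exact: (integral12_prod_meas1 iG).
apply: ae_eq_integral => //.
- exact: (measurable_fubini_F iG).
- exact: measurable_int iH.
pose N : set R := (fun e => (S e).1.1) @` [set` E] `|` (fun e => (S e).2.1) @` [set` E].
have fN : countable N.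
  apply: finite_set_countable; rewrite finite_setU; split;
    by apply: finite_image; exact: finite_finset.
exists N; split.
- by apply: countable_measurable => // t; exact: measurable_set1.
- exact: countable_lebesgue_measure0.
move=> x /= /not_implyP[_ hx]; apply: contrapT => nN; apply: hx.
rewrite slice_integral ?HE// => e eE.
by split => xe; apply: nN; [left|right]; exists e.
Qed.

End Divergence.

(** * Functions of class C1 and polynomials *)

Lemma sum_ord2 {V : zmodType} (F : 'I_2 -> V) : \sum_(i < 2) F i = F ord0 + F ord_max.
Proof. by rewrite big_ord_recl big_ord1; congr (_ + F _); exact: val_inj. Qed.

Section Calculus.
Context {R : realType}.
Implicit Types (f g : plane R -> R) (i : 'I_2).

Lemma ord2_cases i : i = ord0 \/ i = ord_max.
Proof. by case: i => -[|[|//]] h; [left|right]; exact: val_inj. Qed.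

(** Class C1 together with formulas for the partial derivatives: the formulas
    are computed along with the proof of differentiability. *)
Definition has_partials f (df : 'I_2 -> plane R -> R) : Prop :=
  [/\ continuous (f : R * R -> R), forall i, continuous (df i : R * R -> R) &
      forall i (x : R * R), is_derive x (unit_vec i) (f : R * R -> R) (df i x)].

Lemma has_partials_pderiv f df i : has_partials f df -> pderiv i f = df i.
Proof.
move=> [_ _ d]; apply/funext => x; exact: (@derive_val _ _ _ _ _ _ _ (d i x)).
Qed.

Lemma has_partials_ext f df dg : has_partials f df ->
  (forall i x, df i x = dg i x) -> has_partials f dg.
Proof. by move=> hf e; rewrite (_ : dg = df)//; apply/funext => i; apply/funext. Qed.

Lemma has_partials_C1 f df : has_partials f df -> Cn 1 f.
Proof.
move=> hf; have [cf cdf d] := hf; split => // i; split => [x|].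
  exact: (@ex_derive _ _ _ _ _ _ _ (d i x)).
by split => //; rewrite (has_partials_pderiv i hf).
Qed.

Lemma C1_has_partials f : Cn 1 f -> has_partials f (fun i => pderiv i f).
Proof.
move=> [cf h]; split => // [i|i x]; first by case: (h i) => _ [].
by apply: DeriveDef; [case: (h i)|].
Qed.

Lemma smooth_C1 f : smooth f -> Cn 1 f. Proof. exact. Qed.

Lemma has_partials_cst (c : R) : has_partials (cst c) (fun _ => cst 0).
Proof.
by split => [x|i x|i x]; [exact: cvg_cst|exact: cvg_cst|exact: is_derive_cst].
Qed.

Lemma fst_continuous : continuous (fst : R * R -> R).
Proof. by move=> x; exact: cvg_fst. Qed.

Lemma snd_continuous : continuous (snd : R * R -> R).
Proof. by move=> x; exact: cvg_snd. Qed.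

Lemma is_derive_of_slope (f : R * R -> R) (x v : R * R) (c : R) :
  (forall h : R, f (h *: v + x) - f x = h * c) -> is_derive x v f c.
Proof.
move=> H.
have L : (fun h : R => h^-1 *: ((f \o shift x) (h *: v) - f x)) @ 0^' --> c.
  apply: (@cvg_trans _ (cst c @ 0^')); last exact: cvg_cst.
  apply: near_eq_cvg; near=> h.
  have h0 : h != 0 by near: h; exact: nbhs_dnbhs_neq.
  by rewrite /= H /GRing.scale /= mulrA mulVf// mul1r.
apply: DeriveDef; first by apply/cvg_ex; exists c.
exact: cvg_lim L.
Unshelve. all: end_near.
Qed.

Lemma has_partials_coord j :
  has_partials (fun x => Defs.coord x j) (fun i => cst (i == j)%:R).
Proof.
split => [x|i x|i x].
- by rewrite /Defs.coord; case: (j == ord0); [exact: fst_continuous|exact: snd_continuous].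
- exact: cvg_cst.
- apply: is_derive_of_slope => h; rewrite /Defs.coord /unit_vec.
  by case: (ord2_cases i) => ->; case: (ord2_cases j) => -> /=;
    rewrite addrK.
Qed.

Lemma continuous_mul f g : continuous (f : R * R -> R) ->
  continuous (g : R * R -> R) -> continuous ((fun x => f x * g x) : R * R -> R).
Proof. by move=> cf cg x; apply: cvgM; [exact: cf|exact: cg]. Qed.

Lemma continuous_add f g : continuous (f : R * R -> R) ->
  continuous (g : R * R -> R) -> continuous ((fun x => f x + g x) : R * R -> R).
Proof. by move=> cf cg x; apply: cvgD; [exact: cf|exact: cg]. Qed.

Lemma has_partials_mul f g df dg : has_partials f df -> has_partials g dg ->
  has_partials (fun x => f x * g x) (fun i x => df i x * g x + f x * dg i x).
Proof.
move=> [cf cdf ff] [cg cdg gg]; split => [|i|i x].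
- exact: continuous_mul.
- by apply: continuous_add; apply: continuous_mul.
- have H := is_deriveM (ff i x) (gg i x).
  by apply: (is_derive_eq H); rewrite /GRing.scale /= addrC mulrC.
Qed.

Lemma has_partials_add f g df dg : has_partials f df -> has_partials g dg ->
  has_partials (fun x => f x + g x) (fun i x => df i x + dg i x).
Proof.
move=> [cf cdf ff] [cg cdg gg]; split => [|i|i x].
- exact: continuous_add.
- exact: continuous_add.
- exact: (is_deriveD (ff i x) (gg i x)).
Qed.

Lemma has_partials_scale (c : R) f df : has_partials f df ->
  has_partials (fun x => c * f x) (fun i x => c * df i x).
Proof.
move=> hf; have := has_partials_mul (has_partials_cst c) hf.
set d1 := (fun i => _); set d2 := (fun i => _); suff -> : d1 = d2 by [].
by apply/funext => i; apply/funext => x; rewrite /d1 /= mul0r add0r.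
Qed.

Lemma has_partials_exp f df (n : nat) : has_partials f df ->
  has_partials (fun x => f x ^+ n) (fun i x => n%:R * f x ^+ n.-1 * df i x).
Proof.
move=> hf; elim: n => [|n IH].
  have := has_partials_cst 1.
  set d1 := (fun i => _); set d2 := (fun i => _); suff -> : d1 = d2 by [].
  by apply/funext => i; apply/funext => x; rewrite /d2 mul0r mul0r.
have := has_partials_mul hf IH.
rewrite (_ : (fun x => f x * _) = (fun x => f x ^+ n.+1)); last first.
  by apply/funext => x; rewrite exprS.
set d1 := (fun i => _); set d2 := (fun i => _); suff -> : d1 = d2 by [].
apply/funext => i; apply/funext => x; rewrite /d1 /d2 /=.
case: n {IH d1 d2} => [|n] /=; first by rewrite expr0; ring.
by rewrite exprS -[n.+2]addn1 natrD; ring.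
Qed.

Lemma pderiv_mul f g i : Cn 1 f -> Cn 1 g ->
  pderiv i (fun x => f x * g x) = fun x => pderiv i f x * g x + f x * pderiv i g x.
Proof.
move=> /C1_has_partials hf /C1_has_partials hg.
exact: has_partials_pderiv (has_partials_mul hf hg).
Qed.

Lemma C1_mul f g : Cn 1 f -> Cn 1 g -> Cn 1 (fun x => f x * g x).
Proof.
move=> /C1_has_partials hf /C1_has_partials hg.
exact: has_partials_C1 (has_partials_mul hf hg).
Qed.

Lemma C1_continuous f : Cn 1 f -> continuous (f : R * R -> R).
Proof. by case. Qed.

Lemma C1_pderiv_continuous f i : Cn 1 f -> continuous (pderiv i f : R * R -> R).
Proof. by case=> _ /(_ i)[_ []]. Qed.

Section Polynomials.
Variable n : nat.

Lemma polynomial2_add p q : polynomial2 n p -> polynomial2 n q ->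
  polynomial2 (R := R) n (fun x => p x + q x).
Proof.
move=> [c hc] [d hd]; exists (fun a b => c a b + d a b) => x.
rewrite hc hd -big_split; apply: eq_bigr => a _.
by rewrite -big_split; apply: eq_bigr => b _ /=; rewrite !mulrDl.
Qed.

Lemma polynomial2_scale (r : R) p : polynomial2 n p ->
  polynomial2 n (fun x => r * p x).
Proof.
move=> [c hc]; exists (fun a b => r * c a b) => x.
rewrite hc mulr_sumr; apply: eq_bigr => a _.
by rewrite mulr_sumr; apply: eq_bigr => b _ /=; rewrite !mulrA.
Qed.

Lemma polynomial2_0 : polynomial2 (R := R) n (fun=> 0).
Proof.
exists (fun _ _ => 0) => x; rewrite big1// => a _; rewrite big1// => b _.
by rewrite !mul0r.
Qed.

Lemma polynomial2_sum (J : Type) (s : seq J) (P : pred J) (F : J -> plane R -> R) :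
  (forall j, P j -> polynomial2 n (F j)) ->
  polynomial2 n (fun x => \sum_(j <- s | P j) F j x).
Proof.
move=> hF; elim: s => [|j s IH].
  by under eq_fun do rewrite big_nil; exact: polynomial2_0.
under eq_fun do rewrite big_cons; case: (boolP (P j)) => // Pj.
by apply: polynomial2_add => //; exact: hF.
Qed.

Lemma polynomial2_monomial (r : R) a b : (a + b <= n)%N ->
  polynomial2 n (fun x : plane R => r * x.1 ^+ a * x.2 ^+ b).
Proof.
move=> abn; exists (fun a' b' => if (a' == a) && (b' == b) then r else 0) => x.
have an : (a < n.+1)%N by rewrite ltnS (leq_trans _ abn)// leq_addr.
have bn : (b < n.+1)%N by rewrite ltnS (leq_trans _ abn)// leq_addl.
rewrite (bigD1 (Ordinal an))//= (bigD1 (Ordinal bn))//= !eqxx/=.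
rewrite [X in _ = _ + X + _]big1 ?addr0 => [|b' /andP[_ ne]]; last first.
  by rewrite ifN ?mul0r//; apply: contra ne => /eqP e; apply/eqP/val_inj.
rewrite [X in _ = _ + X]big1 ?addr0// => a' ne; rewrite big1// => b' _.
rewrite ifN ?mul0r// negb_and; apply/orP; left.
by apply: contra ne => /eqP e; apply/eqP/val_inj.
Qed.

End Polynomials.

Lemma polynomial2_le m n (p : plane R -> R) : (m <= n)%N ->
  polynomial2 m p -> polynomial2 n p.
Proof.
move=> mn [c hc]; rewrite (funext hc).
apply: polynomial2_sum => a _; apply: polynomial2_sum => b abm.
by apply: polynomial2_monomial; exact: leq_trans mn.
Qed.

Definition differentiable_polynomial n (p : plane R -> R) : Prop :=
  exists2 dp, has_partials p dp & forall i, polynomial2 n (dp i).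

Lemma differentiable_polynomial_sum n (J : Type) (s : seq J) (P : pred J)
    (F : J -> plane R -> R) :
  (forall j, P j -> differentiable_polynomial n (F j)) ->
  differentiable_polynomial n (fun x => \sum_(j <- s | P j) F j x).
Proof.
move=> hF; elim: s => [|j s [ds hs ps]].
  under eq_fun do rewrite big_nil.
  by exists (fun _ => cst 0); [exact: has_partials_cst|move=> i; exact: polynomial2_0].
under eq_fun do rewrite big_cons; case: (boolP (P j)) => Pj; last by exists ds.
have [dj hj pj] := hF j Pj.
exists (fun i x => dj i x + ds i x); first exact: has_partials_add.
by move=> i; exact: polynomial2_add.
Qed.

Lemma polynomial2_differentiable n p : polynomial2 n p ->
  differentiable_polynomial n p.
Proof.
move=> [c hc]; rewrite (funext hc).
apply: differentiable_polynomial_sum => a _.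
apply: differentiable_polynomial_sum => b abn.
have h1 := has_partials_exp (nat_of_ord a) (has_partials_coord ord0).
have h2 := has_partials_exp (nat_of_ord b) (has_partials_coord ord_max).
have := has_partials_mul (has_partials_scale (c a b) h1) h2.
rewrite /Defs.coord /=; set d := (fun i x => _) => hd; exists d => // i.
case: (ord2_cases i) => ->.
  rewrite (_ : d _ = fun x : plane R => (c a b * a%:R) * x.1 ^+ a.-1 * x.2 ^+ b).
    by apply: polynomial2_monomial; rewrite (leq_trans _ abn)// leq_add2r leq_pred.
  by apply/funext => x; rewrite /d /=; ring.
rewrite (_ : d _ = fun x : plane R => (c a b * b%:R) * x.1 ^+ a * x.2 ^+ b.-1).
  by apply: polynomial2_monomial; rewrite (leq_trans _ abn)// leq_add2l leq_pred.
by apply/funext => x; rewrite /d /=; ring.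
Qed.

Lemma polynomial2_C1 n (p : plane R -> R) : polynomial2 n p -> Cn 1 p.
Proof. by move=> /polynomial2_differentiable[dp /has_partials_C1]. Qed.

Lemma polynomial2_continuous n p : polynomial2 n p -> continuous (p : R * R -> R).
Proof. by move=> /polynomial2_C1/C1_continuous. Qed.

Lemma polynomial2_pderiv n (p : plane R -> R) i : polynomial2 n p -> polynomial2 n (pderiv i p).
Proof.
by move=> /polynomial2_differentiable[dp hp]; rewrite (has_partials_pderiv i hp).
Qed.

End Calculus.

(** * The divergence theorem *)

Section Transposition.
Context {R : realType}.
Implicit Types (x : plane R) (s : segment R) (D : set (plane R)).

Definition transpose x : plane R := (x.2, x.1).
Definition transpose_segment s : segment R := (transpose s.1, transpose s.2).

Lemma transposeK : involutive transpose. Proof. by case. Qed.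

Lemma transpose_continuous : continuous (transpose : R * R -> R * R).
Proof. by apply: pair_continuous; [exact: snd_continuous|exact: fst_continuous]. Qed.

Lemma param_transpose s t : param (transpose_segment s) t = transpose (param s t).
Proof. by []. Qed.

Lemma segset_transpose s x : segset (transpose_segment s) x <-> segset s (transpose x).
Proof.
split => -[t tI h]; exists t => //; first by rewrite -h param_transpose transposeK.
by rewrite param_transpose h transposeK.
Qed.

Lemma len_transpose s : len (transpose_segment s) = len s.
Proof. by rewrite /len /enorm !dotE /= addrC. Qed.

Lemma snormal_transpose s :
  snormal (transpose_segment s) = vscale (-1) (transpose (snormal s)).
Proof.
rewrite /snormal len_transpose /vscale /=.
by apply: plane_eq; rewrite /= mulN1r -mulrN opprB.
Qed.

Lemma is_normal_transpose s nu : is_normal s nu ->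
  is_normal (transpose_segment s) (transpose nu).
Proof.
rewrite /is_normal snormal_transpose => -[] ->; [right|left];
  by apply: plane_eq; rewrite /= ?mulN1r ?opprK.
Qed.

Lemma closure_transpose D : closure (transpose @^-1` D : set (R * R)) =
  transpose @^-1` closure (D : set (R * R)).
Proof.
have H (A : set (R * R)) : closure (transpose @^-1` A : set (R * R)) `<=`
    transpose @^-1` closure A.
  have /continuous_closedP cT := transpose_continuous.
  rewrite [X in _ `<=` X](closure_id _).1; last by apply: cT; exact: closed_closure.
  by apply: closure_subset => y /= /subset_closure.
apply/seteqP; split; first exact: H.
move=> x /= Dx; have := H (transpose @^-1` D : set (R * R)) (transpose x).
rewrite /preimage /= transposeK; apply.
rewrite (_ : [set _ | _] = D)//.
by apply/seteqP; split => z /=; rewrite transposeK.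
Qed.

Lemma region_transpose (I : finType) (E : {set I}) (S : I -> segment R)
    (nu : I -> plane R) D :
  polygonal_region E S nu D ->
  polygonal_region E (transpose_segment \o S) (transpose \o nu) (transpose @^-1` D).
Proof.
move=> HD.
have oT : open (transpose @^-1` D : set (R * R)).
  by move/continuousP : transpose_continuous; apply; exact: region_open HD.
split => //.
- have [B [Br HB]] := region_bounded HD; exists B; split => // M BM x Dx.
  by have := HB M BM _ Dx; rewrite /= !prod_normE /= maxC.
- rewrite boundaryE// closure_transpose.
  apply/seteqP; split => x /=.
    move=> [Dx nDx]; have : boundary D (transpose x).
      by rewrite boundaryE//; exact: region_open HD.
    rewrite (region_boundary HD) => -[e eE h]; exists e => //.
    exact/segset_transpose.
  move=> [e eE /segset_transpose h]; have : boundary D (transpose x).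
    by rewrite (region_boundary HD); exists e.
  by rewrite boundaryE//; exact: region_open HD.
- move=> e e' eE e'E ne x [/segset_transpose h /segset_transpose h'].
  have [|h1 h2] := region_meet HD eE e'E ne (t := transpose x); first by split.
  by split; [case: h1|case: h2] => h0; [left|right|left|right];
    apply: (can_inj transposeK); rewrite h0 /= transposeK.
- by move=> e eE h; apply: (region_nondegenerate HD eE); apply: (can_inj transposeK) h.
- by move=> e eE; apply: is_normal_transpose; exact: region_normal HD _ eE.
- move=> e eE t t01; have [d d0 Hd] := region_outward HD eE t01.
  by exists d => // r /Hd.
Qed.

(** Both sides are the same iterated integral, by Fubini in the two orders. *)
Lemma Rintegral_transpose D (f : plane R -> R) : measurable D ->
  measurable (transpose @^-1` D : set (plane R)) ->
  mu2.-integrable D (EFin \o f) ->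
  mu2.-integrable (transpose @^-1` D) (EFin \o (f \o transpose)) ->
  \int[mu2]_(x in D) f x = \int[mu2]_(x in transpose @^-1` D) f (transpose x).
Proof.
move=> mD mTD iF iFT; apply: (congr1 fine).
rewrite integral_mkcond [RHS]integral_mkcond.
have i1 := (integrable_mkcond _ mD).1 iF.
have i2 := (integrable_mkcond _ mTD).1 iFT.
transitivity (\int[mu1]_y \int[mu1]_x ((EFin \o f) \_ D) (x, y))%E.
  by apply/esym; exact: (integral21_prod_meas1 i1).
transitivity (\int[mu1]_x \int[mu1]_y
    ((EFin \o (f \o transpose)) \_ (transpose @^-1` D)) (x, y))%E; last first.
  exact: (integral12_prod_meas1 i2).
apply: eq_integral => x _; apply: eq_integral => y _.
by rewrite !patchE (_ : ((x, y) \in _) = ((y, x) \in D)).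
Qed.

Lemma transpose_has_partials (f : plane R -> R) : Cn 1 f ->
  has_partials (f \o transpose)
    (fun i => pderiv (if i == ord0 then ord_max else ord0) f \o transpose).
Proof.
move=> /C1_has_partials[cf cdf d]; split => [x|i x|i x].
- by apply: continuous_comp; [exact: transpose_continuous|exact: cf].
- by apply: continuous_comp; [exact: transpose_continuous|exact: cdf].
set j := if _ then _ else _.
have E : (fun h : R => h^-1 *: (((f \o transpose) \o shift x) (h *: unit_vec i) -
     (f \o transpose) x)) =
   (fun h : R => h^-1 *: ((f \o shift (transpose x)) (h *: unit_vec j) -
     f (transpose x))).
  apply/funext => h; congr (_ *: (f _ - _)).
  rewrite /j /unit_vec; case: (ord2_cases i) => -> /=;
    by apply: plane_eq.
have [dj vj] := d j (transpose x).
apply: DeriveDef; first by rewrite /derivable E.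
by rewrite /derive E.
Qed.

End Transposition.

Section DivergenceTheorem.
Context {R : realType} {I : finType} (E : {set I}) (S : I -> segment R)
  (nu : I -> plane R) (D : set (plane R)) (HD : polygonal_region E S nu D).

Lemma divergence_theorem (F : plane R -> R) (i : 'I_2) : Cn 1 F ->
  \int[mu2]_(x in D) pderiv i F x =
  \sum_(e in E) eint (S e) (fun x => F x * Defs.coord (nu e) i).
Proof.
move=> CF; case: (ord2_cases i) => ->; last first.
  by rewrite (divergence_vertical HD)//.
have HT := region_transpose HD.
have mD := region_measurable HD; have mT := region_measurable HT.
have cp := C1_pderiv_continuous (i := ord0) CF.
have hT := transpose_has_partials CF.
rewrite Rintegral_transpose//; last 2 first.
- by apply: continuous_integrable_plane => //; exact: region_bounded HD.
- apply: continuous_integrable_plane => //; first exact: region_bounded HT.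
  by move=> x; apply: continuous_comp; [exact: transpose_continuous|exact: cp].
have := divergence_vertical HT (i := ord_max) isT (has_partials_C1 hT).
rewrite (has_partials_pderiv _ hT)/= => ->; apply: eq_bigr => e eE.
by rewrite /eint len_transpose.
Qed.

Lemma green_C1 (w q : plane R -> R) (i : 'I_2) : Cn 1 w -> Cn 1 q ->
  \int[mu2]_(x in D) (pderiv i w x * q x) + \int[mu2]_(x in D) (w x * pderiv i q x) =
  \sum_(e in E) eint (S e) (fun x => w x * q x * Defs.coord (nu e) i).
Proof.
move=> Cw Cq; rewrite -(divergence_theorem i (C1_mul Cw Cq)) pderiv_mul//.
have mD := region_measurable HD.
rewrite RintegralD//.
- apply: (@continuous_integrable_plane R D (fun x => pderiv i w x * q x)) => //.
    exact: region_bounded HD.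
  by apply: continuous_mul; [exact: C1_pderiv_continuous|exact: C1_continuous].
- apply: (@continuous_integrable_plane R D (fun x => w x * pderiv i q x)) => //.
    exact: region_bounded HD.
  by apply: continuous_mul; [exact: C1_continuous|exact: C1_pderiv_continuous].
Qed.

End DivergenceTheorem.

(** * Triangles *)

Section Triangle.
Context {R : realType} (a b c : plane R).
Implicit Types (x y u v : plane R) (i j : 'I_3).

Definition cross u v : R := u.1 * v.2 - u.2 * v.1.

Definition vertex (m : nat) : plane R :=
  match m with 0%N => a | 1%N => b | _ => c end.

(** Sides are indexed by the opposite vertex. *)
Definition tri_side i : segment R := (vertex ((i + 1) %% 3), vertex ((i + 2) %% 3)).

Definition det3 : R := cross (vsub b a) (vsub c a).

(** The barycentric coordinates, as ratios of areas. *)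
Definition bary i x : R :=
  cross (vsub (tri_side i).1 x) (vsub (tri_side i).2 x) / det3.

Definition triangle : set (plane R) := [set x | forall i, 0 < bary i x].

Definition tri_normal i : plane R :=
  if 0 < det3 then snormal (tri_side i) else vscale (-1) (snormal (tri_side i)).

Let i0 : 'I_3 := @Ordinal 3 0 isT.
Let i1 : 'I_3 := @Ordinal 3 1 isT.
Let i2 : 'I_3 := @Ordinal 3 2 isT.

Lemma ord3_cases i : [\/ i = i0, i = i1 | i = i2].
Proof.
by case: i => -[|[|[|//]]] h; [constructor 1|constructor 2|constructor 3]; exact: val_inj.
Qed.

Context (d0 : det3 != 0).

Lemma bary_sum x : bary i0 x + bary i1 x + bary i2 x = 1.
Proof. by move: d0; rewrite /bary /det3 /cross /= => h; field. Qed.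

Lemma bary_point1 x : x.1 = bary i0 x * a.1 + bary i1 x * b.1 + bary i2 x * c.1.
Proof. by move: d0; rewrite /bary /det3 /cross /= => h; field. Qed.

Lemma bary_point2 x : x.2 = bary i0 x * a.2 + bary i1 x * b.2 + bary i2 x * c.2.
Proof. by move: d0; rewrite /bary /det3 /cross /= => h; field. Qed.

Lemma bary_affine i x y (t : R) :
  bary i (param (x, y) t) = bary i x + t * (bary i y - bary i x).
Proof.
rewrite /bary -mulrBl mulrA -mulrDl; congr (_ / _).
by rewrite /cross /=; ring.
Qed.

Lemma bary_side i (t : R) : bary i (param (tri_side i) t) = 0.
Proof.
by rewrite /bary /cross /= (_ : _ - _ = 0) ?mul0r//; ring.
Qed.

Lemma bary_on_side i j (t : R) : bary j (param (tri_side i) t) =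
  if j == i then 0 else if nat_of_ord j == ((i + 1) %% 3)%N then 1 - t else t.
Proof.
rewrite /bary; move: d0.
by case: (ord3_cases i) => ->; case: (ord3_cases j) => -> /=;
  rewrite /det3 /cross /= => h; field.
Qed.

(** A barycentric coordinate is affine; its gradient is orthogonal to the side
    on which it vanishes. *)
Lemma bary_shift i x u (r : R) : bary i (vadd x (vscale r u)) = bary i x -
  r * (u.1 * ((tri_side i).2.2 - (tri_side i).1.2) +
       u.2 * ((tri_side i).1.1 - (tri_side i).2.1)) / det3.
Proof.
rewrite /bary -mulrBl; congr (_ / _); rewrite /cross /=; ring.
Qed.

Lemma bary_continuous i : continuous (bary i : R * R -> R).
Proof.
pose p (x : R * R) := (tri_side i).1.1 * (tri_side i).2.2 - (tri_side i).1.2 * (tri_side i).2.1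
  + x.1 * ((tri_side i).1.2 - (tri_side i).2.2) + x.2 * ((tri_side i).2.1 - (tri_side i).1.1).
have -> : bary i = (fun x : R * R => p x / det3).
  by apply/funext => x; rewrite /bary /p /cross /=; congr (_ / _); ring.
move=> x; apply: cvgM; last exact: cvg_cst.
apply: cvgD; last by apply: cvgM; [exact: snd_continuous|exact: cvg_cst].
apply: cvgD; first exact: cvg_cst.
by apply: cvgM; [exact: fst_continuous|exact: cvg_cst].
Qed.

Lemma tri_side_nondegenerate i : (tri_side i).1 <> (tri_side i).2.
Proof.
move=> h; move/eqP: d0; apply; move: h.
by case: (ord3_cases i) => -> /=; rewrite /det3 /cross /= => ->; ring.
Qed.

Lemma tri_normal_is_normal i : is_normal (tri_side i) (tri_normal i).
Proof. by rewrite /tri_normal; case: ifP => _; [left|right]. Qed.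

Lemma tri_normal_slope i :
  ((tri_normal i).1 * ((tri_side i).2.2 - (tri_side i).1.2) +
   (tri_normal i).2 * ((tri_side i).1.1 - (tri_side i).2.1)) =
  (if 0 < det3 then 1 else -1) * len (tri_side i).
Proof.
have l0 := len_gt0 (@tri_side_nondegenerate i).
apply: (mulfI (lt0r_neq0 l0)).
have -> : len (tri_side i) * ((if 0 < det3 then 1 else -1) * len (tri_side i)) =
   (if 0 < det3 then 1 else -1) * len (tri_side i) ^+ 2 by ring.
rewrite sqr_len /tri_normal; case: ifP => _ /=; rewrite ?mul1r ?mulN1r.
  by field; rewrite gt_eqF.
by field; rewrite gt_eqF.
Qed.

Lemma triangle_open : open (triangle : set (R * R)).
Proof.
have oi i : open (bary i @^-1` [set r | 0 < r] : set (R * R)).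
  by apply: open_comp => [x _|]; [exact: bary_continuous|exact: open_gt].
have -> : triangle = bary i0 @^-1` [set r | 0 < r] `&`
    bary i1 @^-1` [set r | 0 < r] `&` bary i2 @^-1` [set r | 0 < r].
  apply/seteqP; split => x; first by move=> h; split; [split|]; exact: h.
  by move=> [[h0 h1] h2] i; case: (ord3_cases i) => ->.
by apply: openI => //; apply: openI.
Qed.

Lemma triangle_closure_ge0 i x : closure (triangle : set (R * R)) x -> 0 <= bary i x.
Proof.
have cl : closed (bary i @^-1` [set r | 0 <= r] : set (R * R)).
  have /continuous_closedP := @bary_continuous i; apply; exact: closed_ge.
move=> h; suff : (bary i @^-1` [set r | 0 <= r]) x by [].
rewrite ((closure_id _).1 cl); apply: closure_subset h => y /(_ i).
exact: ltW.
Qed.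

Lemma triangle_bounded : bounded_set (triangle : set (R * R)).
Proof.
pose B : R := `|a.1| + `|b.1| + `|c.1| + (`|a.2| + `|b.2| + `|c.2|).
exists B; split; first exact: num_real.
move=> M BM x /= h.
have := h i2; have := h i1; have := h i0 => h0 h1 h2.
have s1 := bary_sum x.
have key (p q r : R) : `|bary i0 x * p + bary i1 x * q + bary i2 x * r| <= `|p| + `|q| + `|r|.
  apply: le_trans (ler_normD _ _) _; apply: lerD.
    apply: le_trans (ler_normD _ _) _; apply: lerD.
      by rewrite normrM gtr0_norm// ler_piMl//; lra.
    by rewrite normrM gtr0_norm// ler_piMl//; lra.
  by rewrite normrM gtr0_norm// ler_piMl//; lra.
rewrite prod_normE ge_max; apply/andP; split; apply: le_trans (ltW BM).
  rewrite (bary_point1 x) (le_trans (key _ _ _))// /B lerDl.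
  by rewrite !addr_ge0.
rewrite (bary_point2 x) (le_trans (key _ _ _))// /B lerDr.
by rewrite !addr_ge0.
Qed.

Lemma triangle_boundary :
  boundary triangle = \bigcup_(i in [set` [set: 'I_3]%SET]) segset (tri_side i).
Proof.
rewrite boundaryE; last exact: triangle_open.
apply/seteqP; split => x.
- move=> [cx nx].
  have ge i := triangle_closure_ge0 i cx.
  have [i hi] : exists i, bary i x = 0.
    apply: contrapT => /forallNP h; apply: nx => i.
    by rewrite lt_neqAle ge andbT eq_sym; apply/eqP.
  have s1 := bary_sum x; have p1 := bary_point1 x; have p2 := bary_point2 x.
  have := ge i2; have := ge i1; have := ge i0 => g0 g1 g2.
  exists i; first by rewrite /= inE.
  case: (ord3_cases i) hi => -> hi.
  + exists (bary i2 x); first by rewrite /= in_itv/=; apply/andP; split; lra.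
    have E : bary i1 x = 1 - bary i2 x by lra.
    by apply: plane_eq; rewrite /= ?p1 ?p2 hi E; ring.
  + exists (bary i0 x); first by rewrite /= in_itv/=; apply/andP; split; lra.
    have E : bary i2 x = 1 - bary i0 x by lra.
    by apply: plane_eq; rewrite /= ?p1 ?p2 hi E; ring.
  + exists (bary i1 x); first by rewrite /= in_itv/=; apply/andP; split; lra.
    have E : bary i0 x = 1 - bary i1 x by lra.
    by apply: plane_eq; rewrite /= ?p1 ?p2 hi E; ring.
- move=> [i _ [t tI <-]]; move: tI; rewrite /= in_itv/= => /andP[t0 t1].
  set y := param _ _.
  split; last by move=> /(_ i); rewrite bary_side ltxx.
  pose g : plane R := ((a.1 + b.1 + c.1) / 3, (a.2 + b.2 + c.2) / 3).
  have bg j : bary j g = 3^-1.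
    rewrite /bary /g; move: d0; case: (ord3_cases j) => -> /=;
      by rewrite /det3 /cross /= => h; field.
  have ge j : 0 <= bary j y.
    by rewrite /y bary_on_side; case: ifP => // _; case: ifP; rewrite ?subr_ge0.
  move=> U /nbhs_ballP[e /= e0 HU].
  pose K := `|g.1 - y.1| + `|g.2 - y.2| + 1.
  have K0 : 0 < K by rewrite ltr_wpDl.
  pose r := Num.min 1 (e / K) / 2.
  have m0 : 0 < Num.min 1 (e / K) by rewrite lt_min ltr01 divr_gt0.
  have r0 : 0 < r by rewrite divr_gt0.
  have r1 : r < 1.
    have : Num.min 1 (e / K) <= 1 by rewrite ge_min lexx.
    by rewrite /r; lra.
  have rK : r * K < e.
    rewrite -ltr_pdivlMr//; have : Num.min 1 (e / K) <= e / K by rewrite ge_min lexx orbT.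
    by rewrite /r; lra.
  exists (param (y, g) r); split.
    by move=> j; rewrite bary_affine bg; have := ge j; nra.
  have k1 : r * `|g.1 - y.1| < e.
    apply: le_lt_trans rK; rewrite ler_pM2l// /K.
    by have := normr_ge0 (g.2 - y.2); lra.
  have k2 : r * `|g.2 - y.2| < e.
    apply: le_lt_trans rK; rewrite ler_pM2l// /K.
    by have := normr_ge0 (g.1 - y.1); lra.
  by apply: HU; split; rewrite /= /ball /= opprD addNKr normrN normrM gtr0_norm.
Qed.

(** All the conditions can be read in barycentric coordinates: two of them
    vanish at a vertex, and on an open side exactly one does, with a derivative
    along the normal whose sign is known. *)
Lemma triangle_region :
  polygonal_region [set: 'I_3]%SET tri_side tri_normal triangle.
Proof.
split.
- exact: triangle_open.
- exact: triangle_bounded.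
- exact: triangle_boundary.
- move=> i j _ _ ij x [[t _ tx] [u _ ux]].
  have hi : bary i x = 0 by rewrite -tx bary_side.
  have hj : bary j x = 0 by rewrite -ux bary_side.
  have s1 := bary_sum x; have p1 := bary_point1 x; have p2 := bary_point2 x.
  have k0 : bary i1 x = 0 -> bary i2 x = 0 -> x = a.
    move=> e1 e2; have e0 : bary i0 x = 1 by lra.
    by apply: plane_eq; rewrite ?p1 ?p2 e0 e1 e2; ring.
  have k1 : bary i0 x = 0 -> bary i2 x = 0 -> x = b.
    move=> e0 e2; have e1 : bary i1 x = 1 by lra.
    by apply: plane_eq; rewrite ?p1 ?p2 e0 e1 e2; ring.
  have k2 : bary i0 x = 0 -> bary i1 x = 0 -> x = c.
    move=> e0 e1; have e2 : bary i2 x = 1 by lra.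
    by apply: plane_eq; rewrite ?p1 ?p2 e0 e1 e2; ring.
  case: (ord3_cases i) hi ij => ->; case: (ord3_cases j) hj => -> // hj hi _;
  [rewrite (k2 hi hj)|rewrite (k1 hi hj)|rewrite (k2 hj hi)|rewrite (k0 hi hj)
  |rewrite (k1 hj hi)|rewrite (k0 hj hi)];
  by split; [by [left|right]|by [left|right]].
- by move=> i _; exact: tri_side_nondegenerate.
- by move=> i _; exact: tri_normal_is_normal.
- move=> i _ t t01; set y := param _ _.
  pose k j := ((tri_normal i).1 * ((tri_side j).2.2 - (tri_side j).1.2) +
       (tri_normal i).2 * ((tri_side j).1.1 - (tri_side j).2.1)) / det3.
  have ki : 0 < k i.
    have l0 := len_gt0 (@tri_side_nondegenerate i).
    rewrite /k tri_normal_slope; case: (ltrP 0 det3) => h /=; first by rewrite mul1r divr_gt0.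
    rewrite mulN1r mulNr -mulrN -invrN divr_gt0// oppr_gt0 lt_neqAle d0//.
  have gt j : j != i -> 0 < bary j y.
    move: t01 => /andP[t0 t1] /negbTE ji.
    by rewrite /y bary_on_side ji; case: ifP; rewrite ?subr_gt0.
  have yi : bary i y = 0 by rewrite bary_side.
  pose m := \big[Num.min/1]_(j | j != i) (bary j y / (1 + `|k j|)).
  have m0 : 0 < m.
    apply: (big_ind (fun z => 0 < z)) => [|p q p0 q0|j ji]; first exact: ltr01.
      by rewrite lt_min p0.
    by rewrite divr_gt0 ?gt// ltr_pwDl.
  exists m => // r /andP[r0 rm].
  have E (u : R) : bary i (vadd y (vscale u (tri_normal i))) = - u * k i.
    by rewrite bary_shift yi sub0r -mulrA mulNr.
  have vs : vsub y (vscale r (tri_normal i)) = vadd y (vscale (- r) (tri_normal i)).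
    by apply: plane_eq; rewrite /= mulNr.
  split.
  + move=> j; rewrite vs; have [->|ji] := eqVneq j i.
      by rewrite E opprK mulr_gt0.
    rewrite bary_shift -mulrA -/(k j) mulNr opprK.
    have : r < bary j y / (1 + `|k j|) by rewrite (lt_le_trans rm)// /m bigmin_le_cond.
    have kj : 0 < 1 + `|k j| by rewrite ltr_pwDl.
    rewrite (ltr_pdivlMr _ _ kj) mulrDr mulr1 => h.
    have : - (r * k j) <= r * `|k j|.
      by rewrite -mulrN ler_pM2l// -normrN ler_norm.
    by move: h; lra.
  + by move=> /(_ i); rewrite E mulNr oppr_gt0 ltNge mulr_ge0// ltW.
Qed.

End Triangle.

(** * Integrals over segments *)

Section EdgeIntegrals.
Context {R : realType}.
Implicit Types (s : segment R) (f g : plane R -> R).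

Lemma measurable_itv01 : measurable (`[0, 1]%classic : set (measurableTypeR R)).
Proof. exact: measurable_itv. Qed.

Lemma mu1_itv01_lty : (mu1 (`[0%R, 1%R]%classic : set (measurableTypeR R)) < +oo :> \bar R)%E.
Proof. by rewrite /mu1 /= lebesgue_measure_itv /= lte_fin ltr01 -EFinD ltry. Qed.

Definition edge_integrable s f : Prop :=
  mu1.-integrable `[0, 1]%classic (EFin \o (f \o param s)).

Lemma continuous_edge_integrable s f : continuous (f : R * R -> R) ->
  edge_integrable s f.
Proof.
move=> cf; apply: continuous_compact_integrable; first exact: segment_compact.
apply: continuous_subspaceT => t.
by apply: continuous_comp; [exact: param_continuous|exact: cf].
Qed.

Lemma eint_scale s f (r : R) : edge_integrable s f ->
  eint s (fun x => r * f x) = r * eint s f.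
Proof.
move=> hf; rewrite /eint mulrCA; congr (_ * _).
by apply: RintegralZl => //; exact: measurable_itv01.
Qed.

Lemma eint_add s f g : edge_integrable s f -> edge_integrable s g ->
  eint s (fun x => f x + g x) = eint s f + eint s g.
Proof.
move=> hf hg; rewrite /eint -mulrDr; congr (_ * _).
by apply: RintegralD => //; exact: measurable_itv01.
Qed.

Lemma eint_sub s f g : edge_integrable s f -> edge_integrable s g ->
  eint s (fun x => f x - g x) = eint s f - eint s g.
Proof.
move=> hf hg; rewrite /eint -mulrBr; congr (_ * _).
by apply: RintegralB => //; exact: measurable_itv01.
Qed.

Lemma eint_sum s (J : Type) (r : seq J) (P : pred J) (F : J -> plane R -> R) :
  (forall j, P j -> edge_integrable s (F j)) ->
  eint s (fun x => \sum_(j <- r | P j) F j x) = \sum_(j <- r | P j) eint s (F j).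
Proof.
move=> hF; rewrite /eint -mulr_sumr; congr (_ * _).
by apply: Rintegral_bigsum => //; exact: measurable_itv01.
Qed.

Lemma eq_eint s f g : (forall t, 0 <= t <= 1 -> f (param s t) = g (param s t)) ->
  eint s f = eint s g.
Proof.
move=> fg; congr (_ * _); apply: eq_Rintegral => t /set_mem.
by rewrite /= in_itv/=; exact: fg.
Qed.

End EdgeIntegrals.

Section SquareIntegrable.
Context {R : realType}.
Implicit Types (w : plane R -> R).

Lemma continuous_L2_plane (D : set (plane R)) w : measurable D -> bounded_set (D : set (R * R)) ->
  continuous (w : R * R -> R) -> L2 mu2 D w.
Proof.
move=> mD bD cw; have [C C0 HC] := continuous_bounded_on bD cw.
apply: (bounded_L2 mD (C := C)) => //; first exact: bounded_mu2_lty.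
by apply: measurable_funTS; exact: continuous_measurable_plane.
Qed.

Lemma continuous_L2_01 (f : R -> R) : continuous f -> L2 mu1 `[0, 1] f.
Proof.
move=> cf; have [C HC] : exists C : R, forall t, `[0, 1]%classic t -> `|f t| <= C.
  have /compact_bounded[C [_ HC]] : compact (f @` `[0, 1]%classic).
    by apply: continuous_compact; [exact: continuous_subspaceT|exact: segment_compact].
  exists (`|C| + 1) => t tI; apply: HC; last by exists t.
  by rewrite (le_lt_trans (ler_norm _))// ltrDl.
apply: (bounded_L2 measurable_itv01 (C := C)) => //; first exact: mu1_itv01_lty.
by apply: measurable_funTS; exact: continuous_measurable_fun.
Qed.

Lemma continuous_L2_edge (s : segment R) w : continuous (w : R * R -> R) ->
  L2 mu1 `[0, 1] (w \o param s).
Proof.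
move=> cw; apply: continuous_L2_01 => t.
by apply: continuous_comp; [exact: param_continuous|exact: cw].
Qed.

Lemma L2_subset (A B : set (plane R)) w : measurable A -> measurable B ->
  A `<=` B -> L2 mu2 B w -> L2 mu2 A w.
Proof.
move=> mA mB AB [mw iw]; split; first exact: measurable_funS mw.
apply: le_lt_trans iw; apply: ge0_subset_integral => //.
- by apply/measurable_EFinP; exact: measurable_funX.
- by move=> x _; rewrite lee_fin sqr_ge0.
Qed.

Lemma vdot_edge_L2 (s : segment R) (q : @vfield R) n :
  (forall i, L2 mu1 `[0, 1] (q i \o param s)) -> L2 mu1 `[0, 1] (vdot q n \o param s).
Proof.
move=> qL; rewrite (_ : _ \o _ = fun t => Defs.coord n ord0 * q ord0 (param s t) +
    Defs.coord n ord_max * q ord_max (param s t)); last first.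
  by apply/funext => t /=; rewrite /vdot sum_ord2; congr (_ + _); exact: mulrC.
by apply: L2_add => //; apply: L2_scale => //; exact: qL.
Qed.

End SquareIntegrable.

(** * The trace inequality on a triangle *)

Section Energy.
Context {R : realType}.

Definition energy (D : set (plane R)) (w : plane R -> R) : R :=
  \int[mu2]_(x in D) (w x ^+ 2 + \sum_(i < 2) pderiv i w x ^+ 2).

Lemma energy_density_continuous (w : plane R -> R) : Cn 1 w ->
  continuous ((fun x => w x ^+ 2 + \sum_(i < 2) pderiv i w x ^+ 2) : R * R -> R).
Proof.
move=> Cw; have sq f : continuous (f : R * R -> R) -> continuous ((fun x => f x ^+ 2) : R * R -> R).
  by move=> cf; under eq_fun do rewrite expr2; exact: continuous_mul.
apply: (@continuous_add _ (fun x => w x ^+ 2)); first exact/sq/C1_continuous.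
rewrite (_ : (fun x => _) = (fun x => pderiv ord0 w x ^+ 2 + pderiv ord_max w x ^+ 2)).
  by apply: continuous_add; apply: sq; exact: C1_pderiv_continuous.
by apply/funext => x; exact: sum_ord2.
Qed.

Lemma energy_density_ge0 (w : plane R -> R) x :
  0 <= w x ^+ 2 + \sum_(i < 2) pderiv i w x ^+ 2.
Proof. by rewrite addr_ge0 ?sqr_ge0// sumr_ge0// => i _; exact: sqr_ge0. Qed.

Lemma Rintegral_subset (A B : set (plane R)) (f : plane R -> R) : measurable A ->
  measurable B -> A `<=` B -> (forall x, 0 <= f x) -> mu2.-integrable B (EFin \o f) ->
  \int[mu2]_(x in A) f x <= \int[mu2]_(x in B) f x.
Proof.
move=> mA mB AB f0 fi; rewrite -lee_fin.
rewrite -!integralE_Rintegral//; last exact: integrableS fi.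
apply: ge0_subset_integral => //.
- by case/integrableP : fi.
- by move=> x _; rewrite lee_fin.
Qed.

Lemma energy_subset A B (w : plane R -> R) : measurable A -> measurable B ->
  bounded_set (B : set (R * R)) -> A `<=` B -> Cn 1 w -> energy A w <= energy B w.
Proof.
move=> mA mB bB AB Cw; apply: Rintegral_subset => //.
  exact: energy_density_ge0.
by apply: continuous_integrable_plane => //; exact: energy_density_continuous.
Qed.

End Energy.

Section TriangleTrace.
Context {R : realType} (a b c : plane R) (d0 : det3 a b c != 0).

Let i0 : 'I_3 := @Ordinal 3 0 isT.

Lemma triangle_height_gt0 : 0 < dot (vsub b a) (tri_normal a b c i0).
Proof.
have ndeg := @tri_side_nondegenerate R a b c d0 i0.
have l0 := len_gt0 ndeg.
rewrite -(pmulr_rgt0 _ l0) dotE mulrDr.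
rewrite /tri_normal; case: (ltrP 0 (det3 a b c)) => h /=.
  set l := len _; rewrite [X in 0 < X](_ : _ = det3 a b c)//.
  by rewrite /det3 /cross /=; field; rewrite gt_eqF.
set l := len _; rewrite [X in 0 < X](_ : _ = - det3 a b c).
  by rewrite oppr_gt0 lt_neqAle d0.
by rewrite /det3 /cross /=; field; rewrite gt_eqF.
Qed.

Lemma triangle_height_side (i : 'I_3) (t : R) :
  dot (vsub (param (tri_side a b c i) t) a) (tri_normal a b c i) =
  if i == i0 then dot (vsub b a) (tri_normal a b c i0) else 0.
Proof.
have ndeg := @tri_side_nondegenerate R a b c d0 i.
have E u := dot_normal_param t u ndeg (tri_normal_is_normal a b c i).
case: (ord3_cases i) => ii; rewrite ii /= in E *.
- rewrite -[RHS]add0r -(E 0) !dotE /=; ring.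
- by rewrite -(E 1) !dotE /=; ring.
- by rewrite -(E 0) !dotE /=; ring.
Qed.

(** Trace inequality: the position vector relative to the apex is tangential to
    the two sides through the apex and has a constant positive flux through the
    third one, so the divergence theorem for its product with w^2 leaves the
    integral of w^2 on that side only. *)
Lemma triangle_trace_inequality : exists2 C : R, 0 < C & forall w, Cn 1 w ->
  eint (b, c) (fun x => w x ^+ 2) <=
  C * energy (triangle a b c) w.
Proof.
have HD := triangle_region d0.
set D := triangle a b c in HD *.
have mD := region_measurable HD.
have bD := region_bounded HD.
(* the position vector relative to the apex a *)
pose X (i : 'I_2) (x : plane R) : R := Defs.coord x i + - Defs.coord a i.
have hX i : has_partials (X i) (fun j => cst (j == i)%:R).
  apply: has_partials_ext (has_partials_add (has_partials_coord i)
    (has_partials_cst (- Defs.coord a i))) _.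
  by move=> j x; rewrite /= addr0.
have cX i : continuous (X i : R * R -> R) by case: (hX i).
have [B0 B0p HB0] := continuous_bounded_on bD (cX ord0).
have [B1 B1p HB1] := continuous_bounded_on bD (cX ord_max).
pose B : R := B0 + B1.
have HB i x : D x -> `|X i x| <= B.
  move=> Dx; case: (ord2_cases i) => ->.
    by apply: le_trans (HB0 _ Dx) _; rewrite lerDl ltW.
  by apply: le_trans (HB1 _ Dx) _; rewrite lerDr ltW.
have kp := triangle_height_gt0; set kappa := dot _ _ in kp.
have Bp : 0 < B by rewrite addr_gt0.
(* Each component of the divergence is at most 2 w^2 + B^2 (d_i w)^2; there are
   two of them. *)
exists ((4 + B ^+ 2) / kappa) => [|w Cw].
  by rewrite divr_gt0// ltr_pwDl// sqr_ge0.
have cw := C1_continuous Cw.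
have cp i := C1_pderiv_continuous (i := i) Cw.
have hw := C1_has_partials Cw.
pose F (i : 'I_2) x := w x * w x * X i x.
have hF i := has_partials_mul (has_partials_mul hw hw) (hX i).
have DT i := divergence_theorem HD i (has_partials_C1 (hF i)).
have iD (g : plane R -> R) : continuous (g : R * R -> R) ->
    mu2.-integrable D (EFin \o g).
  by move=> cg; exact: continuous_integrable_plane.
have cF i : continuous (F i : R * R -> R) by case: (hF i).
have flux : \sum_(i < 2) \int[mu2]_(x in D) pderiv i (F i) x =
    kappa * eint (b, c) (fun x => w x ^+ 2).
  under eq_bigr do rewrite DT; rewrite exchange_big /=.
  transitivity (\sum_(e in [set: 'I_3]%SET) if e == i0 then
      kappa * eint (b, c) (fun x => w x ^+ 2) else 0); last first.
    rewrite -big_mkcondr (big_pred1 i0)// => e.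
    by rewrite inE.
  apply: eq_bigr => e _.
  rewrite -(@eint_sum _ _ _ _ _ (fun i x => w x * w x * X i x * Defs.coord (tri_normal a b c e) i)); last first.
    move=> i _; apply: continuous_edge_integrable.
    by apply: (@continuous_mul _ (F i)) => // x; exact: cvg_cst.
  have E t : \sum_(i < 2) w (param (tri_side a b c e) t) * w (param (tri_side a b c e) t) *
      X i (param (tri_side a b c e) t) * Defs.coord (tri_normal a b c e) i =
      (if e == i0 then kappa else 0) * w (param (tri_side a b c e) t) ^+ 2.
    rewrite /kappa -(triangle_height_side e t) /dot mulr_suml.
    apply: eq_bigr => i _; rewrite /X /Defs.coord.
    by case: (ord2_cases i) => -> /=; ring.
  transitivity (eint (tri_side a b c e) (fun x => (if e == i0 then kappa else 0) * w x ^+ 2)).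
    by apply: eq_eint => t _; exact: E.
  rewrite eint_scale; last first.
    by apply: continuous_edge_integrable; under eq_fun do rewrite expr2; exact: continuous_mul.
  by case: eqP => [->|]; rewrite ?mul0r.
rewrite mulrAC ler_pdivlMr// mulrC -flux.
have dF i : pderiv i (F i) = fun x => w x ^+ 2 + 2 * (w x * pderiv i w x * X i x).
  rewrite (has_partials_pderiv i (hF i)); apply/funext => x /=.
  by rewrite eqxx /=; ring.
have cdF i : continuous (pderiv i (F i) : R * R -> R).
  exact: C1_pderiv_continuous (has_partials_C1 (hF i)).
rewrite -Rintegral_bigsum//; last by move=> i _; exact: iD.
have c2 := energy_density_continuous Cw.
rewrite /energy -RintegralZl//; last exact: iD.
apply: le_Rintegral => //.
- apply: (@integrable_bigsum _ _ _ mu2 D mD) => i _; exact: iD.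
- by apply: integrable_scale => //; exact: iD.
move=> x Dx.
have step i : pderiv i (F i) x <= 2 * w x ^+ 2 + B ^+ 2 * pderiv i w x ^+ 2.
  rewrite dF; have := HB i x Dx; move: (X i x) (w x) (pderiv i w x) => z u v zB.
  have h1 := sqr_ge0 (u - v * z).
  have h2 : z ^+ 2 <= B ^+ 2.
    by rewrite -(real_normK (num_real z)) lerXn2r ?nnegrE// ltW.
  have h3 := ler_wpM2r (sqr_ge0 v) h2.
  by move: h1 h3; rewrite sqrrB exprMn; lra.
apply: (@le_trans _ _ (\sum_(i < 2) (2 * w x ^+ 2 + B ^+ 2 * pderiv i w x ^+ 2))).
  exact: ler_sum.
rewrite big_split /= sumr_const card_ord -mulr_sumr.
have h1 := sqr_ge0 (w x).
have h2 : 0 <= \sum_(i < 2) pderiv i w x ^+ 2 by apply: sumr_ge0 => i _; exact: sqr_ge0.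
have h3 := sqr_ge0 B.
move: (\sum_(i < 2) _) (w x ^+ 2) (B ^+ 2) h1 h2 h3 => p q r h1 h2 h3.
rewrite -mulr_natr; nra.
Qed.

End TriangleTrace.

(** * Cells of a mesh *)

Section Segments.
Context {R : realType}.
Implicit Types (s : segment R) (D : set (plane R)).

Lemma onormal_is_normal D s : is_normal s (onormal D s).
Proof. by rewrite /onormal; case: ifP => _; [left|right]. Qed.

Definition one_sided D s : Prop :=
  points_outward D s (snormal s) \/ points_outward D s (vscale (-1) (snormal s)).

Lemma onormal_outward D s : one_sided D s -> points_outward D s (onormal D s).
Proof. by rewrite /onormal; case: asboolP => [//|n] [/n|]. Qed.

Definition reverse s : segment R := (s.2, s.1).

Lemma param_reverse s t : param (reverse s) t = param s (1 - t).
Proof. by apply: plane_eq; rewrite /=; ring. Qed.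

Lemma segset_reverse s : segset (reverse s) = segset s.
Proof.
apply/seteqP; split => x [t tI <-]; exists (1 - t).
- by move: tI; rewrite /= !in_itv/=; lra.
- by rewrite param_reverse.
- by move: tI; rewrite /= !in_itv/=; lra.
- by rewrite param_reverse; congr param; ring.
Qed.

Lemma snormal_reverse s : snormal (reverse s) = vscale (-1) (snormal s).
Proof.
have -> : snormal (reverse s) = vscale (len s)^-1 (s.1.2 - s.2.2, s.2.1 - s.1.1).
  by rewrite /snormal (_ : len (reverse s) = len s)// /len /enorm !dotE /=; congr Num.sqrt; ring.
by apply: plane_eq; rewrite /=; ring.
Qed.

Lemma outward_reverse D s nu : points_outward D s nu -> points_outward D (reverse s) nu.
Proof.
move=> h t t01; rewrite param_reverse; apply: h.
by move: t01; rewrite /=; lra.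
Qed.

Lemma one_sided_reverse D s : one_sided D s -> one_sided D (reverse s).
Proof.
rewrite /one_sided snormal_reverse => -[] h; [right|left]; apply: outward_reverse => //.
by rewrite (_ : vscale _ _ = snormal s)//; apply: plane_eq; rewrite /= !mulN1r opprK.
Qed.

Lemma same_segmentP s s' : same_segment s s' -> s' = s \/ s' = reverse s.
Proof. by move=> [->|->]; [left|right; case: s']. Qed.

Lemma sides_of_nondegenerate (p : seq (plane R)) s : (2 < size p)%N -> uniq p ->
  s \in sides_of p -> s.1 <> s.2.
Proof.
case: p => [//|x p] sp up /(nthP (x, x))[i].
rewrite size_zip size_rot minnn => ip <-; rewrite nth_zip ?size_rot//= => h.
rewrite rot1_cons nth_rcons in h.
move: ip; rewrite /= ltnS leq_eqVlt => /orP[/eqP ip|ip].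
  rewrite ip ltnn eqxx in h.
  have /eqP := h; rewrite -[X in _ == X]/(nth x (x :: p) 0) nth_uniq//= => /eqP p0.
  by move: sp; rewrite /= p0.
rewrite ip in h.
have /eqP := h; rewrite -[X in _ == X]/(nth x (x :: p) i.+1) nth_uniq//=; last first.
  by rewrite ltnW.
by rewrite -[X in X == _]addn0 -addn1 eqn_add2l.
Qed.

End Segments.

Section Cells.
Context {R : realType} {Omega : set (plane R)} {M : mesh R}
  (hM : partition_of Omega M).
Implicit Types (T : cell M) (e : edge M).

Definition cell_normal T e : plane R := onormal (dom T) (ends e).

Lemma cell_region T : polygonal_region (sides T) (@ends R M) (cell_normal T) (dom T).
Proof.
have [[/(_ T)[p [[[oD cD nD bD] /andP[sp up] bE _ os] se es]] _ _ _ _] meet] := hM.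
have side e : e \in sides T -> exists2 s, s \in sides_of p &
    ends e = s \/ ends e = reverse s.
  by move=> eT; have [s sp' /same_segmentP h] := es _ eT; exists s.
split => //.
- rewrite bE; apply/seteqP; split => x.
    move=> [s /= sp' xs]; have [e eT /same_segmentP h] := se _ sp'.
    by exists e => //; case: h => ->; rewrite ?segset_reverse.
  move=> [e /= eT xe]; have [s sp' h] := side _ eT; exists s => //.
  by move: xe; case: h => ->; rewrite ?segset_reverse.
- by move=> e e' _ _; exact: meet.
- move=> e eT; have [s sp' h] := side _ eT.
  have ns := sides_of_nondegenerate sp up sp'.
  by case: h => -> //= /esym.
- by move=> e _; exact: onormal_is_normal.
- move=> e eT; apply: onormal_outward; have [s sp' h] := side _ eT.
  by case: h => ->; [exact: os|apply: one_sided_reverse; exact: os].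
Qed.

Lemma cell_sub T : dom T `<=` Omega.
Proof. by case: hM => -[]. Qed.

Lemma edge_side e : exists T, e \in sides T.
Proof. by case: hM => -[]. Qed.

Lemma edge_nondegenerate e : (ends e).1 <> (ends e).2.
Proof. by have [T eT] := edge_side e; exact: (region_nondegenerate (cell_region T) eT). Qed.

Lemma side_on_boundary T e (t : R) : e \in sides T -> 0 <= t <= 1 ->
  closure (dom T : set (R * R)) (param (ends e) t) /\ ~ dom T (param (ends e) t).
Proof.
move=> eT t01; have : boundary (dom T) (param (ends e) t).
  by rewrite (region_boundary (cell_region T)); exists e => //; exists t.
by rewrite boundaryE; [case|exact: region_open (cell_region T)].
Qed.

Lemma cell_measurable T : measurable (dom T).
Proof. exact: region_measurable (cell_region T). Qed.

Lemma cell_bounded T : bounded_set (dom T : set (R * R)).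
Proof. exact: region_bounded (cell_region T). Qed.

(** Shape regularity provides, on each side of a cell, a triangle contained in
    the cell: its apex sees the side at a positive distance from the line. *)
Lemma cell_trace_inequality (rho : R) (K : nat) : 0 < rho -> shape_regular M rho K ->
  forall T e, e \in sides T -> exists2 C : R, 0 < C & forall w, Cn 1 w ->
    eint (ends e) (fun x => w x ^+ 2) <= C * energy (dom T) w.
Proof.
move=> rho0 [_ _ /(_ _) tri _] T e eT; have [A [inT far]] := tri T e eT.
set b := (ends e).1; set c := (ends e).2.
have bc : b <> c := @edge_nondegenerate e.
have hn := onormal_is_normal (dom T) (ends e).
set nu := onormal _ _ in hn far.
have ge0 t : 0 <= t <= 1 -> rho * enorm (vsub (param (ends e) t) A) <= dot (vsub (param (ends e) t) A) nu.
  by move=> /far[].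
have dE t : dot (vsub (param (ends e) t) A) nu = dot (vsub b A) nu.
  have := dot_normal_param t 0 bc hn; rewrite /b !dotE /= => E.
  by rewrite -[RHS]add0r -E; ring.
have epos (v : plane R) : v <> (0, 0) -> 0 < enorm v.
  move=> v0; rewrite /enorm sqrtr_gt0 dotE lt_neqAle.
  rewrite addr_ge0 -?expr2 ?sqr_ge0// andbT eq_sym paddr_eq0 ?sqr_ge0//.
  by rewrite !sqrf_eq0; apply/negP => /andP[/eqP v1 /eqP v2]; apply: v0; exact: plane_eq.
(* The bound by enorm is positive at one of the two ends at least, and the height
   is the same at all points of the side. *)
have dpos : 0 < dot (vsub b A) nu.
  have [h0|h0] := pselect (vsub b A = (0, 0)).
    rewrite -(dE 1); apply: lt_le_trans (ge0 1 _); last by rewrite ler01 lexx.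
    rewrite mulr_gt0//; apply: epos => h1; apply: bc.
    move: h0 h1 => /[dup] /(congr1 fst) /= a1 /(congr1 snd) /= a2.
    move=> /[dup] /(congr1 fst) /= b1 /(congr1 snd) /= b2.
    by apply: plane_eq; rewrite /b /c in a1 a2 b1 b2 *; lra.
  rewrite -(dE 0); apply: lt_le_trans (ge0 0 _); last by rewrite ler01 lexx.
  rewrite mulr_gt0//; apply: epos => h1; apply: h0; rewrite -h1.
  by apply: plane_eq; rewrite /= mul0r addr0.
have d0 : det3 A b c != 0.
  have l0 := len_gt0 bc; apply/negP => /eqP h.
  suff : len (ends e) * dot (vsub b A) nu = 0.
    by move/eqP; rewrite mulf_eq0 !gt_eqF.
  rewrite dotE mulrDr !mulrA [len _ * _]mulrC -[_ * len _ * _]mulrA.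
  rewrite [len _ * (vsub b A).2]mulrC -[_ * len _ * _]mulrA.
  case: (normal_len bc hn) => -[-> ->]; rewrite -/b -/c;
  [rewrite -h|rewrite -[RHS]oppr0 -h]; rewrite /det3 /cross /=; ring.
have [C C0 HC] := triangle_trace_inequality d0.
exists C => // w Cw; have := HC w Cw.
rewrite (_ : (b, c) = ends e); last by rewrite /b /c; case: (ends e).
move=> /le_trans; apply; rewrite (ler_wpM2l (ltW C0))//.
apply: (energy_subset _ (cell_measurable T) (cell_bounded T)) => //.
  exact: region_measurable (triangle_region d0).
move=> x hx.
set l0 := bary A b c (@Ordinal 3 0 isT) x.
set l1 := bary A b c (@Ordinal 3 1 isT) x.
set l2 := bary A b c (@Ordinal 3 2 isT) x.
have p0 : 0 < l0 by exact: hx.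
have p1 : 0 < l1 by exact: hx.
have p2 : 0 < l2 by exact: hx.
have s1 : l0 + l1 + l2 = 1 by exact: bary_sum.
have q1 : x.1 = l0 * A.1 + l1 * b.1 + l2 * c.1 by exact: bary_point1.
have q2 : x.2 = l0 * A.2 + l1 * b.2 + l2 * c.2 by exact: bary_point2.
have r0 : 0 < l1 + l2 by lra.
(* x lies on the ray from A through the point of parameter l2 / (l1 + l2) *)
have := inT (l2 / (l1 + l2)) (l1 + l2).
have h1 : 0 < l2 / (l1 + l2) < 1 by rewrite divr_gt0//= ltr_pdivrMr// mul1r; lra.
have h2 : 0 < l1 + l2 < 1 by rewrite r0/=; lra.
move=> /(_ h1 h2).
rewrite (_ : vadd _ _ = x)//; have E : l0 = 1 - l1 - l2 by lra.
apply: plane_eq; rewrite /= ?q1 ?q2 E -/b -/c;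
by field; rewrite gt_eqF.
Qed.

End Cells.

(** * Completeness of L2 *)

Section RieszFischer.
Context d (T : measurableType d) (R : realType) (mu : {measure set T -> \bar R})
  (A : set T) (mA : measurable A).
Local Notation L2 := (L2 mu A).

(** The upper limit makes this total and measurable. *)
Definition pointwise_limit (h : nat -> T -> R) (x : T) : R :=
  fine (limn_esup (fun n => (h n x)%:E)).

Lemma pointwise_limit_cvg (h : nat -> T -> R) x (l : R) :
  (fun n => h n x) @ \oo --> l -> pointwise_limit h x = l.
Proof.
move=> hl.
have hE : (fun n => (h n x)%:E) @ \oo --> l%:E.
  by apply/fine_cvgP; split => //; near=> n.
rewrite /pointwise_limit is_cvg_limn_esupE; last by apply/cvg_ex; exists l%:E.
by rewrite (cvg_lim _ hE).
Unshelve. all: end_near.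
Qed.

Context (h : nat -> T -> R) (K : R) (hL : forall n, L2 (h n))
  (hK : forall n m, (n <= m)%N ->
     \int[mu]_(x in A) ((h n x - h m x) ^+ 2) <= K * 8^-1 ^+ n).

Let g := pointwise_limit h.

Let K0 : 0 <= K.
Proof.
have := hK (leqnn 0); rewrite expr0 mulr1; apply: le_trans.
by apply: Rintegral_ge0 => x _; exact: sqr_ge0.
Qed.

(** The bounds decay fast enough for the squared increments, multiplied by
    4 ^ n, to have a finite sum of integrals; where that sum is finite the
    increments are dominated by a geometric series. *)
Lemma fast_cauchy_ae_cvg : {ae mu, forall x, A x -> (fun n => h n x) @ \oo --> g x}.
Proof.
pose D n x : R := 4 ^+ n * (h n x - h n.+1 x) ^+ 2.
have D0 n x : 0 <= D n x by rewrite mulr_ge0 ?sqr_ge0 ?exprn_ge0.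
have L n : L2 (fun x => h n x - h n.+1 x) by exact: L2_sub.
have iD n : mu.-integrable A (EFin \o D n).
  by apply: integrable_scale => //; exact: L2_sqr_integrable.
have mD n : measurable_fun A (EFin \o D n) by exact: measurable_int (iD n).
pose s x := (\sum_(n <oo) (D n x)%:E)%E.
have D0E n x : (0 <= (D n x)%:E)%E by rewrite lee_fin.
have s_int : (\int[mu]_(x in A) s x < +oo)%E.
  rewrite integral_nneseries//.
  apply: (@le_lt_trans _ _ (K * 2)%:E); last exact: ltry.
  have ip n : (0 <= \int[mu]_(x in A) (D n x)%:E)%E.
    by apply: integral_ge0 => x _; rewrite lee_fin.
  apply: lime_le; first by apply: is_cvg_nneseries => n _ _; exact: ip.
  apply: nearW => n.
  apply: (@le_trans _ _ (K * (2 - 2 * 2^-1 ^+ n))%:E); last first.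
    by rewrite lee_fin ler_wpM2l// gerBl mulr_ge0// exprn_ge0.
  elim: n => [|n IH].
    by rewrite big_geq// lee_fin expr0 mulr1 subrr mulr0.
  rewrite big_nat_recr//=; apply: le_trans (leeD IH (lexx _)) _.
  rewrite (integralE_Rintegral mA (iD n)) -EFinD lee_fin.
  rewrite RintegralZl//; last exact: L2_sqr_integrable.
  have h4 : (0 : R) <= 4 ^+ n by exact: exprn_ge0.
  apply: (@le_trans _ _ (K * (2 - 2 * 2^-1 ^+ n) + 4 ^+ n * (K * 8^-1 ^+ n))).
    by rewrite lerD2l ler_wpM2l// hK.
  have -> : 4 ^+ n * (K * 8^-1 ^+ n) = K * 2^-1 ^+ n.
    by rewrite mulrCA -exprMn; congr (_ * _ ^+ _); field.
  rewrite [leLHS](_ : _ = K * (2 - 2 * 2^-1 ^+ n.+1))//.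
  by rewrite exprS; field.
have ms : measurable_fun A s.
  by apply: ge0_emeasurable_sum => [n x _ _|n _]; [exact: D0E|exact: mD].
have s0 x : (0 <= s x)%E by apply: nneseries_ge0 => n _ _; rewrite lee_fin.
have is_ : mu.-integrable A s.
  by apply/integrableP; split => //; under eq_integral do rewrite gee0_abs//.
have := integrable_ae mA is_; apply: filterS => x sf Ax.
have {}sf := sf Ax.
pose S := fine (s x) + 1.
have S1 : 1 <= S by rewrite lerDr fine_ge0.
have DS n : D n x <= S.
  apply: (@le_trans _ _ (fine (s x))); last by rewrite lerDl.
  rewrite -lee_fin fineK//; apply: le_trans (nneseries_lim_ge n.+1 _); last first.
    by move=> i _ _; rewrite lee_fin.
  rewrite big_nat_recr//= leeDr//; apply: sume_ge0 => i _; by rewrite lee_fin.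
have step n : `|h n.+1 x - h n x| <= S * 2^-1 ^+ n.
  have p2 : (0 : R) < 2 ^+ n by rewrite exprn_gt0.
  rewrite exprVn -ler_pdivrMr ?invr_gt0// invrK distrC.
  rewrite -(@ler_pXn2r _ 2)// ?nnegrE; last 2 first.
    by rewrite mulr_ge0// ltW.
    exact: le_trans S1.
  rewrite exprMn real_normK ?num_real// -exprM mulnC exprM.
  rewrite (_ : 2 ^+ 2 = 4 :> R); last by rewrite -natrX.
  rewrite mulrC (le_trans (DS n))// expr2 ler_peMl// (le_trans _ S1)//.
have cs : cvgn (series (telescope (fun n => h n x))).
  apply: normed_cvg; apply: (@series_le_cvg _ _ (geometric S 2^-1)) => //.
  - by move=> n; rewrite /= normr_ge0.
  - by move=> n; rewrite /geometric /= mulr_ge0 ?exprn_ge0 ?invr_ge0// (le_trans _ S1).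
  - by apply: is_cvg_geometric_series; rewrite ger0_norm ?invr_ge0// invf_lt1// ltr1n.
have ch : cvgn (fun n => h n x).
  rewrite telescopeK in cs.
  have : cvgn ((fun n => h n x - h 0%N x) + cst (h 0%N x)).
    by apply: is_cvgD => //; exact: is_cvg_cst.
  rewrite (_ : _ + _ = fun n => h n x)//; apply/funext => n /=.
  by rewrite /GRing.add /= subrK.
by rewrite /g (pointwise_limit_cvg ch).
Qed.

Lemma pointwise_limit_measurable : measurable_fun A g.
Proof.
apply: (measurableT_comp (fine_measurable measurableT)).
apply: measurable_fun_limn_esup => // n; apply/measurable_EFinP.
by case: (hL n).
Qed.

(** The bound on [h n - h m] passes to the limit in [m] by Fatou's lemma. *)
Lemma fast_cauchy_bound n :
  (\int[mu]_(x in A) ((h n x - g x) ^+ 2)%:E <= (K * 8^-1 ^+ n)%:E)%E.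
Proof.
pose f m x := ((h n x - h m x) ^+ 2)%:E.
have mh m : measurable_fun A (h m) by case: (hL m).
have mf m : measurable_fun A (f m).
  by apply/measurable_EFinP; apply: measurable_funX; exact: measurable_funB.
have f0 m x : A x -> (0 <= f m x)%E by rewrite lee_fin sqr_ge0.
have -> : (\int[mu]_(x in A) ((h n x - g x) ^+ 2)%:E =
    \int[mu]_(x in A) limn_einf (f^~ x))%E.
  apply: ae_eq_integral => //.
  - apply/measurable_EFinP; apply: measurable_funX; apply: measurable_funB => //.
    exact: pointwise_limit_measurable.
  - rewrite /limn_einf; apply: measurableT_comp => //.
    apply: measurable_fun_limn_esup => m.
    by apply: measurableT_comp => //; exact: mf.
  have := fast_cauchy_ae_cvg; apply: filterS => x hx Ax.
  have {}hx := hx Ax.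
  have c : (fun m => (h n x - h m x) ^+ 2) @ \oo --> (h n x - g x) ^+ 2.
    rewrite expr2; under eq_fun do rewrite expr2.
    by apply: cvgM; apply: cvgB => //; exact: cvg_cst.
  have cE : f^~ x @ \oo --> ((h n x - g x) ^+ 2)%:E.
    by apply/fine_cvgP; split => //; near=> m.
  rewrite is_cvg_limn_einfE; last by apply/cvg_ex; eexists; exact: cE.
  by rewrite (cvg_lim _ cE).
apply: (@le_trans _ _ (limn_einf (fun m => \int[mu]_(x in A) f m x)%E)).
  exact: (fatou mu mA mf f0).
rewrite limn_einf_lim; apply: lime_le; first exact: is_cvg_einfs.
apply: nearW => m.
apply: (@le_trans _ _ (\int[mu]_(x in A) f (maxn m n) x)%E).
  by apply: ereal_inf_lbound; exists (maxn m n) => //=; exact: leq_maxl.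
rewrite /f integralE_Rintegral//; last first.
  apply: (L2_sqr_integrable mA (f := fun x => h n x - h (maxn m n) x)).
  exact: L2_sub.
by rewrite lee_fin hK// leq_maxr.
Unshelve. all: end_near.
Qed.

Lemma fast_cauchy_limit_L2 : L2 g.
Proof.
have L : L2 (fun x => h 0%N x - g x).
  split; last exact: le_lt_trans (fast_cauchy_bound 0) (ltry _).
  by apply: measurable_funB; [case: (hL 0)|exact: pointwise_limit_measurable].
have := L2_sub mA (hL 0) L; apply: eq_L2 => x _; by rewrite opprB addrC subrK.
Qed.

(** Completeness of L2, for a sequence that converges fast enough to converge
    almost everywhere without extracting a subsequence. *)
Lemma fast_cauchy_cvg : L2_cvg mu A h g.
Proof.
apply/(L2_cvgE mA hL fast_cauchy_limit_L2).
apply: (@squeeze_cvgr _ _ _ _ (cst 0) (geometric K 8^-1)).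
- apply: nearW => n; apply/andP; split.
    by apply: Rintegral_ge0 => x _; exact: sqr_ge0.
  rewrite /geometric /= -lee_fin -(integralE_Rintegral mA); last first.
    apply: (L2_sqr_integrable mA (f := fun x => h n x - g x)).
    exact: L2_sub fast_cauchy_limit_L2.
  exact: fast_cauchy_bound.
- exact: cvg_cst.
- by apply: cvg_geometric; rewrite ger0_norm ?invr_ge0// invf_lt1// ltr1n.
Qed.

End RieszFischer.

(** * Traces of Sobolev functions *)

Lemma cvg_bigsum {R : realType} (J : Type) (r : seq J) (P : pred J)
    (f : J -> nat -> R) (l : J -> R) :
  (forall j, P j -> f j @ \oo --> l j) ->
  (fun n => \sum_(j <- r | P j) f j n) @ \oo --> \sum_(j <- r | P j) l j.
Proof.
move=> hf; elim: r => [|j r IH].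
  by under eq_fun do rewrite big_nil; rewrite big_nil; exact: cvg_cst.
under eq_fun do rewrite big_cons; rewrite big_cons.
by case: (boolP (P j)) => // Pj; apply: cvgD => //; exact: hf.
Qed.

Section Traces.
Context {R : realType} {Omega : set (plane R)} {M : mesh R}
  (hM : partition_of Omega M) (oOmega : open (Omega : set (R * R)))
  (bOmega : bounded_set (Omega : set (R * R)))
  (rho : R) (K : nat) (rho0 : 0 < rho) (hreg : shape_regular M rho K).
Implicit Types (T : cell M) (e : edge M) (v w g : plane R -> R).

Let mOmega : measurable Omega := open_measurable_plane oOmega.

(** What remains of the definition of a trace when the segments are left out:
    smooth functions converging in H1. *)
Definition approximable v (w : nat -> plane R -> R) : Prop :=
  [/\ L2 mu2 Omega v, forall i, L2 mu2 Omega (wderiv Omega i v),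
      forall n, smooth (w n), L2_cvg mu2 Omega w v &
      forall i, L2_cvg mu2 Omega (fun n => pderiv i (w n)) (wderiv Omega i v)].

Definition H1_distance v w : R :=
  \int[mu2]_(x in Omega) ((w x - v x) ^+ 2) +
  \sum_(i < 2) \int[mu2]_(x in Omega) ((pderiv i w x - wderiv Omega i v x) ^+ 2).

Lemma H1_L2_wderiv v : H1 Omega v -> forall i, L2 mu2 Omega (wderiv Omega i v).
Proof. by move=> [_ h] i; rewrite /wderiv; case: xgetP => [g -> []|/(_ _)] //; have [g hg] := h i => /(_ g hg). Qed.

Lemma is_trace_approximable S v g : H1 Omega v -> is_trace Omega S v g ->
  exists w : nat -> plane R -> R, approximable v w.
Proof.
move=> hv [_ [w [sw wv dwv _]]]; exists w; split => //; first by case: hv.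
exact: H1_L2_wderiv.
Qed.

Section Approximation.
Context v (vL : L2 mu2 Omega v) (dL : forall i, L2 mu2 Omega (wderiv Omega i v)).

Lemma C1_L2 w : Cn 1 w -> L2 mu2 Omega w.
Proof. by move=> Cw; apply: continuous_L2_plane => //; exact: C1_continuous. Qed.

Lemma C1_pderiv_L2 i w : Cn 1 w -> L2 mu2 Omega (pderiv i w).
Proof. by move=> Cw; apply: continuous_L2_plane => //; exact: C1_pderiv_continuous. Qed.

Lemma H1_distance_ge0 w : 0 <= H1_distance v w.
Proof.
apply: addr_ge0; first by apply: Rintegral_ge0 => x _; exact: sqr_ge0.
by apply: sumr_ge0 => i _; apply: Rintegral_ge0 => x _; exact: sqr_ge0.
Qed.

Lemma H1_distance_cvg (w : nat -> plane R -> R) : (forall n, Cn 1 (w n)) ->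
  L2_cvg mu2 Omega w v ->
  (forall i, L2_cvg mu2 Omega (fun n => pderiv i (w n)) (wderiv Omega i v)) ->
  (fun n => H1_distance v (w n)) @ \oo --> (0 : R).
Proof.
move=> Cw wv dwv; rewrite /H1_distance.
under eq_fun do rewrite sum_ord2.
rewrite (_ : (0 : R) = 0 + (0 + 0)); last by rewrite !addr0.
apply: cvgD; first exact/(L2_cvgE mOmega (fun n => C1_L2 (Cw n)) vL).
by apply: cvgD; apply/(L2_cvgE mOmega (fun n => C1_pderiv_L2 _ (Cw n)) (dL _)).
Qed.

Lemma L2_cvg_H1_distance (w : nat -> plane R -> R) : (forall n, Cn 1 (w n)) ->
  (fun n => H1_distance v (w n)) @ \oo --> (0 : R) ->
  L2_cvg mu2 Omega w v /\
  (forall i, L2_cvg mu2 Omega (fun n => pderiv i (w n)) (wderiv Omega i v)).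
Proof.
move=> Cw h; split=> [|i].
  apply/(L2_cvgE mOmega (fun n => C1_L2 (Cw n)) vL).
  apply: (squeeze_cvgr _ (cvg_cst 0) h); apply: nearW => n; apply/andP; split.
    by apply: Rintegral_ge0 => x _; exact: sqr_ge0.
  rewrite lerDl; apply: sumr_ge0 => i _.
  by apply: Rintegral_ge0 => x _; exact: sqr_ge0.
apply/(L2_cvgE mOmega (fun n => C1_pderiv_L2 _ (Cw n)) (dL _)).
apply: (squeeze_cvgr _ (cvg_cst 0) h); apply: nearW => n; apply/andP; split.
  by apply: Rintegral_ge0 => x _; exact: sqr_ge0.
rewrite /H1_distance (bigD1 i)//= addrCA lerDl; apply: addr_ge0.
  by apply: Rintegral_ge0 => x _; exact: sqr_ge0.
by apply: sumr_ge0 => j _; apply: Rintegral_ge0 => x _; exact: sqr_ge0.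
Qed.

Lemma sqr_distance_le (A : set (plane R)) (f g h : plane R -> R) : measurable A ->
  L2 mu2 A f -> L2 mu2 A g -> L2 mu2 A h ->
  \int[mu2]_(x in A) ((f x - g x) ^+ 2) <=
  2 * (\int[mu2]_(x in A) ((f x - h x) ^+ 2) + \int[mu2]_(x in A) ((g x - h x) ^+ 2)).
Proof.
move=> mA fL gL hL.
have i1 := L2_sqr_integrable mA (L2_sub mA fL gL).
have i2 := L2_sqr_integrable mA (L2_sub mA fL hL).
have i3 := L2_sqr_integrable mA (L2_sub mA gL hL).
rewrite -RintegralD// -RintegralZl//; last exact: integrable_add.
apply: le_Rintegral => //.
  by apply: integrable_scale => //; exact: integrable_add.
move=> x _; have := sqr_ge0 (f x + g x - 2 * h x).
by move: (f x) (g x) (h x) => a b c; rewrite !expr2; lra.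
Qed.

Lemma energy_sub_le w w' : Cn 1 w -> Cn 1 w' ->
  energy Omega (fun x => w x - w' x) <= 2 * (H1_distance v w + H1_distance v w').
Proof.
move=> Cw Cw'.
have hw := has_partials_add (C1_has_partials Cw) (has_partials_scale (-1) (C1_has_partials Cw')).
have E : (fun x => w x - w' x) = (fun x => w x + -1 * w' x).
  by apply/funext => x; rewrite mulN1r.
have dE i : pderiv i (fun x => w x - w' x) = fun x => pderiv i w x - pderiv i w' x.
  rewrite E (has_partials_pderiv i hw); apply/funext => x; by rewrite mulN1r.
rewrite /energy; under eq_Rintegral do (under eq_bigr do rewrite dE).
have L1 := L2_sub mOmega (C1_L2 Cw) (C1_L2 Cw').
have L3 i := L2_sub mOmega (C1_pderiv_L2 i Cw) (C1_pderiv_L2 i Cw').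
rewrite RintegralD//; last 2 first.
- exact: L2_sqr_integrable L1.
- by apply: (@integrable_bigsum _ _ _ mu2 Omega mOmega) => i _; exact: (L2_sqr_integrable mOmega (L3 i)).
rewrite Rintegral_bigsum//; last first.
  by move=> i _; exact: (L2_sqr_integrable mOmega (L3 i)).
rewrite /H1_distance [X in _ <= 2 * X]addrACA mulrDr; apply: lerD.
  by apply: sqr_distance_le => //; exact: C1_L2.
rewrite -big_split /= mulr_sumr; apply: ler_sum => i _.
by apply: sqr_distance_le => //; exact: C1_pderiv_L2.
Qed.

(** The trace inequality, applied to a difference of approximations. *)
Lemma edge_distance_le e : exists2 C : R, 0 < C & forall w w', Cn 1 w -> Cn 1 w' ->
  \int[mu1]_(t in `[0, 1]) ((w (param (ends e) t) - w' (param (ends e) t)) ^+ 2) <=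
  C * (H1_distance v w + H1_distance v w').
Proof.
have [T eT] := edge_side hM e.
have [C C0 HC] := cell_trace_inequality hM rho0 hreg eT.
have l0 := len_gt0 (@edge_nondegenerate _ _ _ hM e).
exists (2 * C / len (ends e)) => [|w w' Cw Cw']; first by rewrite divr_gt0 ?mulr_gt0.
have Cww : Cn 1 (fun x => w x - w' x).
  rewrite (_ : (fun x => _) = (fun x => w x + -1 * w' x)); last first.
    by apply/funext => x; rewrite mulN1r.
  apply: has_partials_C1; apply: has_partials_add; first exact: C1_has_partials.
  by apply: has_partials_scale; exact: C1_has_partials.
rewrite mulrAC ler_pdivlMr// mulrC -mulrA [C * _]mulrC mulrA.
have := HC _ Cww; rewrite /eint => /le_trans; apply.
rewrite mulrC ler_pM2r//; apply: le_trans (energy_sub_le Cw Cw').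
by apply: energy_subset => //; [exact: (cell_measurable hM)|exact: (cell_sub hM)].
Qed.

End Approximation.

(** A smooth sequence converging in H1 converges in L2 on every edge, by the
    trace inequality; its fast subsequences converge almost everywhere on every
    edge, which gives one trace for the whole skeleton. *)
Lemma trace_exists v (w : nat -> plane R -> R) : approximable v w ->
  exists g, is_trace Omega (skeleton M) v g.
Proof.
move=> [vL dL sw wv dwv].
have Cw n : Cn 1 (w n) := smooth_C1 (sw n).
have /cvgrPdist_le H := H1_distance_cvg vL dL Cw wv dwv.
have [s Hs] : {s : nat -> nat & forall k, H1_distance v (w (s k)) <= 8^-1 ^+ k}.
  apply: (@choice _ _ (fun k n => H1_distance v (w n) <= 8^-1 ^+ k)) => k.
  have /H[N _ HN] : 0 < 8^-1 ^+ k :> R by rewrite exprn_gt0 ?invr_gt0.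
  exists N; have := HN N (leqnn N); rewrite sub0r normrN => /(le_trans _); apply.
  exact: ler_norm.
pose w' k := w (s k).
have Cw' k : Cn 1 (w' k) := Cw (s k).
have d'0 : (fun k => H1_distance v (w' k)) @ \oo --> (0 : R).
  apply: (@squeeze_cvgr _ _ _ _ (cst 0) (GRing.exp 8^-1)).
  - by apply: nearW => k; rewrite H1_distance_ge0 Hs.
  - exact: cvg_cst.
  - by apply: cvg_expr; rewrite ger0_norm ?invr_ge0// invf_lt1// ltr1n.
have [w'v dw'v] := L2_cvg_H1_distance vL dL Cw' d'0.
pose g := pointwise_limit w'.
have edgeP e : L2 mu1 `[0, 1] (g \o param (ends e)) /\
    L2_cvg mu1 `[0, 1] (fun n => w' n \o param (ends e)) (g \o param (ends e)).
  have hL n : L2 mu1 `[0, 1] (w' n \o param (ends e)).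
    by apply: continuous_L2_edge; exact: C1_continuous.
  have [C C0 HC] := edge_distance_le vL dL e.
  have hK n m : (n <= m)%N -> \int[mu1]_(t in `[0, 1])
      (((w' n \o param (ends e)) t - (w' m \o param (ends e)) t) ^+ 2) <=
      (2 * C) * 8^-1 ^+ n.
    move=> nm; apply: le_trans (HC _ _ (Cw' n) (Cw' m)) _.
    rewrite [2 * C]mulrC -mulrA ler_pM2l// mulr2n mulrDl mul1r.
    apply: lerD; first exact: Hs.
    apply: le_trans (Hs m) _; rewrite ler_wiXn2l ?invr_ge0//.
    by rewrite invf_le1// ler1n.
  split; first exact: (fast_cauchy_limit_L2 measurable_itv01 hL hK).
  exact: (fast_cauchy_cvg measurable_itv01 hL hK).
exists g; split; first by move=> _ [e _ <-]; case: (edgeP e).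
exists w'; split => //; first by move=> n; exact: sw.
by move=> _ [e _ <-]; case: (edgeP e).
Qed.

Lemma trace_is_trace v (w : nat -> plane R -> R) : approximable v w ->
  is_trace Omega (skeleton M) v (trace Omega (skeleton M) v).
Proof.
move=> /trace_exists[g hg]; rewrite /trace; case: xgetP => [h -> //|].
by move=> /(_ g).
Qed.

(** Two approximating sequences come close to each other in H1, hence also on an
    edge by the trace inequality. *)
Lemma trace_unique_ae (S S' : set (segment R)) v g g' e : H1 Omega v ->
  is_trace Omega S v g -> is_trace Omega S' v g' -> S (ends e) -> S' (ends e) ->
  {ae mu1, forall t, t \in `[0, 1] -> g (param (ends e) t) = g' (param (ends e) t)}.
Proof.
move=> hv [gL [w [sw wv dwv wg]]] [gL' [w' [sw' wv' dwv' wg']]] Se Se'.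
have vL : L2 mu2 Omega v by case: hv.
have dL := H1_L2_wderiv hv.
have {}gL := gL _ Se; have {}gL' := gL' _ Se'.
have mI := @measurable_itv01 R.
have Cw n : Cn 1 (w n) := smooth_C1 (sw n).
have Cw' n : Cn 1 (w' n) := smooth_C1 (sw' n).
have wL n : L2 mu1 `[0, 1] (w n \o param (ends e)).
  by apply: continuous_L2_edge; exact: C1_continuous.
have wL' n : L2 mu1 `[0, 1] (w' n \o param (ends e)).
  by apply: continuous_L2_edge; exact: C1_continuous.
have [C C0 HC] := edge_distance_le vL dL e.
pose G := g \o param (ends e); pose G' := g' \o param (ends e).
pose N f := \int[mu1]_(t in `[0, 1]) ((f t) ^+ 2) : R.
have bound n : N (fun t => G t - G' t) <=
    3 * (N (fun t => w n (param (ends e) t) - G t) +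
         N (fun t => w' n (param (ends e) t) - G' t) +
         C * (H1_distance v (w n) + H1_distance v (w' n))).
  have hC := HC _ _ (Cw n) (Cw' n).
  have i1 := L2_sqr_integrable mI (L2_sub mI gL gL').
  have i2 := L2_sqr_integrable mI (L2_sub mI (wL n) gL).
  have i3 := L2_sqr_integrable mI (L2_sub mI (wL' n) gL').
  have i4 := L2_sqr_integrable mI (L2_sub mI (wL n) (wL' n)).
  apply: (@le_trans _ _ (3 * (N (fun t => w n (param (ends e) t) - G t) +
         N (fun t => w' n (param (ends e) t) - G' t) +
         N (fun t => w n (param (ends e) t) - w' n (param (ends e) t))))); last first.
    by rewrite ler_pM2l// lerD2l.
  have i23 := integrable_add mI i2 i3.
  rewrite /N -RintegralD// -RintegralD// -RintegralZl//; last exact: integrable_add.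
  apply: le_Rintegral => //.
    by apply: integrable_scale => //; exact: integrable_add.
  move=> t _; move: (G t) (G' t) (w _ _) (w' _ _) => a b c d.
  rewrite -subr_ge0 (_ : _ - _ = ((a - c) - (c - d)) ^+ 2 +
    ((a - c) - (d - b)) ^+ 2 + ((c - d) - (d - b)) ^+ 2); last by ring.
  by rewrite !addr_ge0// sqr_ge0.
have lim0 : (fun n => 3 * (N (fun t => w n (param (ends e) t) - G t) +
         N (fun t => w' n (param (ends e) t) - G' t) +
         C * (H1_distance v (w n) + H1_distance v (w' n)))) @ \oo --> (0 : R).
  rewrite (_ : (0 : R) = 3 * (0 + 0 + C * (0 + 0))); last by ring.
  apply: cvgM; first exact: cvg_cst.
  apply: cvgD; last first.
    apply: cvgM; first exact: cvg_cst.
    by apply: cvgD; apply: H1_distance_cvg.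
  apply: cvgD; first exact/(L2_cvgE mI wL gL)/wg.
  exact/(L2_cvgE mI wL' gL')/wg'.
have N0 : N (fun t => G t - G' t) = 0.
  apply/eqP; rewrite eq_le; apply/andP; split; last first.
    by apply: Rintegral_ge0 => t _; exact: sqr_ge0.
  rewrite -(cvg_lim _ lim0)//; apply: limr_ge; first by apply/cvg_ex; exists 0.
  exact: nearW.
have := Rintegral_sqr_eq0 mI (L2_sub mI gL gL') N0.
by apply: filterS => t ht tI; apply/eqP; rewrite -subr_eq0; apply/eqP/ht.
Qed.

(** All the terms of the formula for smooth functions are continuous for the
    convergence that defines the trace. *)
Lemma green_H1 T i v g (q : plane R -> R) : H1 Omega v ->
  is_trace Omega (skeleton M) v g -> Cn 1 q ->
  \int[mu2]_(x in dom T) (wderiv Omega i v x * q x) +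
  \int[mu2]_(x in dom T) (v x * pderiv i q x) =
  \sum_(e in sides T) eint (ends e)
     (fun x => g x * q x * Defs.coord (cell_normal T e) i).
Proof.
move=> hv [gL [w [sw wv dwv wg]]] Cq.
have vL : L2 mu2 Omega v by case: hv.
have dL := H1_L2_wderiv hv.
have mT := cell_measurable hM T; have bT := cell_bounded hM T.
have sub := @cell_sub _ _ _ hM T.
have Cw n : Cn 1 (w n) := smooth_C1 (sw n).
have cq := C1_continuous Cq.
have restrict (f : nat -> plane R -> R) h : (forall n, L2 mu2 Omega (f n)) ->
    L2 mu2 Omega h -> L2_cvg mu2 Omega f h -> L2_cvg mu2 (dom T) f h.
  move=> fL hL /(L2_cvgE mOmega fL hL) fh.
  apply/(L2_cvgE mT (fun n => L2_subset mT mOmega sub (fL n)) (L2_subset mT mOmega sub hL)).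
  apply: (squeeze_cvgr _ (cvg_cst 0) fh); apply: nearW => n; apply/andP; split.
    by apply: Rintegral_ge0 => x _; exact: sqr_ge0.
  apply: Rintegral_subset => // [x|]; first exact: sqr_ge0.
  exact: L2_sqr_integrable (L2_sub mOmega (fL n) hL).
have LT h : L2 mu2 Omega h -> L2 mu2 (dom T) h := L2_subset mT mOmega sub.
have c1 := L2_cvg_mul mT (fun n => LT _ (C1_pderiv_L2 i (Cw n))) (LT _ (dL i))
  (restrict _ _ (fun n => C1_pderiv_L2 i (Cw n)) (dL i) (dwv i))
  (continuous_L2_plane mT bT cq).
have c2 := L2_cvg_mul mT (fun n => LT _ (C1_L2 (Cw n))) (LT _ vL)
  (restrict _ _ (fun n => C1_L2 (Cw n)) vL wv)
  (continuous_L2_plane mT bT (C1_pderiv_continuous (i := i) Cq)).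
have c3 : (fun n => \sum_(e in sides T) eint (ends e)
     (fun x => w n x * q x * Defs.coord (cell_normal T e) i)) @ \oo -->
   \sum_(e in sides T) eint (ends e)
     (fun x => g x * q x * Defs.coord (cell_normal T e) i).
  apply: cvg_bigsum => e eT; apply: cvgM; first exact: cvg_cst.
  have Se : @skeleton R M (ends e) by exists e.
  have qL : L2 mu1 `[0, 1] ((fun x => q x * Defs.coord (cell_normal T e) i) \o param (ends e)).
    by apply: continuous_L2_edge; apply: continuous_mul => // x; exact: cvg_cst.
  have := L2_cvg_mul measurable_itv01
    (fun n => continuous_L2_edge (ends e) (C1_continuous (Cw n))) (gL _ Se) (wg _ Se) qL.
  have EA (h : plane R -> R) : \int[mu1]_(t in `[0, 1])
      (h (param (ends e) t) * q (param (ends e) t) * Defs.coord (cell_normal T e) i) =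
      \int[mu1]_(t in `[0, 1]) ((h \o param (ends e)) t *
        ((fun x => q x * Defs.coord (cell_normal T e) i) \o param (ends e)) t).
    by apply: eq_Rintegral => t _; rewrite /= mulrA.
  by move=> c3; under eq_cvg do rewrite EA; rewrite EA.
have cl := cvgD c1 c2.
have E n : \int[mu2]_(x in dom T) (pderiv i (w n) x * q x) +
    \int[mu2]_(x in dom T) (w n x * pderiv i q x) =
    \sum_(e in sides T) eint (ends e)
     (fun x => w n x * q x * Defs.coord (cell_normal T e) i).
  exact: (green_C1 (cell_region hM T) i (Cw n) Cq).
have cl' : (fun n => \sum_(e in sides T) eint (ends e)
     (fun x => w n x * q x * Defs.coord (cell_normal T e) i)) @ \oo -->
  \int[mu2]_(x in dom T) (wderiv Omega i v x * q x) +
  \int[mu2]_(x in dom T) (v x * pderiv i q x).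
  by under eq_cvg do rewrite -E; exact: cl.
by rewrite -(cvg_lim _ cl')// (cvg_lim _ c3).
Qed.

End Traces.

(** * Fluxes through the edges *)

Section EdgeCancellation.
Context {R : realType} {Omega : set (plane R)} {M : mesh R}
  (hM : partition_of Omega M) (oOmega : open (Omega : set (R * R))).
Implicit Types (T : cell M) (e : edge M).

Definition normal_sign T e : R :=
  if `[< points_outward (dom T) (ends e) (snormal (ends e)) >] then 1 else -1.

Lemma onormal_sign T e :
  onormal (dom T) (ends e) = vscale (normal_sign T e) (snormal (ends e)).
Proof.
rewrite /onormal /normal_sign; case: ifP => // _.
by apply: plane_eq; rewrite /= mul1r.
Qed.

Lemma cells_disjoint T T' x : dom T x -> dom T' x -> T = T'.
Proof.
case: hM => -[_ _ _ dj _] _ Tx T'x; apply/eqP/negPn/negP => /dj h.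
by have : (dom T `&` dom T') x by []; rewrite h.
Qed.

Lemma cells_cover x : Omega x -> (forall e, ~ segset (ends e) x) -> exists T, dom T x.
Proof.
case: hM => -[_ _ cl _ _] _ Ox nx.
have : closure (Omega : set (R * R)) x by exact: subset_closure.
rewrite cl => -[T _ cT]; exists T; apply: contrapT => nT.
have : boundary (dom T) x by rewrite boundaryE//; exact: region_open (cell_region hM T).
by rewrite (region_boundary (cell_region hM T)) => -[e _ /nx].
Qed.

Lemma one_cell_per_point x : Omega x -> (forall e, ~ segset (ends e) x) ->
  \sum_(T : cell M) (`[< dom T x >])%:R = 1 :> R.
Proof.
move=> Ox nx; have [T Tx] := cells_cover Ox nx.
rewrite (bigD1 T)//= asboolT// big1 ?addr0// => T' ne.
by rewrite asboolF// => T'x; move/eqP: ne; apply; exact: cells_disjoint T'x Tx.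
Qed.

(** An edge that is not contained in the boundary has a point in the domain;
    being open, the domain then contains a point of the edge that is not an
    endpoint. *)
Lemma inner_edge_point e : ~~ boundary_edge Omega e ->
  exists2 t : R, 0 < t < 1 & Omega (param (ends e) t).
Proof.
move=> /asboolPn; move=> /existsNP[x /not_implyP[[t t01 tx] nb]].
have [T eT] := edge_side hM e.
have Ox : Omega x.
  apply: contrapT => nO; apply: nb; rewrite boundaryE//; split => //.
  have : boundary (dom T) x.
    by rewrite (region_boundary (cell_region hM T)); exists e => //; exists t.
  rewrite boundaryE; last exact: region_open (cell_region hM T).
  by move=> [+ _]; apply: closure_subset; exact: cell_sub.
have oP : open ((param (ends e) : R -> R * R) @^-1` Omega).
  by move/continuousP : (@param_continuous _ (ends e)); apply.
have /nbhs_ballP[d /= d0 Hd] : nbhs t ((param (ends e) : R -> R * R) @^-1` Omega).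
  by apply: open_nbhs_nbhs; split => //; rewrite /preimage /= tx.
move: t01; rewrite /= in_itv/= => /andP[t0 t1].
pose r : R := Num.min d 1 / 2.
have m0 : 0 < Num.min d 1 by rewrite lt_min d0 ltr01.
have r0 : 0 < r by rewrite divr_gt0.
have rd : r < d by have : Num.min d 1 <= d by [rewrite ge_min lexx]; rewrite /r; lra.
have r1 : r < 1.
  by have : Num.min d 1 <= 1 by [rewrite ge_min lexx orbT]; rewrite /r; lra.
exists (t + r * (2^-1 - t)); first by apply/andP; split; nra.
apply: Hd; rewrite /ball /= opprD addNKr normrN normrM gtr0_norm//.
apply: le_lt_trans rd; apply: ler_piMr; first exact: ltW.
by rewrite ler_norml; apply/andP; split; lra.
Qed.

(** Step off a point [P] of the edge along the normal, on either side. Both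
    points lie in exactly one cell, so the sum over the cells of the jumps of
    their indicator functions is zero. The jump of a cell that has the edge as a
    side is the sign of its normal; the other cells have no jump, as [P] is not
    on their boundary. *)
Lemma normal_sign_sum e : ~~ boundary_edge Omega e ->
  \sum_(T | e \in sides T) normal_sign T e = 0.
Proof.
move=> ne; have [t t01 OP] := inner_edge_point ne; set P := param _ _ in OP.
have ndeg := @edge_nondegenerate _ _ _ hM e.
pose nu := snormal (ends e).
have hnu : is_normal (ends e) nu by left.
have nuu := normal_unit ndeg hnu.
have Pe : segset (ends e) P.
  by exists t => //=; rewrite in_itv/=; case/andP: t01 => /ltW -> /ltW ->.
have Ponly e' : segset (ends e') P -> e' = e.
  move=> h; apply/eqP/negPn/negP => e'e; case: hM => _ meet.
  have [|_ h2] := meet e' e e'e P; first by split.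
  exact: (inner_not_endpoint ndeg t01 h2).
have bd T := region_boundary (cell_region hM T).
have oT T := region_open (cell_region hM T).
pose near (d : R) (Q : R -> Prop) := forall r, 0 < r < d -> Q r.
pose jump T (r : R) : R := (`[< dom T (vsub P (vscale r nu)) >])%:R -
   (`[< dom T (vadd P (vscale r nu)) >])%:R.
have avoid (A : set (plane R)) : closed (A : set (R * R)) -> ~ A P ->
    exists2 d : R, 0 < d & near d (fun r =>
      ~ A (vsub P (vscale r nu)) /\ ~ A (vadd P (vscale r nu))).
  move=> cA nA; have [d d0 Hd] := closed_avoid cA nA.
  pose B : R := 1 + `|nu.1| + `|nu.2|.
  have B0 : 0 < B by rewrite !ltr_wpDr.
  exists (d / B) => [|r /andP[r0]]; first by rewrite divr_gt0.
  rewrite ltr_pdivlMr// => rB.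
  have b1 : `|r * nu.1| < d.
    rewrite normrM gtr0_norm//; apply: le_lt_trans rB; rewrite ler_pM2l// /B.
    by have := normr_ge0 nu.2; lra.
  have b2 : `|r * nu.2| < d.
    rewrite normrM gtr0_norm//; apply: le_lt_trans rB; rewrite ler_pM2l// /B.
    by have := normr_ge0 nu.1; lra.
  by split; [apply: (Hd (- (r * nu.1)) (- (r * nu.2))); rewrite normrN|exact: Hd].
have jumpE T : exists d : R, 0 < d /\ near d (fun r =>
    jump T r = if e \in sides T then normal_sign T e else 0).
  case: (boolP (e \in sides T)) => eT.
    have [d d0 Hd] := region_outward (cell_region hM T) eT t01.
    exists d; split => // r /Hd; rewrite -/P /cell_normal onormal_sign -/nu /jump.
    rewrite /normal_sign; case: asboolP => _.
      rewrite (_ : vscale 1 nu = nu); last by apply: plane_eq; rewrite /= mul1r.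
      by move=> [/asboolT -> /asboolF ->]; rewrite subr0.
    rewrite (_ : vsub _ _ = vadd P (vscale r nu)); last by apply: plane_eq; rewrite /=; ring.
    rewrite (_ : vadd P (vscale r (vscale _ _)) = vsub P (vscale r nu)); last first.
      by apply: plane_eq; rewrite /=; ring.
    by move=> [/asboolT -> /asboolF ->]; rewrite sub0r.
  have nb : ~ boundary (dom T) P.
    by rewrite bd => -[e' /= e'T /Ponly h]; move: eT; rewrite -h e'T.
  have [TP|nTP] := pselect (dom T P).
    have [d d0 Hd] : exists2 d : R, 0 < d & near d (fun r =>
      ~ (~` dom T) (vsub P (vscale r nu)) /\ ~ (~` dom T) (vadd P (vscale r nu))).
      by apply: avoid; [exact: open_closedC|apply].
    exists d; split => // r /Hd[/contrapT h1 /contrapT h2].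
    by rewrite /jump !asboolT// subrr.
  have [d d0 Hd] : exists2 d : R, 0 < d & near d (fun r =>
      ~ (closure (dom T : set (R * R))) (vsub P (vscale r nu)) /\
      ~ (closure (dom T : set (R * R))) (vadd P (vscale r nu))).
    apply: avoid; first exact: closed_closure.
    by move=> cP; apply: nb; rewrite boundaryE.
  exists d; split => // r /Hd[h1 h2].
  by rewrite /jump !asboolF ?subrr// => h; [apply: h2|apply: h1]; exact: subset_closure.
have [dT HdT] := choice jumpE.
pose others : set (plane R) := \bigcup_(e' in [set` predC1 e]) segset (ends e').
have [d1 d10 Hd1] : exists2 d : R, 0 < d & near d (fun r =>
    ~ others (vsub P (vscale r nu)) /\ ~ others (vadd P (vscale r nu))).
  apply: avoid; last by move=> [e' /= e'e /Ponly h]; move: e'e; rewrite h inE eqxx.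
  apply: closed_bigcup; first exact: finite_finset.
  by move=> e' _; exact: segset_closed.
have [d2 d20 Hd2] : exists2 d : R, 0 < d & near d (fun r =>
    ~ (~` Omega) (vsub P (vscale r nu)) /\ ~ (~` Omega) (vadd P (vscale r nu))).
  by apply: avoid; [exact: open_closedC|apply].
pose m : R := Num.min (Num.min d1 d2) (\big[Num.min/1]_T dT T).
have m0 : 0 < m.
  rewrite !lt_min d10 d20; apply: (big_ind (fun z => 0 < z)) => [|a b a0 b0|T _].
  - exact: ltr01.
  - by rewrite lt_min a0.
  - by case: (HdT T).
pose r := m / 2.
have r0 : 0 < r by rewrite divr_gt0.
have rm : r < m by rewrite /r; move: m0; lra.
have [rd1 rd2] : r < d1 /\ r < d2.
  by move: rm; rewrite /m !lt_min => /andP[/andP[-> ->]].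
have rdT T : r < dT T.
  by apply: (lt_le_trans rm); rewrite /m ge_min; apply/orP; right; exact: bigmin_le_cond.
have [//|o1 o2] := Hd1 r; first by rewrite r0.
have [//|/contrapT O1 /contrapT O2] := Hd2 r; first by rewrite r0.
have offe (s : R) : s != 0 -> ~ segset (ends e) (vadd P (vscale s nu)).
  move=> s0 [u _ hu]; have := dot_normal_param u t ndeg hnu; rewrite hu -/P => h.
  move/eqP: s0; apply; rewrite -[LHS]mulr1 -nuu -h !dotE /=; ring.
have vs : vsub P (vscale r nu) = vadd P (vscale (- r) nu).
  by apply: plane_eq; rewrite /= mulNr.
have off1 e' : ~ segset (ends e') (vsub P (vscale r nu)).
  have [->|e'e] := eqVneq e' e; first by rewrite vs; apply: offe; rewrite oppr_eq0 gt_eqF.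
  by move=> h; apply: o1; exists e'.
have off2 e' : ~ segset (ends e') (vadd P (vscale r nu)).
  have [->|e'e] := eqVneq e' e; first by apply: offe; rewrite gt_eqF.
  by move=> h; apply: o2; exists e'.
have : \sum_(T : cell M) jump T r = 0.
  by rewrite sumrB one_cell_per_point// one_cell_per_point// subrr.
rewrite (eq_bigr (fun T => if e \in sides T then normal_sign T e else 0)).
  by rewrite -big_mkcond.
by move=> T _; case: (HdT T) => _; apply; rewrite r0 rdT.
Qed.

Lemma vdot_scale (q : vfield) (s : R) n x : vdot q (vscale s n) x = s * vdot q n x.
Proof.
rewrite /vdot mulr_sumr; apply: eq_bigr => i _.
by rewrite mulrCA; congr (_ * _); rewrite /Defs.coord; case: ifP.
Qed.

(** The terms of one edge share the same integral up to the sign of the normal,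
    and these signs add up to zero unless the edge is on the boundary. *)
Lemma edge_fluxes_cancel (g : @vfield R) (b : edge M -> plane R -> R) :
  (forall e i, L2 mu1 `[0, 1] (g i \o param (ends e))) ->
  (forall e, L2 mu1 `[0, 1] (b e \o param (ends e))) ->
  (forall e, boundary_edge Omega e -> {ae mu1, forall t, t \in `[0, 1] ->
     vdot g (onormal Omega (ends e)) (param (ends e) t) = 0}) ->
  \sum_(T : cell M) \sum_(e in sides T) eip T e (b e) g = 0.
Proof.
move=> gL bL g0; have mI := @measurable_itv01 R.
pose J e := eint (ends e) (fun x => b e x * vdot g (snormal (ends e)) x).
have bv e n : edge_integrable (ends e) (fun x => b e x * vdot g n x).
  exact: (L2_mul_integrable mI (bL e) (vdot_edge_L2 n (gL e))).
transitivity (\sum_(e : edge M) J e * \sum_(T | e \in sides T) normal_sign T e).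
  transitivity (\sum_(T : cell M) \sum_(e in sides T) J e * normal_sign T e).
    apply: eq_bigr => T _; apply: eq_bigr => e eT.
    rewrite /eip onormal_sign mulrC -eint_scale//; congr eint; apply/funext => x.
    by rewrite vdot_scale mulrCA.
  rewrite (exchange_big_dep xpredT)//=; apply: eq_bigr => e _.
  by rewrite mulr_sumr.
apply: big1 => e _; case: (boolP (boundary_edge Omega e)) => be; last first.
  by rewrite normal_sign_sum// mulr0.
suff -> : J e = 0 by rewrite mul0r.
rewrite /J /eint (_ : \int[mu1]_(t in `[0, 1]) _ = \int[mu1]_(t in `[0, 1]) 0).
  by rewrite Rintegral_cst// mul0r mulr0.
congr fine; apply: ae_eq_integral => //.
  exact: measurable_int (bv e _).
have [N [mN N0 sN]] := g0 e be; exists N; split => // t /= /not_implyP[tI ne].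
apply: sN => /= ht; apply: ne; congr EFin.
have := ht tI; rewrite /onormal; case: ifP => _.
  by move=> ->; rewrite mulr0.
by rewrite vdot_scale mulN1r => /eqP; rewrite oppr_eq0 => /eqP ->; rewrite mulr0.
Qed.

End EdgeCancellation.

(** * Weak gradients and projections *)

(** The Fredholm alternative: the row space of a matrix is the annihilator of its
    kernel. *)
Lemma solvable_of_kernel (F : fieldType) m (G : 'M[F]_m) (l : 'rV[F]_m) :
  (forall u : 'cV[F]_m, G *m u = 0 -> l *m u = 0) -> exists c : 'rV[F]_m, c *m G = l.
Proof.
move=> h; suff /submxP[c ->] : (l <= G)%MS by exists c.
rewrite submxE; apply/eqP/matrixP => i j; rewrite (ord1 i) mxE.
have := h (cokermx G *m delta_mx j 0).
rewrite mulmxA mulmx_coker mul0mx => /(_ erefl)/matrixP/(_ 0 0).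
by rewrite mulmxA -colE !mxE.
Qed.

Section PolynomialRiesz.
Context {R : realType} (D : set (plane R)) (oD : open (D : set (R * R)))
  (bD : bounded_set (D : set (R * R))) (n : nat).

Let mD : measurable D := open_measurable_plane oD.

Lemma open_ball_measure_gt0 (x : plane R) (r : R) : 0 < r ->
  (0 < mu2 (`](x.1 - r)%R, (x.1 + r)%R[%classic `*` `](x.2 - r)%R, (x.2 + r)%R[%classic
     : set (plane R)))%E.
Proof.
move=> r0.
have -> : mu2 (`](x.1 - r)%R, (x.1 + r)%R[%classic `*` `](x.2 - r)%R, (x.2 + r)%R[%classic
     : set (plane R)) =
    (mu1 `](x.1 - r)%R, (x.1 + r)%R[%classic * mu1 `](x.2 - r)%R, (x.2 + r)%R[%classic)%E.
  by apply: product_measure1E; exact: measurable_itv.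
rewrite /mu1 /= !lebesgue_measure_itv /= !lte_fin.
by rewrite !ifT -?EFinB -?EFinM ?lte_fin ?mulr_gt0; lra.
Qed.

(** A continuous function that vanishes almost everywhere on an open set vanishes
    there, because small squares have positive measure. *)
Lemma continuous_sqr_eq0 (p : plane R -> R) : continuous (p : R * R -> R) ->
  \int[mu2]_(x in D) (p x ^+ 2) = 0 -> forall x, D x -> p x = 0.
Proof.
move=> cp p0 x Dx; apply: contrapT => /eqP px.
have [N [mN N0 sN]] := Rintegral_sqr_eq0 mD (continuous_L2_plane mD bD cp) p0.
have oU : open (D `&` p @^-1` [set r | r != 0] : set (R * R)).
  apply: openI => //; apply: open_comp => [y _|]; first exact: cp.
  exact: open_neq.
have /nbhs_ballP[r /= r0 Hr] := open_nbhs_nbhs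
  (conj oU (conj Dx px) : open_nbhs (x : R * R) _).
have := open_ball_measure_gt0 x r0; rewrite lt_neqAle => /andP[/eqP + _]; apply.
apply/esym/eqP; rewrite -measure_le0 -N0; apply: le_measure; rewrite ?inE//.
  by apply: measurableX; exact: measurable_itv.
move=> y [/=]; rewrite !in_itv/= => /andP[a1 a2] /andP[b1 b2]; apply: sN => /= hy.
have [|Dy /eqP py] := Hr y; last by apply: py; exact: hy.
by split; rewrite /ball /= ltr_norml; apply/andP; split; lra.
Qed.

(** Zero above degree [n], so that the index set is a product. *)
Definition monomial (j : 'I_n.+1 * 'I_n.+1) (x : plane R) : R :=
  if (j.1 + j.2 <= n)%N then x.1 ^+ j.1 * x.2 ^+ j.2 else 0.

Lemma monomial_polynomial j : polynomial2 n (monomial j).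
Proof.
rewrite /monomial; case: leqP => h; last exact: polynomial2_0.
have := polynomial2_monomial (R := R) 1 h.
by under [X in polynomial2 _ X -> _]eq_fun do rewrite mul1r.
Qed.

Lemma polynomial2_expansion p : polynomial2 n p ->
  exists d : 'I_n.+1 * 'I_n.+1 -> R, p = fun x => \sum_j d j * monomial j x.
Proof.
move=> [c hc]; exists (fun j : 'I_n.+1 * 'I_n.+1 => c j.1 j.2); apply/funext => x; rewrite hc.
rewrite pair_big_dep /= [LHS]big_mkcond /=; apply: eq_bigr => j _.
by rewrite /monomial; case: ifP; rewrite ?mulr0// mulrA.
Qed.

Lemma ip_sym (f g : plane R -> R) : ip D f g = ip D g f.
Proof. by apply: eq_Rintegral => x _; rewrite mulrC. Qed.

Lemma polynomial2_L2 p : polynomial2 n p -> L2 mu2 D p.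
Proof. by move=> /polynomial2_continuous cp; exact: continuous_L2_plane. Qed.

Lemma ip_sumr (J : finType) (d : J -> R) (F : J -> plane R -> R) f : L2 mu2 D f ->
  (forall j, L2 mu2 D (F j)) ->
  ip D f (fun x => \sum_j d j * F j x) = \sum_j d j * ip D f (F j).
Proof.
move=> fL FL; rewrite /ip; under eq_Rintegral do rewrite mulr_sumr.
rewrite Rintegral_bigsum//; last first.
  by move=> j _; apply: L2_mul_integrable => //; exact: L2_scale.
apply: eq_bigr => j _; under eq_Rintegral do rewrite mulrCA.
by rewrite RintegralZl//; exact: L2_mul_integrable.
Qed.

Context (ell : (plane R -> R) -> R)
  (ell_linear : forall (a : R) p q, polynomial2 n p -> polynomial2 n q ->
     ell (fun x => a * p x + q x) = a * ell p + ell q)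
  (ell_null : forall p, polynomial2 n p -> (forall x, D x -> p x = 0) -> ell p = 0).

Lemma ell_sum (J : Type) (s : seq J) (d : J -> R) (F : J -> plane R -> R) :
  (forall j, polynomial2 n (F j)) ->
  ell (fun x => \sum_(j <- s) d j * F j x) = \sum_(j <- s) d j * ell (F j).
Proof.
move=> hF; elim: s => [|j s IH].
  under eq_fun do rewrite big_nil; rewrite big_nil; apply: ell_null => //.
  exact: polynomial2_0.
under eq_fun do rewrite big_cons; rewrite big_cons ell_linear ?IH//.
by apply: polynomial2_sum => i _; exact: polynomial2_scale.
Qed.

(** The Gram system of the monomials is solvable: its kernel consists of the
    polynomials of zero norm, which vanish on [D], and the functional vanishes on
    these. *)
Lemma polynomial_riesz :
  exists g, polynomial2 n g /\ forall p, polynomial2 n p -> ip D g p = ell p.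
Proof.
pose m := #|{: 'I_n.+1 * 'I_n.+1}|.
pose mono (i : 'I_m) := monomial (enum_val i).
have pm i : polynomial2 n (mono i) by exact: monomial_polynomial.
have Lm i : L2 mu2 D (mono i) by exact: polynomial2_L2.
have expand p : polynomial2 n p -> exists d : 'I_m -> R, p = fun x => \sum_i d i * mono i x.
  move=> /polynomial2_expansion[d ->]; exists (fun i => d (enum_val i)).
  apply/funext => x; rewrite (reindex_onto enum_val enum_rank)/=; last first.
    by move=> j _; exact: enum_rankK.
  by apply: eq_bigl => i; rewrite enum_valK eqxx.
pose G : 'M[R]_m := \matrix_(i, j) ip D (mono i) (mono j).
pose l : 'rV[R]_m := \row_j ell (mono j).
have [u Gu|c cG] := @solvable_of_kernel _ _ G l.
  pose p x := \sum_i u i 0 * mono i x.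
  have pp : polynomial2 n p.
    by apply: polynomial2_sum => i _; exact: polynomial2_scale.
  have ip0 i : ip D (mono i) p = 0.
    rewrite ip_sumr//; transitivity ((G *m u) i 0); last by rewrite Gu mxE.
    by rewrite mxE; apply: eq_bigr => j _; rewrite !mxE mulrC.
  have p0 : forall x, D x -> p x = 0.
    apply: continuous_sqr_eq0; first exact: polynomial2_continuous pp.
    under eq_Rintegral do rewrite expr2.
    rewrite -/(ip D p p) {2}/p ip_sumr//; last exact: polynomial2_L2.
    by apply: big1 => i _; rewrite ip_sym ip0 mulr0.
  apply/matrixP => i j; rewrite !mxE (ord1 i) (ord1 j).
  transitivity (ell p); last exact: ell_null.
  by rewrite /p ell_sum//; apply: eq_bigr => i' _; rewrite !mxE mulrC.
exists (fun x => \sum_i c 0 i * mono i x); split.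
  by apply: polynomial2_sum => i _; exact: polynomial2_scale.
move=> p /expand[d ->]; rewrite ell_sum// ip_sumr//; last first.
  by apply: polynomial2_L2; apply: polynomial2_sum => i _; exact: polynomial2_scale.
apply: eq_bigr => j _; congr (_ * _); rewrite ip_sym ip_sumr//.
have /matrixP/(_ 0 j) := cG; rewrite !mxE => <-.
by apply: eq_bigr => i _; rewrite !mxE ip_sym.
Qed.

End PolynomialRiesz.

Section WeakGradients.
Context {R : realType} {Omega : set (plane R)} {M : mesh R}
  (hM : partition_of Omega M) (k : nat).
Implicit Types (T : cell M) (e : edge M) (v w : wfun M) (q : @vfield R).

Definition square_integrable v : Prop := forall T,
  L2 mu2 (dom T) (v0 v T) /\
  forall e, e \in sides T -> L2 mu1 `[0, 1] (vb v e \o param (ends e)).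

Let oT T : open (dom T : set (R * R)) := region_open (cell_region hM T).
Let mT T : measurable (dom T) := cell_measurable hM T.
Let bT T : bounded_set (dom T : set (R * R)) := cell_bounded hM T.

(** Derivatives are local, and the cell is open. *)
Lemma zero_on_cell_pderiv T (p : plane R -> R) (i : 'I_2) :
  (forall x, dom T x -> p x = 0) -> forall x, dom T x -> pderiv i p x = 0.
Proof.
move=> p0 x Tx; rewrite /pderiv /derive; apply: cvg_lim => //.
apply: (@cvg_trans _ (cst 0 @ 0^')); last exact: cvg_cst.
apply: near_eq_cvg.
have cs : continuous (fun h : R => (h *: unit_vec i + x : R * R)).
  move=> h; apply: cvgD; last exact: cvg_cst.
  by apply: cvgZr_tmp; exact: cvg_id.
have : \forall h \near (0 : R)^', dom T (h *: unit_vec i + x).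
  apply: (@nbhs_dnbhs R).
  have := open_comp (fun h _ => cs h) (@oT T); rewrite openE => /(_ 0); apply.
  by rewrite /= scale0r add0r.
by apply: filterS => h Th; rewrite /= p0// p0// subrr scaler0.
Qed.

Lemma zero_on_cell_side T e (p : plane R -> R) (t : R) : continuous (p : R * R -> R) ->
  (forall x, dom T x -> p x = 0) -> e \in sides T -> 0 <= t <= 1 ->
  p (param (ends e) t) = 0.
Proof.
move=> cp p0 eT t01; have [cP _] := side_on_boundary hM eT t01.
have cl : closed (p @^-1` [set 0] : set (R * R)).
  by have /continuous_closedP := cp; apply; exact: closed_eq.
suff : (p @^-1` [set 0]) (param (ends e) t) by [].
by rewrite ((closure_id _).1 cl); apply: closure_subset cP => y /p0.
Qed.

Lemma poly_L2 T (p : plane R -> R) n : polynomial2 n p -> L2 mu2 (dom T) p.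
Proof. by move=> hp; apply: polynomial2_L2 hp. Qed.

Lemma edge_mul_integrable e (f p : plane R -> R) :
  L2 mu1 `[0, 1] (f \o param (ends e)) -> continuous (p : R * R -> R) ->
  edge_integrable (ends e) (fun x => f x * p x).
Proof.
move=> fL cp.
exact: (L2_mul_integrable (@measurable_itv01 R) fL (continuous_L2_edge (ends e) cp)).
Qed.

Lemma coordZ_continuous (p : plane R -> R) (c : R) : continuous (p : R * R -> R) ->
  continuous ((fun x => p x * c) : R * R -> R).
Proof. by move=> cp; apply: continuous_mul => // x; exact: cvg_cst. Qed.

(** The right-hand side of the definition of the weak gradient, for fields whose
    only component is the i-th. *)
Definition gradient_functional v T (i : 'I_2) (p : plane R -> R) : R :=
  - ip (dom T) (v0 v T) (pderiv i p) +
  \sum_(e in sides T) eint (ends e)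
     (fun x => vb v e x * (p x * Defs.coord (onormal (dom T) (ends e)) i)).

Lemma gradient_functionalE v T q : square_integrable v -> Pj k T q ->
  - ip (dom T) (v0 v T) (divergence q) + \sum_(e in sides T) eip T e (vb v e) q =
  \sum_(i < 2) gradient_functional v T i (q i).
Proof.
move=> vL hq; have [v0L vbL] := vL T.
have cq i := polynomial2_continuous (hq i).
rewrite big_split /= sumrN; congr (- _ + _).
  rewrite /ip /divergence; under eq_Rintegral do rewrite mulr_sumr.
  rewrite Rintegral_bigsum// => i _; apply: L2_mul_integrable => //.
  by apply: (@poly_L2 T _ (jdeg k T)); exact: polynomial2_pderiv.
rewrite exchange_big /=; apply: eq_bigr => e eT.
rewrite /eip /vdot; under [X in eint _ X]eq_fun do rewrite mulr_sumr.
rewrite eint_sum// => i _; apply: edge_mul_integrable; first exact: vbL.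
exact: coordZ_continuous.
Qed.

Lemma gradient_functional_linear v T i n (a : R) (p q : plane R -> R) : square_integrable v ->
  polynomial2 n p -> polynomial2 n q ->
  gradient_functional v T i (fun x => a * p x + q x) =
  a * gradient_functional v T i p + gradient_functional v T i q.
Proof.
move=> vL hp hq; have [v0L vbL] := vL T.
have cp := polynomial2_continuous hp; have cq := polynomial2_continuous hq.
have dE : pderiv i (fun x => a * p x + q x) = fun x => a * pderiv i p x + pderiv i q x.
  have h := has_partials_add (has_partials_scale a (C1_has_partials (polynomial2_C1 hp)))
    (C1_has_partials (polynomial2_C1 hq)).
  exact: has_partials_pderiv h.
have Lp := poly_L2 T (polynomial2_pderiv i hp).
have Lq := poly_L2 T (polynomial2_pderiv i hq).
have e1 : ip (dom T) (v0 v T) (pderiv i (fun x => a * p x + q x)) =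
    a * ip (dom T) (v0 v T) (pderiv i p) + ip (dom T) (v0 v T) (pderiv i q).
  rewrite dE /ip; under eq_Rintegral do rewrite mulrDr mulrCA.
  rewrite RintegralD//; last 2 first.
  - by apply: integrable_scale => //; exact: L2_mul_integrable.
  - exact: L2_mul_integrable.
  by rewrite RintegralZl//; exact: L2_mul_integrable.
rewrite /gradient_functional e1 opprD mulrDr mulrN addrACA; congr (_ + _).
rewrite mulr_sumr -big_split; apply: eq_bigr => e eT /=.
have ip_ := edge_mul_integrable (vbL e eT) (coordZ_continuous (c := Defs.coord (onormal (dom T) (ends e)) i) cp).
have iq := edge_mul_integrable (vbL e eT) (coordZ_continuous (c := Defs.coord (onormal (dom T) (ends e)) i) cq).
rewrite -eint_scale// -eint_add//; last first.
  exact: (integrable_scale (@measurable_itv01 R) a ip_).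
by congr eint; apply/funext => x; ring.
Qed.

(** A polynomial that vanishes on the cell has zero derivatives there, as the cell
    is open, and vanishes on the sides by continuity. *)
Lemma gradient_functional_null v T i n p : polynomial2 n p ->
  (forall x, dom T x -> p x = 0) -> gradient_functional v T i p = 0.
Proof.
move=> hp p0; rewrite /gradient_functional.
have -> : ip (dom T) (v0 v T) (pderiv i p) = 0.
  rewrite /ip (_ : \int[mu2]_(x in dom T) _ = \int[mu2]_(x in dom T) 0).
    by rewrite Rintegral_cst// mul0r.
  by apply: eq_Rintegral => x /set_mem Tx; rewrite (zero_on_cell_pderiv i p0)// mulr0.
rewrite oppr0 add0r; apply: big1 => e eT.
rewrite (_ : eint _ _ = eint (ends e) (fun=> 0)).
  by rewrite /eint Rintegral_cst ?mul0r ?mulr0//; exact: measurable_itv01.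
apply: eq_eint => t t01.
by rewrite (zero_on_cell_side (polynomial2_continuous hp) p0 eT t01) mul0r mulr0.
Qed.

Lemma weak_gradient_exists v T : square_integrable v ->
  is_weak_gradient k v T (weak_gradient k v T).
Proof.
move=> vL.
have H i := polynomial_riesz (@oT T) (@bT T) (n := jdeg k T)
  (ell := gradient_functional v T i)
  (fun (a : R) (p q : plane R -> R) hp hq => gradient_functional_linear T i a vL hp hq)
  (fun p hp p0 => gradient_functional_null v i hp p0).
have [G HG] := choice H.
have GP : is_weak_gradient k v T G.
  split => [i|q hq]; first by case: (HG i).
  rewrite gradient_functionalE//; apply: eq_bigr => i _.
  by case: (HG i) => _; exact.
by rewrite /weak_gradient; case: xgetP => [G' -> //|/(_ G)].
Qed.

Lemma Qh_exists T (F : @vfield R) : (forall i, L2 mu2 (dom T) (F i)) ->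
  is_Qh k T F (Qh k T F).
Proof.
move=> FL.
have H i : exists g, polynomial2 (jdeg k T) g /\
    forall p, polynomial2 (jdeg k T) p -> ip (dom T) g p = ip (dom T) (F i) p.
  apply: (polynomial_riesz (@oT T) (@bT T)) => [a p q hp hq|p hp p0].
    rewrite /ip; under eq_Rintegral do rewrite mulrDr mulrCA.
    rewrite RintegralD//; last 2 first.
    - apply: integrable_scale => //; apply: L2_mul_integrable => //.
      exact: poly_L2 hp.
    - by apply: L2_mul_integrable => //; exact: poly_L2 hq.
    by rewrite RintegralZl//; apply: L2_mul_integrable => //; exact: poly_L2 hp.
  rewrite /ip (_ : \int[mu2]_(x in dom T) _ = \int[mu2]_(x in dom T) 0).
    by rewrite Rintegral_cst// mul0r.
  by apply: eq_Rintegral => x /set_mem Tx; rewrite p0 ?mulr0.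
have [G HG] := choice H.
have GP : is_Qh k T F G.
  split => [i|q hq]; first by case: (HG i).
  by apply: eq_bigr => i _; case: (HG i) => _; exact.
by rewrite /Qh; case: xgetP => [G' -> //|/(_ G)].
Qed.

Lemma vip_sym (D : set (plane R)) (F G : @vfield R) : vip D F G = vip D G F.
Proof. by apply: eq_bigr => i _; exact: ip_sym. Qed.

Lemma form_b_sym v w : form_b k v w = form_b k w v.
Proof. by apply: eq_bigr => T _; exact: vip_sym. Qed.

Lemma square_integrable_sub v w : square_integrable v -> square_integrable w ->
  square_integrable (wsub v w).
Proof.
move=> vL wL T; have [v0L vbL] := vL T; have [w0L wbL] := wL T; split=> [|e eT].
  exact: L2_sub.
by apply: (L2_sub (@measurable_itv01 R)); [exact: vbL|exact: wbL].
Qed.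

Lemma gradient_functional_sub v w T i n p : square_integrable v ->
  square_integrable w -> polynomial2 n p ->
  gradient_functional (wsub v w) T i p =
  gradient_functional v T i p - gradient_functional w T i p.
Proof.
move=> vL wL hp; have [v0L vbL] := vL T; have [w0L wbL] := wL T.
have cp := polynomial2_continuous hp.
have Lp := poly_L2 T (polynomial2_pderiv i hp).
rewrite /gradient_functional opprD addrACA; congr (_ + _).
  rewrite -opprD; congr (- _); rewrite /ip /=.
  under eq_Rintegral do rewrite mulrBl.
  by rewrite RintegralB//; exact: L2_mul_integrable.
rewrite -sumrB; apply: eq_bigr => e eT.
have c1 := coordZ_continuous (c := Defs.coord (onormal (dom T) (ends e)) i) cp.
rewrite -eint_sub//; [|exact: edge_mul_integrable (vbL e eT) c1|exact: edge_mul_integrable (wbL e eT) c1].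
by congr eint; apply/funext => x; rewrite /= mulrBl.
Qed.

Lemma form_b_subr v w w' : square_integrable v -> square_integrable w ->
  square_integrable w' -> form_b k v (wsub w w') = form_b k v w - form_b k v w'.
Proof.
move=> vL wL wL'; rewrite /form_b -sumrB; apply: eq_bigr => T _.
have [Gv _] := weak_gradient_exists T vL.
have [_ E] := weak_gradient_exists T (square_integrable_sub wL wL').
have [_ E1] := weak_gradient_exists T wL.
have [_ E2] := weak_gradient_exists T wL'.
rewrite vip_sym E// [X in _ = X - _]vip_sym E1// [X in _ = _ - X]vip_sym E2//.
rewrite !gradient_functionalE//; last exact: square_integrable_sub.
rewrite -sumrB; apply: eq_bigr => i _; exact: (gradient_functional_sub _ _ wL wL' (Gv i)).
Qed.

End WeakGradients.

(** * Consistency *)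

Section Consistency.
Context {R : realType} {Omega : set (plane R)} {M : mesh R}
  (hM : partition_of Omega M) (oOmega : open (Omega : set (R * R)))
  (bOmega : bounded_set (Omega : set (R * R))) {k : nat}.
Implicit Types (T : cell M) (e : edge M) (v w : wfun M) (u phi : plane R -> R)
  (q : @vfield R).

Let mOmega : measurable Omega := open_measurable_plane oOmega.
Let mI := @measurable_itv01 R.
Let mT T : measurable (dom T) := cell_measurable hM T.
Local Notation edge_L2 e f := (L2 mu1 `[0, 1] (f \o param (ends e))).

Lemma L2_cell T u : L2 mu2 Omega u -> L2 mu2 (dom T) u.
Proof. exact: (L2_subset (mT T) mOmega (@cell_sub _ _ _ hM T)). Qed.

(** A polygon has at least one side, so polynomials of degree [k] and their
    derivatives are admissible components of weak gradients. *)
Lemma jdeg_ge T : (k <= jdeg k T)%N.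
Proof.
have [[/(_ T)[p [[_ /andP[p2 _] _ _ _] sp _]] _ _ _ _] _] := hM.
suff : (0 < #|sides T|)%N by rewrite /jdeg; case: #|_| => // n _; rewrite addSn subn1 leq_addl.
case: p p2 sp => [//|a [//|b p]] _ sp; apply/card_gt0P.
have [e eT _] : exists2 e, e \in sides T & same_segment (a, b) (ends e).
  by apply: sp; rewrite /sides_of rot1_cons /= inE eqxx.
by exists e.
Qed.

Lemma Vh_square_integrable v : Vh k v -> square_integrable v.
Proof.
move=> [v0P vbP] T; split=> [|e _].
  have [p hp pE] := v0P T; apply: eq_L2 (poly_L2 hM T hp) => x Tx.
  by rewrite pE//; exact: subset_closure.
have [p _ pE] := vbP e.
have pe (t : R) : `[0, 1]%classic t -> horner p t = (vb v e \o param (ends e)) t.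
  by rewrite /= in_itv/= => /pE.
suff : L2 mu1 `[0, 1] (horner p) by apply: eq_L2.
by apply: continuous_L2_01; exact: continuous_horner.
Qed.

Lemma Vh_edge_L2 v T e : Vh k v -> e \in sides T -> edge_L2 e (v0 v T).
Proof.
move=> [v0P _] eT; have [p hp pE] := v0P T.
apply: eq_L2 (continuous_L2_edge (ends e) (polynomial2_continuous hp)) => t tI /=.
by rewrite pE//; case: (side_on_boundary hM eT tI).
Qed.

Lemma of_H1_side T e u (t : R) : e \in sides T -> 0 <= t <= 1 ->
  v0 (of_H1 Omega M u) T (param (ends e) t) = trace Omega (skeleton M) u (param (ends e) t).
Proof. by move=> eT t01; rewrite /= asboolF//; case: (side_on_boundary hM eT t01). Qed.

(** If there is no trace, its default value 0 is square integrable as well. *)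
Lemma trace_edge_L2 e u : edge_L2 e (trace Omega (skeleton M) u).
Proof.
rewrite /trace; case: xgetP => [g _ [+ _]|_]; first by apply; exists e.
by apply: continuous_L2_edge => x; exact: cvg_cst.
Qed.

Lemma of_H1_square_integrable u : L2 mu2 Omega u -> square_integrable (of_H1 Omega M u).
Proof.
move=> uL T; split=> [|e _]; last exact: trace_edge_L2.
by apply: eq_L2 (L2_cell T uL) => x Tx; rewrite /= asboolT.
Qed.

Lemma eip_integrable T e (f : plane R -> R) q : edge_L2 e f ->
  (forall i, edge_L2 e (q i)) ->
  edge_integrable (ends e) (fun x => f x * vdot q (onormal (dom T) (ends e)) x).
Proof. by move=> fL qL; apply: (L2_mul_integrable mI fL); exact: vdot_edge_L2. Qed.

Lemma eip_subl T e (f g : plane R -> R) q : edge_L2 e f -> edge_L2 e g ->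
  (forall i, edge_L2 e (q i)) ->
  eip T e (fun x => f x - g x) q = eip T e f q - eip T e g q.
Proof.
move=> fL gL qL; rewrite /eip -eint_sub; [|exact: eip_integrable..].
by congr eint; apply/funext => x; rewrite mulrBl.
Qed.

Lemma eip_subr T e (f : plane R -> R) q q' : edge_L2 e f ->
  (forall i, edge_L2 e (q i)) -> (forall i, edge_L2 e (q' i)) ->
  eip T e f (fun i x => q i x - q' i x) = eip T e f q - eip T e f q'.
Proof.
move=> fL qL qL'; rewrite /eip -eint_sub; [|exact: eip_integrable..].
congr eint; apply/funext => x; rewrite -mulrBr; congr (_ * _).
by rewrite /vdot -sumrB; apply: eq_bigr => i _; rewrite mulrBl.
Qed.

Lemma eip_sum T e (f : plane R -> R) q : edge_L2 e f -> (forall i, edge_L2 e (q i)) ->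
  eip T e f q =
  \sum_(i < 2) eint (ends e) (fun x => q i x * f x * Defs.coord (cell_normal T e) i).
Proof.
move=> fL qL; rewrite -eint_sum; last first.
  move=> i _; have := L2_mul_integrable mI (qL i) (L2_scale mI (Defs.coord (cell_normal T e) i) fL).
  by apply: eq_integrable => // t _; congr EFin => /=; rewrite -mulrA; congr (_ * _); exact: mulrC.
congr eint; apply/funext => x; rewrite /vdot mulr_sumr; apply: eq_bigr => i _.
by rewrite mulrCA mulrA.
Qed.

Lemma green_poly T (p : plane R -> R) q n : polynomial2 n p ->
  (forall i, polynomial2 n (q i)) ->
  vip (dom T) q (fun i => pderiv i p) =
  - ip (dom T) p (divergence q) + \sum_(e in sides T) eip T e p q.
Proof.
move=> hp hq; have Lp := poly_L2 hM T hp.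
have Ld i := poly_L2 hM T (polynomial2_pderiv i (hq i)).
rewrite /ip /divergence; under eq_Rintegral do rewrite mulr_sumr.
rewrite Rintegral_bigsum//; last by move=> i _; exact: L2_mul_integrable.
under [X in _ + X]eq_bigr => e eT.
  rewrite eip_sum; first over.
    by apply: continuous_L2_edge; exact: polynomial2_continuous hp.
  by move=> i; apply: continuous_L2_edge; exact: polynomial2_continuous (hq i).
rewrite exchange_big /= -sumrN -big_split /=; apply: eq_bigr => i _.
rewrite -(green_C1 (cell_region hM T) i (polynomial2_C1 (hq i)) (polynomial2_C1 hp)).
have : ip (dom T) p (pderiv i (q i)) = ip (dom T) (pderiv i (q i)) p by exact: ip_sym.
by rewrite /ip => ->; rewrite addrA addNr add0r.
Qed.

(** Integration by parts turns the definition of the weak gradient into the inner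
    product with the gradient. *)
Lemma weak_gradient_of_H1 T u q : H1 Omega u ->
  is_trace Omega (skeleton M) u (trace Omega (skeleton M) u) -> Pj k T q ->
  vip (dom T) (weak_gradient k (of_H1 Omega M u) T) q = vip (dom T) (grad Omega u) q.
Proof.
move=> hu tu hq; have uL : L2 mu2 Omega u by case: hu.
have [_ ->//] := weak_gradient_exists hM k T (of_H1_square_integrable uL).
have uT := L2_cell T uL.
have Ld i := poly_L2 hM T (polynomial2_pderiv i (hq i)).
rewrite (_ : ip _ _ _ = ip (dom T) u (divergence q)); last first.
  by apply: eq_Rintegral => x /set_mem Tx; rewrite /= asboolT.
rewrite /ip /divergence; under eq_Rintegral do rewrite mulr_sumr.
rewrite Rintegral_bigsum//; last by move=> i _; exact: L2_mul_integrable.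
under [X in _ + X]eq_bigr => e eT.
  rewrite eip_sum; first over.
    exact: trace_edge_L2.
  by move=> i; apply: continuous_L2_edge; exact: polynomial2_continuous (hq i).
rewrite exchange_big /= -sumrN -big_split /=; apply: eq_bigr => i _.
have := green_H1 hM oOmega bOmega T i hu tu (polynomial2_C1 (hq i)).
move=> E; apply/eqP; rewrite addrC subr_eq; apply/eqP; rewrite /ip /grad E.
by apply: eq_bigr => e _; congr eint; apply/funext => x; congr (_ * _); exact: mulrC.
Qed.

Lemma ip_neg_laplacian T u n (p : plane R -> R) : H2 Omega u ->
  (forall i, is_trace Omega (skeleton M) (wderiv Omega i u) (grad_trace Omega M u i)) ->
  polynomial2 n p ->
  ip (dom T) (neg_laplacian Omega u) p =
  vip (dom T) (grad Omega u) (fun i => pderiv i p) -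
  \sum_(e in sides T) eip T e p (grad_trace Omega M u).
Proof.
move=> [_ hu] tu hp.
have Lp := poly_L2 hM T hp.
have L2d i : L2 mu2 (dom T) (wderiv Omega i (wderiv Omega i u)).
  by apply: L2_cell; exact: H1_L2_wderiv.
transitivity (- \sum_(i < 2) ip (dom T) (wderiv Omega i (wderiv Omega i u)) p).
  rewrite -mulN1r /ip -Rintegral_bigsum//; last by move=> i _; exact: L2_mul_integrable.
  rewrite -RintegralZl//; last first.
    by apply: (@integrable_bigsum _ _ _ mu2 _ (mT T)) => i _; exact: L2_mul_integrable.
  by apply: eq_Rintegral => x _; rewrite mulN1r /neg_laplacian mulNr mulr_suml.
under [X in _ - X]eq_bigr => e eT.
  rewrite eip_sum; first over.
    by apply: continuous_L2_edge; exact: polynomial2_continuous hp.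
  by move=> i; exact: trace_edge_L2.
rewrite exchange_big /= -sumrN -sumrB; apply: eq_bigr => i _.
have := green_H1 hM oOmega bOmega T i (hu i) (tu i) (polynomial2_C1 hp).
by move=> <-; rewrite /ip /grad opprD addrCA subrr addr0.
Qed.

Lemma eq_eip T e (f g : plane R -> R) q :
  (forall t, 0 <= t <= 1 -> f (param (ends e) t) = g (param (ends e) t)) ->
  eip T e f q = eip T e g q.
Proof. by move=> fg; apply: eq_eint => t /fg ->. Qed.

(** The interior component of [v] is tested against [- div (grad u)], with two
    integrations by parts: forth for [grad u], and back for its projection,
    which is a polynomial and can be tested with the weak gradient of [v]. *)
Lemma cell_consistency T u v : H2 Omega u -> Vh k v ->
  is_trace Omega (skeleton M) u (trace Omega (skeleton M) u) ->
  (forall i, is_trace Omega (skeleton M) (wderiv Omega i u) (grad_trace Omega M u i)) ->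
  ip (dom T) (neg_laplacian Omega u) (v0 v T) =
  vip (dom T) (weak_gradient k v T) (weak_gradient k (of_H1 Omega M u) T) +
  \sum_(e in sides T) eip T e (fun x => v0 v T x - vb v e x)
     (fun i x => Qh k T (grad Omega u) i x - grad_trace Omega M u i x) -
  \sum_(e in sides T) eip T e (vb v e) (grad_trace Omega M u).
Proof.
move=> hu hv tu tdu; have vL := Vh_square_integrable hv; have [v0L vbL] := vL T.
have hu1 : H1 Omega u by case: hu.
have gradL i : L2 mu2 (dom T) (grad Omega u i).
  by apply: L2_cell; exact: H1_L2_wderiv.
have [hQ QE] := Qh_exists hM k gradL; set Q := Qh k T _ in hQ QE *.
have [hG GE] := weak_gradient_exists hM k T vL.
have [p hp pE] := hv.1 T.
have vp x : dom T x -> v0 v T x = p x by move=> Tx; exact/pE/subset_closure.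
have vpe e : e \in sides T -> forall t : R, 0 <= t <= 1 ->
    v0 v T (param (ends e) t) = p (param (ends e) t).
  by move=> eT t t01; apply: pE; case: (side_on_boundary hM eT t01).
have hpj : polynomial2 (jdeg k T) p by exact: polynomial2_le (jdeg_ge T) hp.
have QL e i : edge_L2 e (Q i).
  by apply: continuous_L2_edge; exact: polynomial2_continuous (hQ i).
have tL e i : edge_L2 e (grad_trace Omega M u i) by exact: trace_edge_L2.
have ipv f : ip (dom T) (v0 v T) f = ip (dom T) p f.
  by apply: eq_Rintegral => x /set_mem /vp ->.
rewrite ip_sym ipv ip_sym (ip_neg_laplacian T hu tdu hp).
rewrite -QE; last by move=> i; exact: polynomial2_pderiv.
rewrite (green_poly T hpj hQ).
rewrite vip_sym weak_gradient_of_H1// -QE// vip_sym GE// ipv -!addrA; congr (_ + _).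
rewrite -!sumrN -!big_split /=; apply: eq_bigr => e eT.
have v0eL := Vh_edge_L2 hv eT; have vbeL := vbL e eT.
rewrite eip_subr; [|by apply: L2_sub|exact: QL|exact: tL].
rewrite (eip_subl T v0eL vbeL (QL e)) (eip_subl T v0eL vbeL (tL e)).
rewrite (eq_eip T Q (vpe e eT)) (eq_eip T (grad_trace Omega M u) (vpe e eT)).
by ring.
Qed.

(** The interior component enters the stabilizer through its values on the sides,
    about which its square integrability in the cell says nothing. *)
Lemma form_a_subl w w' v : square_integrable w -> square_integrable w' -> square_integrable v ->
  (forall T e, e \in sides T ->
     [/\ edge_L2 e (v0 w T), edge_L2 e (v0 w' T) & edge_L2 e (v0 v T)]) ->
  form_a (wsub w w') v = form_a w v - form_a w' v.
Proof.
move=> wL wL' vL eL; rewrite /form_a opprD addrACA -!sumrB; congr (_ + _).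
  apply: eq_bigr => T _; rewrite /ip.
  have [w0 _] := wL T; have [w0' _] := wL' T; have [v0L _] := vL T.
  rewrite -RintegralB//; [|exact: L2_mul_integrable..].
  by apply: eq_Rintegral => x _; rewrite /= mulrBl.
apply: eq_bigr => T _; rewrite -mulrBr -sumrB; congr (_ * _); apply: eq_bigr => e eT.
have [_ /(_ e eT) wb] := wL T; have [_ /(_ e eT) wb'] := wL' T.
have [_ /(_ e eT) vbL] := vL T; have [w0 w0' v0L] := eL T e eT.
rewrite -eint_sub; first by congr eint; apply/funext => x /=; ring.
  exact: (L2_mul_integrable mI (L2_sub mI w0 wb) (L2_sub mI v0L vbL)).
exact: (L2_mul_integrable mI (L2_sub mI w0' wb') (L2_sub mI v0L vbL)).
Qed.

(** The stabilizer does not see a function of H1, which has no jump on the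
    sides. *)
Lemma form_a_of_H1 phi v : form_a (of_H1 Omega M phi) v = load phi v.
Proof.
rewrite /form_a [X in _ + X]big1 ?addr0; last first.
  move=> T _; rewrite big1 ?mulr0// => e eT.
  rewrite (@eq_eint _ _ _ (fun=> 0)) => [|t t01].
    by rewrite /eint Rintegral_cst ?mul0r ?mulr0.
  by rewrite of_H1_side// subrr mul0r.
by apply: eq_bigr => T _; apply: eq_Rintegral => x /set_mem Tx; rewrite /= asboolT.
Qed.

Context (rho : R) (K : nat) (rho0 : 0 < rho) (hreg : shape_regular M rho K).

(** The terms left over by the cells are the fluxes of the gradient of [u] weighted
    by [vb v]; they cancel between neighbouring cells, and vanish on the boundary
    because the two traces of the gradient, on the edges and on the boundary
    segments, agree. *)
Lemma consistency f u v : biharmonic_solution Omega f u -> Vh k v ->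
  load (neg_laplacian Omega u) v =
  form_b k v (of_H1 Omega M u) + form_l Omega k u v.
Proof.
move=> [hu _ u0 [g [gP g0]]] hv; have [hu1 hdu] := hu.
have tu : is_trace Omega (skeleton M) u (trace Omega (skeleton M) u).
  have [w wP] := is_trace_approximable hu1 u0.
  exact: (trace_is_trace hM oOmega bOmega rho0 hreg wP).
have tdu i : is_trace Omega (skeleton M) (wderiv Omega i u) (grad_trace Omega M u i).
  have [w wP] := is_trace_approximable (hdu i) (gP i).
  exact: (trace_is_trace hM oOmega bOmega rho0 hreg wP).
rewrite /load; under eq_bigr do rewrite (cell_consistency _ hu hv tu tdu).
rewrite sumrB big_split /= -[RHS]subr0; congr (_ - _).
have vbL e : edge_L2 e (vb v e).
  by have [T eT] := edge_side hM e; case: (Vh_square_integrable hv T) => _; exact.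
apply: (edge_fluxes_cancel hM oOmega _ vbL) => [e i|e /asboolP be].
  exact: trace_edge_L2.
have Se : @skeleton R M (ends e) by exists e.
have Sb : boundary_segments Omega (ends e).
  by split => //; exact: (@edge_nondegenerate _ _ _ hM).
have [N0 [mN0 N00 sN0]] :=
  trace_unique_ae hM oOmega bOmega rho0 hreg (hdu ord0) (tdu ord0) (gP ord0) Se Sb.
have [N1 [mN1 N10 sN1]] :=
  trace_unique_ae hM oOmega bOmega rho0 hreg (hdu ord_max) (tdu ord_max) (gP ord_max) Se Sb.
have [N2 [mN2 N20 sN2]] := g0 _ Sb.
exists (N0 `|` N1 `|` N2); split.
- by apply: measurableU => //; exact: measurableU.
- by apply: null_set_setU => //; [exact: measurableU|exact: null_set_setU].
move=> t /= /not_implyP[tI ne].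
have [|n0] := pselect (N0 t); first by left; left.
have [|n1] := pselect (N1 t); first by left; right.
right; apply: sN2 => /= /(_ tI) h2; apply: ne; rewrite -h2 /vdot !sum_ord2.
have -> : grad_trace Omega M u ord0 (param (ends e) t) = g ord0 (param (ends e) t).
  by apply: contrapT => h; apply: n0; apply: sN0 => /= /(_ tI).
by have -> : grad_trace Omega M u ord_max (param (ends e) t) = g ord_max (param (ends e) t)
  by apply: contrapT => h; apply: n1; apply: sN1 => /= /(_ tI).
Qed.

Lemma load_ae f g v : L2 mu2 Omega f -> L2 mu2 Omega g ->
  {ae mu2, forall x, Omega x -> f x = g x} -> Vh k v -> load f v = load g v.
Proof.
move=> fL gL fg hv; apply: eq_bigr => T _.
have [vL _] := Vh_square_integrable hv T.
have i1 := L2_mul_integrable (mT T) (L2_cell T fL) vL.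
have i2 := L2_mul_integrable (mT T) (L2_cell T gL) vL.
congr fine; apply: ae_eq_integral => //; [exact: measurable_int i1|exact: measurable_int i2|].
apply: filterS fg => x h Tx; rewrite /= h//; exact: (cell_sub hM Tx).
Qed.

Lemma neg_laplacian_L2 u : H2 Omega u -> L2 mu2 Omega (neg_laplacian Omega u).
Proof.
move=> [_ hu]; have h i := H1_L2_wderiv (hu i) i.
rewrite (_ : neg_laplacian Omega u = fun x => -1 * (wderiv Omega ord0 (wderiv Omega ord0 u) x +
    wderiv Omega ord_max (wderiv Omega ord_max u) x)); last first.
  by apply/funext => x; rewrite /neg_laplacian sum_ord2 mulN1r.
by apply: L2_scale => //; apply: L2_add.
Qed.

End Consistency.

(** * The error equations *)

Theorem theorem4p1 (R : realType) (Omega : set (plane R))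
  (hOmega : polygonal_domain Omega) (hLip : lipschitz_boundary Omega)
  (M : mesh R) (hM : partition_of Omega M)
  (rho : R) (hrho : 0 < rho) (K : nat) (hreg : shape_regular M rho K)
  (k : nat) (hk : (1 <= k)%N)
  (f : plane R -> R) (hf : L2 mu2 Omega f)
  (u : plane R -> R) (hu : biharmonic_solution Omega f u)
  (phi : plane R -> R) (hphi : phi = neg_laplacian Omega u)
  (hphi2 : H2 Omega phi)
  (phih uh : wfun M) (hsol : wg_solution Omega k f phih uh)
  (PRu : wfun M) (hPRu : is_ritz_projection Omega k u PRu)
  (PNphi : wfun M) (hPNphi : is_neumann_projection Omega k phi PNphi) :
  let eps_u := wsub PRu uh in
  let eps_phi := wsub PNphi phih in
  (forall v : wfun M, Vh k v ->
     form_a eps_phi v - form_b k v eps_u =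
     error_functional Omega k phi u PNphi PRu v) /\
  (forall psi : wfun M, Vh0 Omega k psi -> form_b k eps_phi psi = 0).
Proof.
have [oO _ _ bO] := hOmega.1.
have [phihV uhV eq1 eq2] := hsol.
have [[PNV _] PNE] := hPNphi; have [[PRV _] _] := hPRu.
have L w (hw : Vh k w) : square_integrable w := Vh_square_integrable hM hw.
have phiL : L2 mu2 Omega phi by case: hphi2 => -[].
have HL := of_H1_square_integrable hM oO phiL.
have UL : square_integrable (of_H1 Omega M u).
  by apply: (of_H1_square_integrable hM oO); case: hu => -[[]].
split=> [v hv|psi hpsi].
  have eL (w : wfun M) (hw : Vh k w) T e (eT : e \in sides T) :
      L2 mu1 `[0, 1] (v0 w T \o param (ends e)) := Vh_edge_L2 hM hw eT.
  rewrite /error_functional.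
  rewrite (form_a_subl hM (L _ PNV) (L _ phihV) (L _ hv)); last first.
    by move=> T e eT; split; exact: eL.
  rewrite (form_a_subl hM (L _ PNV) HL (L _ hv)); last first.
    move=> T e eT; split; [exact: eL| |exact: eL].
    apply: eq_L2 (@trace_edge_L2 _ Omega _ e phi) => t; rewrite /= in_itv/= => t01.
    by rewrite asboolF//; case: (side_on_boundary hM eT t01).
  rewrite (form_b_subr hM k (L _ hv) (L _ PRV) (L _ uhV.1)).
  rewrite (form_b_subr hM k (L _ hv) UL (L _ PRV)).
  rewrite form_a_of_H1//; rewrite [in load _ _]hphi.
  rewrite (consistency hM oO bO hrho hreg hu hv).
  move: (eq1 _ hv); move: (form_a PNphi v) (form_a phih v) (form_b k v PRu)
    (form_b k v uh) (form_b k v _) (form_l _ _ _ _) => a b c d e l /eqP.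
  by rewrite subr_eq0 => /eqP ->; ring.
have [psiV psi0] := hpsi.
rewrite form_b_sym (form_b_subr hM k (L _ psiV) (L _ PNV) (L _ phihV)).
rewrite [X in X - _]form_b_sym [X in _ - X]form_b_sym PNE// eq2// big1 ?addr0; last first.
  move=> e be; rewrite (@eq_eint _ _ _ (fun=> 0)) => [|t t01].
    by rewrite /eint Rintegral_cst ?mul0r ?mulr0.
  by rewrite psi0 ?mulr0//; exists t.
rewrite (load_ae hM oO _ hf _ psiV) ?subrr//; first exact: neg_laplacian_L2.
by case: hu => _ + _ _; rewrite hphi.
Qed.
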